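(* A complex algebraic LNE model of a smooth connected complex algebraic curve need not exist: there exists a smooth connected complex affine algebraic curve $X\subset\mathbb{C}^n$ (for some $n$) such that for no $m$ is there a complex algebraic set $Y\subset\mathbb{C}^m$ that is an LNE model of $X$ in $\mathbb{C}^m$.
   Context: $\mathbb{C}^n$ carries the Euclidean metric of $\mathbb{R}^{2n}$. For a subset $X$ of a metric space $(M,d)$, the outer metric on $X$ is the restriction of $d$, and the inner metric $d_X$ is given by the infimum of lengths of continuous curves in $X$ connecting the given points. A map $f:(M,d)\to(N,d')$ is bi-Lipschitz if there is $L>0$ with $\frac1L d(x,y)\le d'(f(x),f(y))\le L\,d(x,y)$ for all $x,y$. The set $X\subset M$ is Lipschitz normally embedded (LNE) in $M$ if $\mathrm{id}:(X,d)\to(X,d_X)$ is bi-Lipschitz. If $f:X\to N$ is a map into a metric space $N$, $Y:=f(X)$ is LNE in $N$, and $f:(X,d_X)\to(Y,d_Y)$ is bi-Lipschitz with respect to the inner metrics, then $Y$ is called an LNE model of $X$ in $N$. *)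

(* Defs.v *)
From HB Require Import structures.
From mathcomp Require Import all_boot all_order all_algebra.
From mathcomp Require Import all_classical all_reals all_analysis.
From mathcomp Require Import ring.
From mathcomp.real_closed Require Import complex.
(* The notations of mpoly clash with those of all_analysis; without them, the
   polynomial ring is [mpoly n K], evaluation is [meval] and the i-th partial
   derivative is [mderiv i]. *)
From mathcomp.multinomials Require Import -(notations) mpoly.

Set Implicit Arguments.
Unset Strict Implicit.
Unset Printing Implicit Defensive.

Import Order.TTheory GRing.Theory Num.Theory.

Local Open Scope classical_set_scope.
Local Open Scope ring_scope.

(* An alias of 'rV[R[i]]_n that carries the Euclidean distance of R^(2n), in
   place of the sup norm attached to matrices. *)
Definition cspace (R : realType) (n : nat) : Type := 'rV[R[i]]_n.

HB.instance Definition _ (R : realType) (n : nat) :=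
  GRing.Lmodule.copy (cspace R n) 'rV[R[i]]_n.

Section EuclideanDistance.
Variable R : realType.

Definition l2norm (I : finType) (a : I -> R) : R := Num.sqrt (\sum_i a i ^+ 2).

Lemma sum_sqr_ge0 (I : finType) (a : I -> R) : 0 <= \sum_i a i ^+ 2.
Proof. by apply: sumr_ge0 => i _; exact: sqr_ge0. Qed.

Lemma cauchy_schwarz (I : finType) (a b : I -> R) :
  (\sum_i a i * b i) ^+ 2 <= (\sum_i a i ^+ 2) * (\sum_i b i ^+ 2).
Proof.
set S := \sum_i a i * b i; set A := \sum_i a i ^+ 2; set B := \sum_i b i ^+ 2.
have [B0|Bn0] := eqVneq B 0.
  have b0 i : b i = 0.
    apply/eqP; rewrite -sqrf_eq0; apply/eqP.
    exact: (psumr_eq0P (fun j _ => sqr_ge0 (b j)) B0).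
  rewrite /S big1 ?expr0n ?B0 ?mulr0// => i _.
  by rewrite b0 mulr0.
have Bgt0 : 0 < B by rewrite lt_neqAle eq_sym Bn0 sum_sqr_ge0.
have : 0 <= \sum_i (B * a i - S * b i) ^+ 2 by exact: sum_sqr_ge0.
have -> : \sum_i (B * a i - S * b i) ^+ 2 = B * (A * B - S ^+ 2).
  transitivity (\sum_i (B ^+ 2 * a i ^+ 2 - 2 * B * S * (a i * b i)
                        + S ^+ 2 * b i ^+ 2)).
    by apply: eq_bigr => i _; ring.
  rewrite big_split/= sumrB -!mulr_sumr -/A -/B -/S.
  by ring.
by rewrite pmulr_rge0// subr_ge0.
Qed.

Lemma l2normD (I : finType) (a b : I -> R) :
  l2norm (fun i => a i + b i) <= l2norm a + l2norm b.
Proof.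
have ge0 : 0 <= l2norm a + l2norm b by rewrite addr_ge0 ?sqrtr_ge0.
rewrite -(@ler_pXn2r _ 2)// ?nnegrE ?sqrtr_ge0// sqrrD !sqr_sqrtr ?sum_sqr_ge0//.
rewrite (eq_bigr (fun i => a i ^+ 2 + 2 * (a i * b i) + b i ^+ 2)); last first.
  by move=> i _; ring.
rewrite !big_split/= -mulr_sumr lerD2r lerD2l -[leRHS]mulr_natl ler_wpM2l//.
rewrite -sqrtrM ?sum_sqr_ge0// (le_trans (ler_norm _))//.
by rewrite -sqrtr_sqr ler_wsqrtr// cauchy_schwarz.
Qed.

Variable n : nat.
Implicit Types x y z : cspace R n.

Definition eucl_dist x y : R :=
  Num.sqrt (\sum_(i < n) (complex.Re (x ord0 i - y ord0 i) ^+ 2 +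
                          complex.Im (x ord0 i - y ord0 i) ^+ 2)).

Definition real_coord x (k : 'I_n * bool) : R :=
  if k.2 then complex.Re (x ord0 k.1) else complex.Im (x ord0 k.1).

Lemma eucl_distE x y :
  eucl_dist x y = l2norm (fun k => real_coord x k - real_coord y k).
Proof.
rewrite /eucl_dist /l2norm; congr Num.sqrt.
rewrite -(pair_bigA _ (fun i j =>
  (real_coord x (i, j) - real_coord y (i, j)) ^+ 2))/=.
apply: eq_bigr => i _; rewrite big_bool/= /real_coord/=.
by case: (x ord0 i) => a b; case: (y ord0 i).
Qed.

Lemma eucl_distxx x : eucl_dist x x = 0.
Proof.
by rewrite eucl_distE /l2norm big1 ?sqrtr0// => k _; rewrite subrr expr0n.
Qed.

Lemma eucl_dist_positivity x y : eucl_dist x y = 0 -> x = y.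
Proof.
rewrite eucl_distE /l2norm => /eqP; rewrite sqrtr_eq0 => s0.
have {}s0 : \sum_k (real_coord x k - real_coord y k) ^+ 2 = 0.
  by apply/eqP; rewrite eq_le s0 sum_sqr_ge0.
have xy k : real_coord x k = real_coord y k.
  apply/eqP; rewrite -subr_eq0 -sqrf_eq0; apply/eqP.
  exact: (psumr_eq0P
    (fun j _ => sqr_ge0 (real_coord x j - real_coord y j)) s0).
apply/matrixP => i j; rewrite (ord1 i).
move: (xy (j, true)) (xy (j, false)); rewrite /real_coord/=.
by case: (x ord0 j) => a b; case: (y ord0 j) => c d /= -> ->.
Qed.

Lemma eucl_dist_sym x y : eucl_dist x y = eucl_dist y x.
Proof.
rewrite !eucl_distE; congr Num.sqrt.
by apply: eq_bigr => k _; rewrite -sqrrN opprB.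
Qed.

Lemma eucl_dist_triangle y x z :
  eucl_dist x z <= eucl_dist x y + eucl_dist y z.
Proof.
rewrite !eucl_distE (le_trans _ (l2normD _ _))// /l2norm.
rewrite ler_wsqrtr// ler_sum// => k _.
by rewrite addrA subrK.
Qed.

HB.instance Definition _ := @isMetric.Build R (cspace R n) eucl_dist
  eucl_distxx eucl_dist_positivity eucl_dist_sym eucl_dist_triangle.

End EuclideanDistance.

Section InnerMetric.
Variables (R : realType) (M : metricType R).
Implicit Types (X : set M) (x y : M) (g : R -> M).

Definition polygonal_length g (s : seq R) : R :=
  let F := g \o nth 1 (0 :: s) in
  \sum_(0 <= k < size s) mdist (F k) (F k.+1).

Definition curve_length g : \bar R :=
  ereal_sup [set (polygonal_length g s)%:E | s in itv_partition 0 1].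

Definition curve_in X x y g : Prop :=
  [/\ {within `[0, 1], continuous g}, g 0 = x, g 1 = y &
      forall t, t \in `[0, 1] -> X (g t)].

Definition outer_dist x y : \bar R := (mdist x y)%:E.

(* The infimum is +oo when no rectifiable curve of X joins x to y. *)
Definition inner_dist X x y : \bar R :=
  ereal_inf [set curve_length g | g in curve_in X x y].

End InnerMetric.

Definition bilipschitz (R : realType) (S T : Type) (X : set S)
    (dS : S -> S -> \bar R) (dT : T -> T -> \bar R) (f : S -> T) : Prop :=
  exists2 L : R, 0 < L & forall x y, X x -> X y ->
    (L^-1%:E * dS x y <= dT (f x) (f y) <= L%:E * dS x y)%E.

Definition LNE (R : realType) (M : metricType R) (X : set M) : Prop :=
  bilipschitz X (@outer_dist R M) (inner_dist X) id.

(* Only the values of f on X matter. *)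
Definition LNE_model (R : realType) (M N : metricType R)
    (X : set M) (Y : set N) : Prop :=
  exists f : M -> N,
    [/\ Y = f @` X, LNE Y & bilipschitz X (inner_dist X) (inner_dist Y) f].

Section AlgebraicSets.
Variables (R : realType) (n : nat).
Implicit Types (X Z : set (cspace R n)) (f : mpoly n R[i]).

Definition peval f (x : cspace R n) : R[i] := meval (x ord0) f.

Definition algebraic_set X : Prop :=
  exists fs : seq (mpoly n R[i]),
    X = [set x | forall f, f \in fs -> peval f x = 0].

Definition vanishes_on X f : Prop := forall x, X x -> peval f x = 0.

Definition irreducible_set Z : Prop :=
  [/\ algebraic_set Z, Z !=set0 &
      forall A B, algebraic_set A -> algebraic_set B ->
        Z `<=` A `|` B -> Z `<=` A \/ Z `<=` B].

Definition irreducible_chain X (d : nat) (C : nat -> set (cspace R n)) : Prop :=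
  [/\ forall i, (i <= d)%N -> irreducible_set (C i),
      forall i, (i <= d)%N -> C i `<=` X &
      forall i, (i < d)%N -> C i `<` C i.+1].

(* Krull dimension for the Zariski topology. *)
Definition algebraic_dim X (d : nat) : Prop :=
  (exists C, irreducible_chain X d C) /\
  (forall e, (exists C, irreducible_chain X e C) -> (e <= d)%N).

Definition tangent_space X (p : cspace R n) : set 'rV[R[i]]_n :=
  [set v : 'rV[R[i]]_n | forall f, vanishes_on X f ->
     \sum_(i < n) peval (mderiv i f) p * v ord0 i = 0].

(* Every Zariski tangent space has dimension d; when d is the dimension of X
   this is the Jacobian criterion for X to be nonsingular of pure dimension. *)
Definition smooth_of_dim X (d : nat) : Prop :=
  forall p, X p -> exists2 V : {vspace 'rV[R[i]]_n},
    \dim V = d & forall v, v \in V <-> tangent_space X p v.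

Definition smooth_affine_curve X : Prop :=
  [/\ algebraic_set X, algebraic_dim X 1 & smooth_of_dim X 1].

End AlgebraicSets.

(* Main.v *)
From HB Require Import structures.
Require Import Defs.
From mathcomp Require Import all_boot all_order all_algebra.
From mathcomp Require Import all_classical all_reals all_analysis.
From mathcomp Require Import closed_field archimedean.
From mathcomp Require Import ring lra zify.
From mathcomp.real_closed Require Import complex.
From mathcomp.multinomials Require Import -(notations) mpoly.

Set Implicit Arguments.
Unset Strict Implicit.
Unset Printing Implicit Defensive.

Import Order.TTheory GRing.Theory Num.Theory.
Import numFieldNormedType.Exports.

Local Open Scope classical_set_scope.
Local Open Scope ring_scope.

(** The curve X : y^2 = x - x^3 is an elliptic curve minus one point. Suppose
    that a complex algebraic set Y of C^m is an LNE model of X through a map F.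
    The outer distance of Y is comparable with its inner distance, hence with the
    inner distance of X, so F is a homeomorphism from X to Y with a Lipschitz
    inverse ([model_cont], [model_inverse_lipschitz]). The proof shows that Y is
    the graph of a continuous map over a complex line, so that X would be
    homeomorphic to a plane, which the genus of X forbids.

    Dimension. The curve is a countable union of Lipschitz images of discs, so by
    Baire's theorem and a counting argument its image in C^2 under two coordinates
    of F has empty interior. By elimination of quantifiers over C, the
    projection of Y to these coordinates contains or misses the complement of a
    plane algebraic curve. It must miss it, so any two coordinates of Y satisfy a
    nontrivial polynomial equation ([projection_dichotomy], [model_dependent]).

    Direction at infinity. The homogeneous parts of top degree of these equations
    leave finitely many directions for the points of Y close to infinity
    ([top_form]). As X has a single end ([curve_end_connected]), only one
    direction occurs: for some coordinate z and constants a_j, the points y of Y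
    satisfy y_j = a_j z + o(|z|) for all j ([single_direction]).

    Degree. Two points of Y with the same large z are at distance o(|z|), so, Y
    being LNE, a path of length o(|z|) in Y joins them. Its image under z is a
    loop in a small square that contains no branch point of the equations between
    z and the y_j. The roots of such an equation form a trivial covering of the
    square, hence the two points agree ([root_loop_closes], [far_injective]). By
    elimination of quantifiers again, z is a bijection from Y to C up to finitely
    many values of z, which are dealt with by properness and by connectedness of
    punctured neighbourhoods ([model_is_graph]).

    Topology. The map (t, s) |-> (t^2, t s) is a double covering of X by the curve
    s^2 = 1 - t^4, without ramification. If X were homeomorphic to a plane the
    covering would be trivial, but the path (t, sqrt (1 - t^4)), for t from -1 to
    1, joins the two points above (1, 0) ([curve_not_plane]). *)

(** * Moduli, coordinates and distances *)

(** The modulus as a real number: the norm of [R[i]] takes its values in [R[i]]. *)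
Notation cm := Normc.normc.
Arguments Normc.normc : simpl never.

Section Modulus.
Variable R : realType.
Local Notation C := R[i].
Implicit Types (z w : C).

Lemma cmE z : cm z = Num.sqrt (complex.Re z ^+ 2 + complex.Im z ^+ 2).
Proof. by case: z. Qed.

Lemma cm_ge0 z : 0 <= cm z.
Proof. by rewrite cmE sqrtr_ge0. Qed.

Lemma cm0 : cm (0 : C) = 0. Proof. exact: Normc.normc0. Qed.
Lemma cm1 : cm (1 : C) = 1. Proof. exact: Normc.normc1. Qed.

Lemma cmN z : cm (- z) = cm z. Proof. exact: normcN. Qed.

Lemma cmM z w : cm (z * w) = cm z * cm w.
Proof. exact: Normc.normcM. Qed.

Lemma cmV z : cm z^-1 = (cm z)^-1.
Proof. exact: Normc.normcV. Qed.

Lemma cmX z n : cm (z ^+ n) = cm z ^+ n.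
Proof. by elim: n => [|n IH]; rewrite ?expr0 ?cm1// !exprS cmM IH. Qed.

Lemma cmD z w : cm (z + w) <= cm z + cm w.
Proof. exact: le_normcD. Qed.

Lemma cmB z w : cm (z - w) <= cm z + cm w.
Proof. by rewrite -(cmN w) cmD. Qed.

Lemma cm_distC z w : cm (z - w) = cm (w - z).
Proof. by rewrite -cmN opprB. Qed.

Lemma cm_tri u z w : cm (z - w) <= cm (z - u) + cm (u - w).
Proof. by have := cmD (z - u) (u - w); rewrite addrA subrK. Qed.

Lemma cm_leD z w : cm z <= cm w + cm (z - w).
Proof. by rewrite -[X in cm X <= _](subrK w) addrC cmD. Qed.

Lemma cm_eq0 z : (cm z == 0) = (z == 0).
Proof.
by apply/eqP/eqP => [|->]; [exact: Normc.eq0_normc | rewrite cm0].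
Qed.

Lemma cm_gt0 z : (0 < cm z) = (z != 0).
Proof. by rewrite lt_neqAle cm_ge0 andbT eq_sym cm_eq0. Qed.

Lemma cm_sum (I : Type) (r : seq I) (P : pred I) (F : I -> C) :
  cm (\sum_(i <- r | P i) F i) <= \sum_(i <- r | P i) cm (F i).
Proof.
elim/big_rec2 : _ => [|i x y _ h]; first by rewrite cm0.
by rewrite (le_trans (cmD _ _))// lerD2l.
Qed.

Lemma cm_prod (I : Type) (r : seq I) (P : pred I) (F : I -> C) :
  cm (\prod_(i <- r | P i) F i) = \prod_(i <- r | P i) cm (F i).
Proof. by elim/big_rec2 : _ => [|i x y _ <-]; rewrite ?cm1 ?cmM. Qed.

Lemma Re_le_cm z : `|complex.Re z| <= cm z.
Proof. by rewrite cmE -sqrtr_sqr ler_wsqrtr// lerDl sqr_ge0. Qed.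

Lemma Im_le_cm z : `|complex.Im z| <= cm z.
Proof. by rewrite cmE -sqrtr_sqr ler_wsqrtr// lerDr sqr_ge0. Qed.

Lemma cm_le_ReIm z : cm z <= `|complex.Re z| + `|complex.Im z|.
Proof.
rewrite cmE -(@ler_pXn2r _ 2)// ?nnegrE ?sqrtr_ge0 ?addr_ge0//.
rewrite sqr_sqrtr ?addr_ge0 ?sqr_ge0// sqrrD !real_normK ?num_real//.
by rewrite [leRHS]addrAC lerDl mulrn_wge0// mulr_ge0.
Qed.

Lemma cm_real (a : R) : cm (a%:C)%C = `|a|.
Proof. by rewrite cmE /= expr0n/= addr0 sqrtr_sqr. Qed.

Lemma cmsq z : cm z ^+ 2 = complex.Re z ^+ 2 + complex.Im z ^+ 2.
Proof. by rewrite cmE sqr_sqrtr// addr_ge0 ?sqr_ge0. Qed.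

End Modulus.

Lemma sum_sqr_le_sqr_sum (R : realType) (I : Type) (r : seq I) (a : I -> R) :
  (forall i, 0 <= a i) -> \sum_(i <- r) a i ^+ 2 <= (\sum_(i <- r) a i) ^+ 2.
Proof.
move=> a0; elim: r => [|i r IH]; first by rewrite !big_nil expr0n.
rewrite !big_cons sqrrD -addrA lerD2l (le_trans IH)// lerDr mulrn_wge0// mulr_ge0//.
exact: sumr_ge0.
Qed.

Section Coordinates.
Variables (R : realType) (m : nat).
Local Notation C := R[i].
Implicit Types (x y : cspace R m).

Definition co y (j : 'I_m) : C := y ord0 j.

Lemma cspace_eqP x y : (forall j, co x j = co y j) -> x = y.
Proof. by move=> h; apply/rowP => j; exact: h. Qed.

Lemma mdist_sqrt x y :
  mdist x y = Num.sqrt (\sum_(i < m) cm (co x i - co y i) ^+ 2).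
Proof. by congr Num.sqrt; apply: eq_bigr => i _; rewrite cmsq. Qed.

Lemma co_le_mdist x y j : cm (co x j - co y j) <= mdist x y.
Proof.
rewrite mdist_sqrt -[leLHS](@ger0_norm R) ?cm_ge0// -sqrtr_sqr ler_wsqrtr//.
by rewrite (bigD1 j)//= lerDl sumr_ge0// => i _; rewrite sqr_ge0.
Qed.

Lemma mdist_le_sum x y : mdist x y <= \sum_(j < m) cm (co x j - co y j).
Proof.
have s0 : 0 <= \sum_(j < m) cm (co x j - co y j).
  by apply: sumr_ge0 => i _; exact: cm_ge0.
rewrite mdist_sqrt -(@ler_pXn2r _ 2)// ?nnegrE ?sqrtr_ge0//.
rewrite sqr_sqrtr; last by apply: sumr_ge0 => i _; rewrite sqr_ge0.
by apply: sum_sqr_le_sqr_sum => i; exact: cm_ge0.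
Qed.

Lemma mdist_lt_unif x y e : 0 < e ->
  (forall j, cm (co x j - co y j) < e / m.+1%:R) -> mdist x y < e.
Proof.
move=> e0 h; apply: le_lt_trans (mdist_le_sum x y) _.
apply: (@le_lt_trans _ _ (\sum_(j < m) e / m.+1%:R)).
  by apply: ler_sum => j _; exact: ltW.
rewrite sumr_const card_ord -[ltLHS]mulr_natr -mulrA gtr_pMr// mulrC.
by rewrite ltr_pdivrMr// mul1r ltr_nat.
Qed.

End Coordinates.

(** The metric form of continuity within [A], see [cont_onP]. *)
Definition cont_on (R : realType) (M N : metricType R) (A : set M) (f : M -> N) :=
  forall x, A x -> forall e, 0 < e -> exists2 d, 0 < d &
    forall y, A y -> mdist x y < d -> mdist (f x) (f y) < e.

Section MetricContinuity.
Variable (R : realType).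
Implicit Types (M N : metricType R).

Lemma nbhs_mdistP M (x : M) (P : set M) :
  nbhs x P <-> exists2 d, 0 < d & forall y, mdist x y < d -> P y.
Proof.
rewrite nbhs_ballP; split=> [[d d0 h]|[d d0 h]]; exists d => // y.
  by move=> xy; apply: h; rewrite ballEmdist.
by rewrite ballEmdist; exact: h.
Qed.

Lemma cont_onP M N (A : set M) (f : M -> N) :
  {within A, continuous f} <-> cont_on A f.
Proof.
rewrite subspace_continuousP; split=> [h x Ax e e0|h x Ax].
  have /(h x Ax) : nbhs (f x) [set z | mdist (f x) z < e].
    by apply/nbhs_mdistP; exists e.
  rewrite /nbhs/= /within/= => /nbhs_mdistP[d d0 hd]; exists d => // y Ay xy.
  exact: hd.
move=> P /nbhs_mdistP[e e0 he]; have [d d0 hd] := h x Ax e e0.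
by apply/nbhs_mdistP; exists d => // y xy Ay; apply/he/hd.
Qed.

Lemma mdistRE (x y : R^o) : mdist x y = `|y - x|.
Proof. by []. Qed.

Lemma cont_on_sub M N (A B : set M) (f : M -> N) :
  B `<=` A -> cont_on A f -> cont_on B f.
Proof.
move=> BA h x /BA Ax e e0; have [d d0 hd] := h x Ax e e0.
by exists d => // y /BA; exact: hd.
Qed.

Lemma cont_on_comp M N (P : metricType R) (A : set M) (B : set N)
    (f : M -> N) (g : N -> P) :
  (forall x, A x -> B (f x)) -> cont_on A f -> cont_on B g ->
  cont_on A (g \o f).
Proof.
move=> AB cf cg x Ax e e0; have [d d0 hd] := cg _ (AB _ Ax) e e0.
have [d' d'0 hd'] := cf x Ax d d0; exists d' => // y Ay xy.
by apply: hd (AB _ Ay) (hd' _ Ay xy).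
Qed.

Lemma cont_on_coP M m (A : set M) (f : M -> cspace R m) :
  (forall j x, A x -> forall e, 0 < e -> exists2 d, 0 < d &
    forall y, A y -> mdist x y < d -> cm (co (f x) j - co (f y) j) < e) ->
  cont_on A f.
Proof.
move=> h x Ax e e0; have e'0 : 0 < e / m.+1%:R by rewrite divr_gt0.
have /choice[d hd] : forall j : 'I_m, exists d, 0 < d /\
    forall y, A y -> mdist x y < d -> cm (co (f x) j - co (f y) j) < e / m.+1%:R.
  by move=> j; have [d d0 hd] := h j x Ax _ e'0; exists d.
exists (\big[Order.min/1]_(j < m) d j).
  by apply: lt_bigmin => // j _; exact: (hd j).1.
move=> y Ay xy; apply: mdist_lt_unif => // j.
apply: (hd j).2 => //; apply: lt_le_trans xy _.
exact: bigmin_le_cond.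
Qed.

(** The form of compactness that yields Lebesgue numbers and uniform bounds. *)
Lemma compact_lebesgue M (K : set M) (P : R -> M -> Prop) : compact K ->
  (forall x, K x -> exists2 d, 0 < d &
     forall y, K y -> mdist x y < d -> forall e, 0 < e -> e < d -> P e y) ->
  exists2 d, 0 < d & forall x, K x -> P d x.
Proof.
move=> /compact_near_coveringP cK h.
have : \forall e \near 0^'+, K `<=` (fun x => K x -> P e x).
  apply: cK => x Kx; have [d d0 hd] := h x Kx.
  exists ([set y | mdist x y < d], [set e | 0 < e < d]) => /=.
    split; first by apply/nbhs_mdistP; exists d.
    by near=> e => /=; apply/andP; split; near: e;
      [exact: nbhs_right_gt|exact: nbhs_right_lt].
  by move=> [y e]/= [xy /andP[e0 ed]] Ky; exact: hd.
move=> hn; have [e [he e0]] : exists e, (K `<=` (fun x => K x -> P e x)) /\ 0 < e.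
  have F : ProperFilter ((0:R)^'+) by exact: at_right_proper_filter.
  near (0:R)^'+ => e; exists e; split; near: e => //.
  exact: nbhs_right_gt.
by exists e => // x Kx; exact: he.
Unshelve. all: by end_near. Qed.

End MetricContinuity.
Lemma cont_on_curve (R : realType) (N : metricType R) (A : set R) (f : R -> N) :
  {within A, continuous f} <-> @cont_on R R^o N A f.
Proof. exact: (@cont_onP R R^o). Qed.

(** * Compact and connected sets in C^m *)

Section HeineBorel.
Variables (R : realType) (m : nat).

Let of_real (v : 'rV[R]_(m + m)) : cspace R m :=
  \row_j (v ord0 (lshift m j) +i* v ord0 (rshift m j))%C.

Let of_real_continuous : continuous of_real.
Proof.
move=> v P /nbhs_mdistP[e e0 hP].
have e'0 : 0 < e / m.+1%:R / 2 by rewrite !divr_gt0.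
apply/nbhs_ballP; exists (e / m.+1%:R / 2) => //= w vw; apply: hP.
apply: mdist_lt_unif => // j; rewrite /co !mxE/=.
apply: (le_lt_trans (cm_le_ReIm _)) => /=.
by rewrite [ltRHS]splitr ltrD//; exact: (vw.2 _ _).
Qed.

(** The Heine-Borel property, transported from R^(2m). *)
Lemma cspace_compact (K : set (cspace R m)) (b : R) : closed K ->
  (forall y, K y -> forall j, cm (co y j) <= b) -> compact K.
Proof.
move=> clK bK.
pose box := [set v : 'rV[R]_(m + m) | forall i, `[-b, b]%classic (v ord0 i)].
have cbox : compact (box `&` of_real @^-1` K).
  apply: compact_closedI; first by apply: (@rV_compact R (m + m) (fun=> `[-b, b]%classic)) => i; exact: segment_compact.
  by apply: closed_comp => // v _; exact: of_real_continuous.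
suff -> : K = of_real @` (box `&` of_real @^-1` K).
  by apply: continuous_compact => //; exact: continuous_subspaceT.
apply/seteqP; split=> [y Ky|y [v [_ ?]] <-//].
have vy : of_real (row_mx (\row_j complex.Re (co y j)) (\row_j complex.Im (co y j))) = y.
  by apply/cspace_eqP => j; rewrite /co mxE row_mxEl row_mxEr !mxE; case: (y _ _).
eexists; last exact: vy.
split; last by rewrite /preimage/= vy.
move=> i /=; rewrite in_itv/= -ler_norml.
case: (split_ordP i) => j ->; rewrite ?row_mxEl ?row_mxEr mxE.
- exact: le_trans (Re_le_cm _) (bK _ Ky j).
- exact: le_trans (Im_le_cm _) (bK _ Ky j).
Qed.

End HeineBorel.

Section ImagesOfCompacts.
Variables (R : realType) (M N : metricType R).

Lemma compact_image (K : set M) (f : M -> N) :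
  compact K -> cont_on K f -> compact (f @` K).
Proof. by move=> cK /cont_onP cf; exact: continuous_compact. Qed.

Lemma closed_image (K : set M) (f : M -> N) :
  compact K -> cont_on K f -> closed (f @` K).
Proof.
by move=> cK cf; apply: compact_closed (compact_image cK cf); exact: metric_hausdorff.
Qed.

Lemma closedP_mdist (A : set M) :
  closed A <-> forall x, (forall e, 0 < e -> exists2 y, A y & mdist x y < e) -> A x.
Proof.
split=> clA x h; apply: clA.
  move=> P /nbhs_mdistP[d d0 hP]; have [y Ay xy] := h d d0.
  by exists y; split => //; exact: hP.
move=> e e0; have [|y [Ay xy]] := h [set y | mdist x y < e].
  by apply/nbhs_mdistP; exists e.
by exists y.
Qed.

Lemma compact_bounded_from (K : set M) (x0 : M) :
  compact K -> exists b, forall x, K x -> mdist x0 x <= b.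
Proof.
move=> cK.
have [x Kx|d d0 h] := @compact_lebesgue R M K
   (fun e x => mdist x0 x < e^-1) cK.
  have h0 : 0 < mdist x0 x + 2 by rewrite ltr_wpDl ?mdist_ge0.
  exists (mdist x0 x + 2)^-1; first by rewrite invr_gt0.
  move=> y Ky xy e e0 ed; apply: (le_lt_trans (metric_triangle _ x _)).
  apply: (@lt_trans _ _ (mdist x0 x + 2)); last by rewrite -[ltLHS]invrK ltf_pV2// posrE invr_gt0.
  rewrite ltrD2l (lt_le_trans xy)// (@le_trans _ _ 1)// ?ler1n//.
  by rewrite invf_le1// (@le_trans _ _ 2)// ?ler1n// lerDr mdist_ge0.
by exists d^-1 => x Kx; exact/ltW/h.
Qed.

Lemma connected_image (A : set M) (f : M -> N) :
  connected A -> cont_on A f -> connected (f @` A).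
Proof. by move=> cA /cont_onP cf; exact: connected_continuous_connected. Qed.

End ImagesOfCompacts.

Lemma connected_ivt (R : realType) (M : metricType R) (A : set M) (f : M -> R)
    (x y : M) (c : R) :
  connected A -> @cont_on R M R^o A f -> A x -> A y -> f x < c -> c < f y ->
  exists2 z, A z & f z = c.
Proof.
move=> cA cf Ax Ay xc cy.
have /connected_intervalP : connected ((f : M -> R^o) @` A) by exact: connected_image.
move=> itv; have [|||z Az zc] := itv (f x) (f y) _ _ c.
- by exists x.
- by exists y.
- by rewrite (ltW xc) (ltW cy).
by exists z.
Qed.

Lemma curve_connected (R : realType) (M : metricType R) (g : R -> M) (a b : R) :
  @cont_on R R^o M `[a, b] g -> connected (g @` `[a, b]).
Proof.
move=> cg; apply: (@connected_image R R^o M) => //.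
exact: segment_connected.
Qed.

(** * Coverings of a rectangle *)

Section PlaneDomain.
Variable R : realType.
Local Notation C := R[i].
Local Notation U := (cspace R 1).
Implicit Types (u v : U).

Definition pt (z : C) : U := const_mx z.
Definition cx (u : U) : C := co u ord0.

Lemma ptK z : cx (pt z) = z. Proof. by rewrite /cx /co mxE. Qed.
Lemma cxK u : pt (cx u) = u.
Proof. by apply/cspace_eqP => j; rewrite ord1 -/(cx _) ptK. Qed.

Lemma mdist_cx u v : mdist u v = cm (cx u - cx v).
Proof. by rewrite mdist_sqrt big_ord1 sqrtr_sqr ger0_norm// cm_ge0. Qed.

Lemma closed_le_lip (M : metricType R) (f : M -> R) c :
  (forall x y, `|f x - f y| <= mdist x y) -> closed [set x | f x <= c].
Proof.
move=> lf; apply/closedP_mdist => x h /=; rewrite leNgt; apply/negP => cx.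
have [|y /= yc xy] := h (f x - c); first by rewrite subr_gt0.
have := le_lt_trans (lf x y) xy; rewrite ltNge => /negP; apply.
by rewrite (le_trans _ (ler_norm _))// lerD2l lerN2.
Qed.

Definition rect (x0 x1 y0 y1 : R) : set U :=
  [set u | [/\ x0 <= complex.Re (cx u), complex.Re (cx u) <= x1,
               y0 <= complex.Im (cx u) & complex.Im (cx u) <= y1]].

Lemma Re_lip u v : `|complex.Re (cx u) - complex.Re (cx v)| <= mdist u v.
Proof.
by rewrite mdist_cx (le_trans _ (Re_le_cm _))//; case: (cx u) (cx v) => ? ? [].
Qed.

Lemma Im_lip u v : `|complex.Im (cx u) - complex.Im (cx v)| <= mdist u v.
Proof.
by rewrite mdist_cx (le_trans _ (Im_le_cm _))//; case: (cx u) (cx v) => ? ? [].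
Qed.

Lemma rect_closed x0 x1 y0 y1 : closed (rect x0 x1 y0 y1).
Proof.
have -> : rect x0 x1 y0 y1 =
    ([set u | - complex.Re (cx u) <= - x0] `&` [set u | complex.Re (cx u) <= x1]) `&`
    ([set u | - complex.Im (cx u) <= - y0] `&` [set u | complex.Im (cx u) <= y1]).
  by apply/seteqP; split=> [u [? ? ? ?]|u [[]] /= + ? []];
    rewrite /= ?lerN2; split => //; split => //=; rewrite lerN2.
by apply: closedI; apply: closedI; apply: closed_le_lip => u v;
  rewrite -?opprD ?normrN; rewrite (Re_lip, Im_lip).
Qed.

Lemma rect_compact x0 x1 y0 y1 : compact (rect x0 x1 y0 y1).
Proof.
apply: (@cspace_compact _ _ _ (`|x0| + `|x1| + (`|y0| + `|y1|))) => [|u [a b c d] j].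
  exact: rect_closed.
have bnd (p q x : R) : p <= x -> x <= q -> `|x| <= `|p| + `|q|.
  move=> px xq; rewrite ler_norml.
  have := ler_norm q; have := ler_norm (- p); rewrite normrN.
  have := normr_ge0 p; have := normr_ge0 q => ? ? ? ?; apply/andP; split; lra.
by rewrite ord1 -/(cx u) (le_trans (cm_le_ReIm _))// lerD// bnd.
Qed.

Definition seg (m : nat) (x y : cspace R m) (t : R) : cspace R m :=
  x + (t%:C)%C *: (y - x).

Lemma co_seg m (x y : cspace R m) t j :
  co (seg x y t) j = co x j + (t%:C)%C * (co y j - co x j).
Proof. by rewrite /co /seg !mxE. Qed.

Lemma seg0 m (x y : cspace R m) : seg x y 0 = x.
Proof. by rewrite /seg scale0r addr0. Qed.

Lemma seg1 m (x y : cspace R m) : seg x y 1 = y.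
Proof. by rewrite /seg scale1r addrC subrK. Qed.

Lemma mdist_seg m (x y : cspace R m) s t :
  mdist (seg x y s) (seg x y t) = `|s - t| * mdist x y.
Proof.
rewrite !mdist_sqrt -[X in X * _](@ger0_norm R)// -sqrtr_sqr -sqrtrM ?sqr_ge0//.
congr Num.sqrt; rewrite mulr_sumr; apply: eq_bigr => j _.
rewrite !co_seg -exprMn; congr (_ ^+ _).
rewrite opprD addrACA subrr add0r -mulrBl cmM -rmorphB cm_real.
by rewrite [cm (co y j - _)]cm_distC.
Qed.

Lemma cont_on_lip (M N : metricType R) (A : set M) (f : M -> N) (L : R) :
  (forall x y, A x -> A y -> mdist (f x) (f y) <= L * mdist x y) -> cont_on A f.
Proof.
move=> h x Ax e e0; exists (e / (`|L| + 1)); first by rewrite divr_gt0// ltr_wpDl.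
move=> y Ay xy; apply: le_lt_trans (h _ _ Ax Ay) _.
apply: (@le_lt_trans _ _ ((`|L| + 1) * mdist x y)).
  by rewrite ler_wpM2r ?mdist_ge0// (le_trans (ler_norm _))// lerDl.
by rewrite mulrC -ltr_pdivlMr// ltr_wpDl.
Qed.

Lemma cont_seg m (x y : cspace R m) (A : set R) :
  @cont_on R R^o _ A (seg x y).
Proof.
apply: (@cont_on_lip R^o _ _ _ (mdist x y)) => s t _ _.
by rewrite mdist_seg mdistRE mulrC distrC.
Qed.

Lemma ReD (z w : C) : complex.Re (z + w) = complex.Re z + complex.Re w.
Proof. by case: z w => ? ? []. Qed.
Lemma ImD (z w : C) : complex.Im (z + w) = complex.Im z + complex.Im w.
Proof. by case: z w => ? ? []. Qed.
Lemma ReN (z : C) : complex.Re (- z) = - complex.Re z.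
Proof. by case: z. Qed.
Lemma ImN (z : C) : complex.Im (- z) = - complex.Im z.
Proof. by case: z. Qed.
Lemma Re_realM (t : R) (z : C) : complex.Re ((t%:C)%C * z) = t * complex.Re z.
Proof. by case: z => a b /=; rewrite mul0r subr0. Qed.
Lemma Im_realM (t : R) (z : C) : complex.Im ((t%:C)%C * z) = t * complex.Im z.
Proof. by case: z => a b /=; rewrite mul0r addr0. Qed.

Lemma segR_le (a b t c : R) : 0 <= t <= 1 -> a <= c -> b <= c -> a + t * (b - a) <= c.
Proof. by move=> /andP[? ?] ? ?; nra. Qed.

Lemma segR_ge (a b t c : R) : 0 <= t <= 1 -> c <= a -> c <= b -> c <= a + t * (b - a).
Proof. by move=> /andP[? ?] ? ?; nra. Qed.

Lemma rect_convex x0 x1 y0 y1 u v t : 0 <= t <= 1 ->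
  rect x0 x1 y0 y1 u -> rect x0 x1 y0 y1 v -> rect x0 x1 y0 y1 (seg u v t).
Proof.
move=> t01 [? ? ? ?] [? ? ? ?].
rewrite /rect/= /cx co_seg -!/(cx _) ReD ImD Re_realM Im_realM ReD ReN ImD ImN.
by split; (exact: segR_le || exact: segR_ge).
Qed.

End PlaneDomain.

(** [E z] is the fibre over [z] of a covering of a rectangle [Q]. The fibres vary
    continuously for the Hausdorff distance, and their points are locally
    uniformly separated; for finite fibres this means that they have locally
    constant cardinality. *)
Section Covering.
Variables (R : realType) (T : metricType R).
Local Notation U := (cspace R 1).
Variables (E : U -> T -> Prop) (a0 a1 b0 b1 : R).
Let Q := rect a0 a1 b0 b1.

Hypothesis fiber_continuous : forall z0, Q z0 -> forall e, 0 < e ->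
  exists2 d, 0 < d & forall z, Q z -> mdist z0 z < d ->
    (forall v, E z v -> exists2 v0, E z0 v0 & mdist v v0 < e) /\
    (forall v0, E z0 v0 -> exists2 v, E z v & mdist v v0 < e).

Hypothesis fiber_separated : forall z0, Q z0 -> exists2 s, 0 < s &
  exists2 d, 0 < d & forall z, Q z -> mdist z0 z < d ->
    forall v v', E z v -> E z v' -> mdist v v' < s -> v = v'.

Let uniformly_separated : exists2 s, 0 < s & forall z, Q z ->
  forall v v', E z v -> E z v' -> mdist v v' < s -> v = v'.
Proof.
apply: compact_lebesgue (rect_compact (x0:=a0) (x1:=a1) (y0:=b0) (y1:=b1)) _.
move=> z0 Qz0; have [s s0 [d d0 h]] := fiber_separated Qz0.
exists (Order.min s d); first by rewrite lt_min s0.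
move=> z Qz; rewrite lt_min => /andP[_ zd] e e0; rewrite lt_min => /andP[es _].
by move=> v v' Ev Ev' vv'; exact: (h _ Qz zd _ _ Ev Ev' (lt_trans vv' es)).
Qed.

(* The distance between two lifts is continuous and omits an interval above 0. *)
Let lift_unique (f g : R -> T) (zeta : R -> U) :
  @cont_on R R^o T `[0, 1] f -> @cont_on R R^o T `[0, 1] g ->
  (forall t, `[0, 1]%classic t -> [/\ Q (zeta t), E (zeta t) (f t) & E (zeta t) (g t)]) ->
  f 0 = g 0 -> f 1 = g 1.
Proof.
move=> cf cg h fg0; have [s s0 sep] := uniformly_separated.
have i0 : `[0, 1]%classic (0 : R) by rewrite /= in_itv/= lexx ler01.
have i1 : `[0, 1]%classic (1 : R) by rewrite /= in_itv/= lexx ler01.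
have [Q1 Ef1 Eg1] := h 1 i1.
apply: (sep _ Q1 _ _ Ef1 Eg1); rewrite ltNge; apply/negP => sfg.
have cd : @cont_on R R^o R^o `[0, 1] (fun t => mdist (f t) (g t)).
  move=> t t01 e e0; have e20 : 0 < e / 2 by rewrite divr_gt0.
  have [d d0 hd] := cf t t01 _ e20; have [d' d'0 hd'] := cg t t01 _ e20.
  exists (Order.min d d'); first by rewrite lt_min d0.
  move=> t' t'01; rewrite lt_min => /andP[tt tt'].
  have /= := hd t' t'01 tt; have /= := hd' t' t'01 tt'; rewrite mdistRE.
  have := metric_triangle (f t) (f t') (g t).
  have := metric_triangle (f t') (g t') (g t).
  have := metric_triangle (f t') (f t) (g t').
  have := metric_triangle (f t) (g t) (g t').
  rewrite (metric_sym (f t') (f t)) (metric_sym (g t') (g t)) => ? ? ? ? ? ?.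
  rewrite ltr_norml; apply/andP; split; lra.
have [||t t01 /= tE] := @connected_ivt R R^o `[0, 1]%classic (fun t => mdist (f t) (g t)) 0 1 (s / 2)
  (@segment_connected R 0 1) cd i0 i1.
- by rewrite fg0 mdistxx divr_gt0.
- by rewrite (lt_le_trans _ sfg)// ltr_pdivrMr// ltr_pMr// ltr1n.
have [Qt Eft Egt] := h t t01.
have : f t = g t.
  by apply: (sep _ Qt _ _ Eft Egt); rewrite tE ltr_pdivrMr// ltr_pMr// ltr1n.
by move=> fgt; move: tE; rewrite fgt mdistxx => /eqP; rewrite eq_sym gt_eqF// divr_gt0.
Qed.

(** Triviality of the covering, in a form that can be glued; the sections are
    unique by [lift_unique]. *)
Let trivial_over (A : set U) := forall z1 v1, A z1 -> E z1 v1 ->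
  exists sigma : U -> T, [/\ sigma z1 = v1, forall z, A z -> E z (sigma z) &
                            cont_on A sigma].

Let trivial_over_sub A B : B `<=` A -> trivial_over A -> trivial_over B.
Proof.
move=> BA h z1 v1 /BA Az1 Ev1; have [s [? hs cs]] := h _ _ Az1 Ev1.
by exists s; split => // [z /BA|]; [exact: hs | exact: cont_on_sub cs].
Qed.

(* A local section follows the point of the fibre closest to a given one. *)
Let locally_trivial : exists2 d, 0 < d & forall z0, Q z0 ->
  trivial_over (Q `&` [set z | mdist z0 z < d]).
Proof.
have [s s0 sep] := uniformly_separated.
apply: compact_lebesgue (rect_compact (x0:=a0) (x1:=a1) (y0:=b0) (y1:=b1)) _.
move=> z0 Qz0; have s80 : 0 < s / 8 by rewrite divr_gt0.
have [d d0 hd] := fiber_continuous Qz0 s80.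
exists (d / 2); rewrite ?divr_gt0// => y Qy z0y e e0 ed.
apply: (@trivial_over_sub (Q `&` [set z | mdist z0 z < d])).
  move=> z [Qz /= yz]; split => //=; rewrite (le_lt_trans (metric_triangle _ y _))//.
  by rewrite [ltRHS]splitr ltrD// (lt_trans yz).
move=> z1 v1 [Qz1 /= z01] Ev1.
have [v0 Ev0 v10] := (hd _ Qz1 z01).1 _ Ev1.
have /choice[sg hsg] : forall z, exists v,
    (Q z /\ mdist z0 z < d) -> E z v /\ mdist v v0 < s / 8.
  move=> z; have [[Qz zd]|nz] := pselect (Q z /\ mdist z0 z < d); last by exists v0.
  by have [v ? ?] := (hd _ Qz zd).2 _ Ev0; exists v.
exists sg; split.
- have [Es s1] := hsg z1 (conj Qz1 z01).
  apply: (sep _ Qz1 _ _ Es Ev1); apply: (le_lt_trans (metric_triangle _ v0 _)).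
  by rewrite (metric_sym v0); move: s1 v10 => ? ?; lra.
- by move=> z [Qz zd]; have [] := hsg z (conj Qz zd).
move=> z2 [Qz2 /= z2d] e' e'0.
have [E2 s2] := hsg z2 (conj Qz2 z2d).
have e''0 : 0 < Order.min e' (s / 8) by rewrite lt_min e'0.
have [d2 d20 hd2] := fiber_continuous Qz2 e''0.
exists d2 => // z [Qz /= zd] zz2.
have [v Ev vs] := (hd2 _ Qz zz2).2 _ E2.
have [E3 s3] := hsg z (conj Qz zd).
move: vs; rewrite lt_min => /andP[ve vs].
suff <- : v = sg z by rewrite metric_sym.
apply: (sep _ Qz _ _ Ev E3).
have := metric_triangle v (sg z2) (sg z); have := metric_triangle (sg z2) v0 (sg z).
by rewrite (metric_sym v0) => ? ?; lra.
Qed.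

(* Sections that agree at one point of the intersection agree on all of it, since
   two points of the intersection are joined by a segment. *)
Let trivial_glue (A B : set U) : closed A -> closed B -> A `<=` Q -> B `<=` Q ->
  A `&` B !=set0 ->
  (forall u v t, (A `&` B) u -> (A `&` B) v -> 0 <= t <= 1 -> (A `&` B) (seg u v t)) ->
  trivial_over A -> trivial_over B -> trivial_over (A `|` B).
Proof.
move=> clA clB AQ BQ [p [Ap Bp]] conv.
wlog suff H : A B clA clB AQ BQ Ap Bp conv / trivial_over A -> trivial_over B ->
    forall z1 v1, A z1 -> E z1 v1 -> exists sigma : U -> T,
      [/\ sigma z1 = v1, forall z, (A `|` B) z -> E z (sigma z) &
          cont_on (A `|` B) sigma].
  move=> tA tB z1 v1 [Az1|Bz1] Ev1; first exact: H.
  by rewrite setUC; apply: (H B A) => // u v t; rewrite setIC; exact: conv.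
move=> tA tB z1 v1 Az1 Ev1.
have [sA [sA1 EA cA]] := tA _ _ Az1 Ev1.
have [sB [sB1 EB cB]] := tB _ _ Bp (EA _ Ap).
have agree u : A u -> B u -> sB u = sA u.
  move=> Au Bu.
  have segA t : `[0, 1]%classic t -> A (seg p u t).
    by move=> /=; rewrite in_itv/= => t01; have [] := conv p u t (conj Ap Bp) (conj Au Bu) t01.
  have segB t : `[0, 1]%classic t -> B (seg p u t).
    by move=> /=; rewrite in_itv/= => t01; have [] := conv p u t (conj Ap Bp) (conj Au Bu) t01.
  have := @lift_unique (sB \o seg p u) (sA \o seg p u) (seg p u).
  rewrite /= seg0 seg1; apply => //.
  - by apply: (@cont_on_comp R R^o U T `[0, 1]%classic B (seg p u) sB segB _ cB); exact: cont_seg.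
  - by apply: (@cont_on_comp R R^o U T `[0, 1]%classic A (seg p u) sA segA _ cA); exact: cont_seg.
  move=> t t01; split; [exact/AQ/segA|exact/EB/segB|exact/EA/segA].
pose s u := if pselect (A u) then sA u else sB u.
have sAE u : A u -> s u = sA u by rewrite /s => Au; case: pselect.
have sBE u : B u -> s u = sB u.
  by rewrite /s => Bu; case: pselect => // Au; rewrite agree.
exists s; split; first by rewrite sAE.
  by move=> z [Az|Bz]; [rewrite sAE//; exact: EA|rewrite sBE//; exact: EB].
apply/cont_onP/withinU_continuous => //; apply/cont_onP => x Ax e e0.
  have [d d0 hd] := cA x Ax e e0; exists d => // y Ay xy.
  by rewrite !sAE//; exact: hd.
have [d d0 hd] := cB x Ax e e0; exists d => // y Ay xy.
by rewrite !sBE//; exact: hd.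
Qed.

(** Rectangles are simply connected: cut the rectangle into squares smaller than a
    Lebesgue number, glue the squares into strips, and the strips together. *)
Lemma rect_trivial z1 v1 : Q z1 -> E z1 v1 ->
  exists sigma : U -> T, [/\ sigma z1 = v1, forall z, Q z -> E z (sigma z) &
                            cont_on Q sigma].
Proof.
have [d d0 hd] := locally_trivial; set h := d / 3.
have h0 : 0 < h by rewrite divr_gt0.
have base x0 x1 y0 y1 : x0 <= x1 -> y0 <= y1 -> rect x0 x1 y0 y1 `<=` Q ->
    x1 <= x0 + h -> y1 <= y0 + h -> trivial_over (rect x0 x1 y0 y1).
  move=> x01 y01 rQ x1h y1h; pose c := pt (x0 +i* y0)%C.
  have rc : rect x0 x1 y0 y1 c by rewrite /rect /c/= ptK.
  apply: trivial_over_sub (hd c (rQ _ rc)) => u ru; split; first exact: rQ.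
  case: ru => ? ? ? ?; rewrite /= mdist_cx ptK cm_distC.
  apply: (le_lt_trans (cm_le_ReIm _)); rewrite ReD ImD ReN ImN/=.
  rewrite !ger0_norm ?subr_ge0//; rewrite /h in x1h y1h; lra.
have strip n x0 x1 y0 y1 : x0 <= x1 -> y0 <= y1 -> rect x0 x1 y0 y1 `<=` Q ->
    x1 <= x0 + n%:R * h -> y1 <= y0 + h -> trivial_over (rect x0 x1 y0 y1).
  elim: n x1 => [|n IH] x1 x01 y01 rQ x1n y1h.
    by apply: base => //; rewrite (le_trans x1n)// mul0r lerD2l ltW.
  have [x1le|ltx1] := leP x1 (x0 + n%:R * h); first exact: IH.
  set c := x0 + n%:R * h in ltx1.
  have x0c : x0 <= c by rewrite lerDl mulr_ge0// ltW.
  have AQ : rect x0 c y0 y1 `<=` Q.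
    by apply: subset_trans rQ => u [? ? ? ?]; split => //; rewrite (le_trans _ (ltW ltx1)).
  have BQ : rect c x1 y0 y1 `<=` Q.
    by apply: subset_trans rQ => u [? ? ? ?]; split => //; rewrite (le_trans x0c).
  have -> : rect x0 x1 y0 y1 = rect x0 c y0 y1 `|` rect c x1 y0 y1.
    apply/seteqP; split=> u.
      move=> [? ? ? ?]; have [uc|/ltW uc] := leP (complex.Re (cx u)) c.
        by left; split.
      by right; split.
    by case=> -[? ? ? ?]; split => //; [rewrite (le_trans _ (ltW ltx1))|rewrite (le_trans x0c)].
  apply: trivial_glue => //; [exact: rect_closed|exact: rect_closed| | | |].
  - by exists (pt (c +i* y0)%C); split; rewrite /rect/= ptK/= lexx ?x0c ?(ltW ltx1).
  - by move=> u v t [? ?] [? ?] t01; split; exact: rect_convex.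
  - exact: IH.
  - apply: base => //; first exact: ltW.
    by rewrite (le_trans x1n)// /c -addrA lerD2l -natr1 mulrDl mul1r.
have block n x0 x1 y0 y1 : x0 <= x1 -> y0 <= y1 -> rect x0 x1 y0 y1 `<=` Q ->
    y1 <= y0 + n%:R * h -> trivial_over (rect x0 x1 y0 y1).
  have big x : exists k : nat, x <= k%:R * h.
    exists (Num.bound `|x / h|); rewrite -ler_pdivrMr//.
    by rewrite (le_trans (ler_norm _))// ltW// archi_boundP.
  elim: n y1 => [|n IH] y1 x01 y01 rQ y1n.
    have [k xk] := big (x1 - x0); apply: (strip k) => //; first by rewrite -lerBlDl.
    by rewrite (le_trans y1n)// mul0r lerD2l ltW.
  have [y1le|lty1] := leP y1 (y0 + n%:R * h); first exact: IH.
  set c := y0 + n%:R * h in lty1.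
  have y0c : y0 <= c by rewrite lerDl mulr_ge0// ltW.
  have AQ : rect x0 x1 y0 c `<=` Q.
    by apply: subset_trans rQ => u [? ? ? ?]; split => //; rewrite (le_trans _ (ltW lty1)).
  have BQ : rect x0 x1 c y1 `<=` Q.
    by apply: subset_trans rQ => u [? ? ? ?]; split => //; rewrite (le_trans y0c).
  have -> : rect x0 x1 y0 y1 = rect x0 x1 y0 c `|` rect x0 x1 c y1.
    apply/seteqP; split=> u.
      move=> [? ? ? ?]; have [uc|/ltW uc] := leP (complex.Im (cx u)) c.
        by left; split.
      by right; split.
    by case=> -[? ? ? ?]; split => //; [rewrite (le_trans _ (ltW lty1))|rewrite (le_trans y0c)].
  apply: trivial_glue => //; [exact: rect_closed|exact: rect_closed| | | |].
  - by exists (pt (x0 +i* c)%C); split; rewrite /rect/= ptK/= lexx ?y0c ?(ltW lty1).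
  - by move=> u v t [? ?] [? ?] t01; split; exact: rect_convex.
  - exact: IH.
  - have [k xk] := big (x1 - x0); apply: (strip k) => //; first exact: ltW.
      by rewrite -lerBlDl.
    by rewrite (le_trans y1n)// /c -addrA lerD2l -natr1 mulrDl mul1r.
move=> Qz1; have [? ? ? ?] := Qz1.
have a01 : a0 <= a1 by exact: (@le_trans _ _ (complex.Re (cx z1))).
have b01 : b0 <= b1 by exact: (@le_trans _ _ (complex.Im (cx z1))).
apply: (block (Num.bound `|(b1 - b0) / h|)) => //.
rewrite -lerBlDl -ler_pdivrMr//.
by rewrite (le_trans (ler_norm _))// ltW// archi_boundP.
Qed.

(** The loop lifts along a section of the trivial covering, and lifts are unique. *)
Lemma rect_lift_closes (zeta : R -> U) (v : R -> T) :
  @cont_on R R^o U `[0, 1] zeta -> @cont_on R R^o T `[0, 1] v ->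
  (forall t, `[0, 1]%classic t -> Q (zeta t) /\ E (zeta t) (v t)) ->
  zeta 0 = zeta 1 -> v 0 = v 1.
Proof.
move=> cz cv h z01.
have i0 : `[0, 1]%classic (0 : R) by rewrite /= in_itv/= lexx ler01.
have [s [s0 Es cs]] := rect_trivial (h 0 i0).1 (h 0 i0).2.
have := @lift_unique (s \o zeta) v zeta.
rewrite /= -z01 s0; apply => //.
  by apply: (@cont_on_comp R R^o U T `[0, 1]%classic Q zeta s _ cz cs) => t /h[].
by move=> t t01; have [Qt Et] := h t t01; split => //; exact: Es.
Qed.

End Covering.

(** * Constructible sets of dimension one and two *)

Section GenericTruth.
Variables (F : closedFieldType) (D : idomainType) (I : Type).
Variables (ev : I -> {rmorphism D -> F}) (cst : F -> D) (xs : seq D).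
Hypothesis ev_cst : forall p c, ev p (cst c) = c.

Fixpoint term_value (t : GRing.term F) : D :=
  match t with
  | GRing.Var i => xs`_i
  | GRing.Const c => cst c
  | GRing.NatConst n => n%:R
  | GRing.Add t1 t2 => term_value t1 + term_value t2
  | GRing.Opp t1 => - term_value t1
  | GRing.NatMul t1 n => term_value t1 *+ n
  | GRing.Mul t1 t2 => term_value t1 * term_value t2
  | GRing.Inv _ => 0
  | GRing.Exp t1 n => term_value t1 ^+ n
  end.

Lemma eval_term_value p t : GRing.rterm t ->
  GRing.eval (map (ev p) xs) t = ev p (term_value t).
Proof.
elim: t => //=.
- move=> i _; have [ix|xi] := ltnP i (size xs); first by rewrite (nth_map 0).
  by rewrite !nth_default ?size_map// rmorph0.
- by move=> n _; rewrite rmorph_nat.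
- by move=> t1 IH1 t2 IH2 /andP[/IH1 -> /IH2 ->]; rewrite rmorphD.
- by move=> t1 IH1 /IH1 ->; rewrite rmorphN.
- by move=> t1 IH1 n /IH1 ->; rewrite rmorphMn.
- by move=> t1 IH1 t2 IH2 /andP[/IH1 -> /IH2 ->]; rewrite rmorphM.
- by move=> t1 IH1 n /IH1 ->; rewrite rmorphXn.
Qed.

(** A quantifier-free formula is a boolean combination of polynomial equations,
    and an equation either holds identically or fails wherever a nonzero
    polynomial does not vanish. The domain [D] of generic points will be a ring of
    polynomials in one or two variables, and [ev] their evaluation. *)
Lemma qf_generic f : GRing.qf_form f && GRing.rformula f ->
  exists2 P : D, P != 0 &
    exists b : bool, forall p, ev p P != 0 -> GRing.qf_eval (map (ev p) xs) f = b.
Proof.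
elim: f => //=.
- by move=> b _; exists 1; [exact: oner_neq0|exists b].
- move=> t1 t2 /andP[r1 r2].
  have [E|nE] := eqVneq (term_value t1) (term_value t2).
    exists 1; first exact: oner_neq0.
    by exists true => p _; rewrite !eval_term_value// E eqxx.
  exists (term_value t1 - term_value t2); first by rewrite subr_eq0.
  exists false => p; rewrite !eval_term_value// rmorphB subr_eq0.
  exact: negbTE.
- move=> f IHf g IHg /andP[/andP[qf qg] /andP[rf rg]].
  have [|P P0 [b hb]] := IHf; first by rewrite qf.
  have [|Q Q0 [c hc]] := IHg; first by rewrite qg.
  exists (P * Q); first exact: mulf_neq0.
  exists (b && c) => p; rewrite rmorphM mulf_eq0 negb_or => /andP[? ?].
  by rewrite hb// hc.
- move=> f IHf g IHg /andP[/andP[qf qg] /andP[rf rg]].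
  have [|P P0 [b hb]] := IHf; first by rewrite qf.
  have [|Q Q0 [c hc]] := IHg; first by rewrite qg.
  exists (P * Q); first exact: mulf_neq0.
  exists (b || c) => p; rewrite rmorphM mulf_eq0 negb_or => /andP[? ?].
  by rewrite hb// hc.
- move=> f IHf g IHg /andP[/andP[qf qg] /andP[rf rg]].
  have [|P P0 [b hb]] := IHf; first by rewrite qf.
  have [|Q Q0 [c hc]] := IHg; first by rewrite qg.
  exists (P * Q); first exact: mulf_neq0.
  exists (b ==> c) => p; rewrite rmorphM mulf_eq0 negb_or => /andP[? ?].
  by rewrite hb// hc.
- move=> f IHf /IHf[P P0 [b hb]]; exists P => //.
  by exists (~~ b) => p ?; rewrite hb.
Qed.

(** By elimination of quantifiers over an algebraically closed field. *)
Lemma generic_truth (f : GRing.formula F) : exists2 P : D, P != 0 &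
  (forall p, ev p P != 0 -> GRing.holds (map (ev p) xs) f) \/
  (forall p, ev p P != 0 -> ~ GRing.holds (map (ev p) xs) f).
Proof.
have Fcl : GRing.closed_field_axiom F by exact: solve_monicpoly.
pose g := GRing.quantifier_elim (@ClosedFieldQE.ex_elim F) (GRing.to_rform f).
have hg : GRing.qf_form g && GRing.rformula g.
  apply: GRing.quantifier_elim_wf; first exact: ClosedFieldQE.wf_ex_elim.
  exact: GRing.to_rform_rformula.
have fgP e : reflect (GRing.holds e f) (GRing.qf_eval e g).
  apply: (iffP (GRing.quantifier_elim_rformP (@ClosedFieldQE.wf_ex_elim F)
     (ClosedFieldQE.holds_ex_elim Fcl) e (GRing.to_rform_rformula f))) => ?;
     exact/GRing.to_rformP.
have [P P0 [[] h]] := qf_generic hg; exists P => //; [left|right] => p /h.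
  by move/fgP.
by move=> E /fgP; rewrite E.
Qed.

End GenericTruth.

Section Definable.
Variable F : closedFieldType.
Local Notation formula := (GRing.formula F).

Lemma definable_line (f : formula) (e : seq F) : exists2 P : {poly F}, P != 0 &
  (forall z, P.[z] != 0 -> GRing.holds (z :: e) f) \/
  (forall z, P.[z] != 0 -> ~ GRing.holds (z :: e) f).
Proof.
have [|P P0 h] := @generic_truth F {poly F} F (fun z => horner_eval z : {rmorphism _ -> _})
  (@polyC F) ('X :: map polyC e) _ f; first by move=> p c; exact: hornerC.
exists P => //.
have E z : map (horner_eval z) ('X :: map polyC e) = z :: e.
  rewrite /= /horner_eval hornerX -map_comp; congr cons.
  by rewrite -[RHS]map_id; apply: eq_map => c /=; rewrite hornerC.
by case: h => h; [left|right] => z Pz; rewrite -E; exact: h.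
Qed.

Definition ev2 (P : {poly {poly F}}) (z w : F) : F := P.[w%:P].[z].

Lemma definable_plane (f : formula) (e : seq F) :
  exists2 P : {poly {poly F}}, P != 0 &
  (forall z w, ev2 P z w != 0 -> GRing.holds (z :: w :: e) f) \/
  (forall z w, ev2 P z w != 0 -> ~ GRing.holds (z :: w :: e) f).
Proof.
pose ev (p : F * F) : {rmorphism {poly {poly F}} -> F} :=
  horner_eval p.1 \o horner_eval (p.2%:P).
have [|P P0 h] := @generic_truth F {poly {poly F}} (F * F)%type ev
  (fun c => c%:P%:P) ('X%:P :: 'X :: map (fun c => c%:P%:P) e) _ f.
  by move=> p c /=; rewrite /horner_eval !hornerC.
exists P => //.
have E p : map (ev p) ('X%:P :: 'X :: map (fun c => c%:P%:P) e) = p.1 :: p.2 :: e.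
  rewrite /= /horner_eval !(hornerC, hornerX) -map_comp; congr [:: _, _ & _].
  by rewrite -[RHS]map_id; apply: eq_map => c /=; rewrite /horner_eval !hornerC.
by case: h => h; [left|right] => z w Pz; rewrite -(E (z, w)); exact: h.
Qed.

End Definable.

Section Formulas.
Variable F : closedFieldType.
Local Notation formula := (GRing.formula F).
Local Notation term := (GRing.term F).

Lemma holds_exists_block (e : seq F) (N : nat) (f : formula) :
  GRing.holds e (foldr GRing.Exists f (iota (size e) N)) <->
  exists2 s : seq F, size s = N & GRing.holds (e ++ s) f.
Proof.
rewrite -GRing.foldExistsP; split=> [[e' ee' h]|[s sN h]].
  exists [seq e'`_i | i <- iota (size e) N]; first by rewrite size_map size_iota.
  pose e1 := e ++ [seq e'`_i | i <- iota (size e) N].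
  have out i : (i \notin iota (size e) N) -> e1`_i = e'`_i.
    move=> iN; rewrite -ee' // /e1 nth_cat; case: ltnP => // ie.
    move: iN; rewrite mem_iota ie/= -leqNgt => iN.
    by rewrite !nth_default// size_map size_iota -(leq_add2l (size e)) subnKC.
  apply: GRing.eq_holds h => i; rewrite -/e1.
  have [iN|/out->//] := boolP (i \in iota (size e) N).
  move: iN; rewrite mem_iota => /andP[ei iN].
  rewrite /e1 nth_cat ltnNge ei/= (nth_map 0%N) ?size_iota ?ltn_subLR//.
  by rewrite nth_iota ?ltn_subLR// subnKC.
exists (e ++ s) => // i; rewrite inE/= mem_iota negb_and -leqNgt -ltnNge nth_cat.
case: (ltnP i (size e)) => //= ei iN.
by rewrite !nth_default// sN -(leq_add2l (size e)) subnKC.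
Qed.

Definition conj_all (I : Type) (r : seq I) (f : I -> formula) : formula :=
  foldr (fun i => GRing.And (f i)) (GRing.Bool true) r.

Lemma holds_conj_all (I : eqType) (r : seq I) (f : I -> formula) e :
  GRing.holds e (conj_all r f) <-> forall i, i \in r -> GRing.holds e (f i).
Proof.
elim: r => [|i r IH] //=; rewrite IH; split=> [[h1 h2] j|h].
  by rewrite inE => /orP[/eqP->|/h2].
by split=> [|j jr]; apply: h; rewrite inE ?eqxx ?jr ?orbT.
Qed.

(** The variables are numbered from [k], so that a formula can speak of several
    points. *)
Definition mpoly_term (m k : nat) (f : mpoly m F) : term :=
  foldr (fun mm t => GRing.Add (GRing.Mul (GRing.Const (mcoeff mm f))
     (foldr (fun (i : 'I_m) => GRing.Mul (GRing.Exp (GRing.Var _ (k + i)) (mm i)))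
       (GRing.Const 1) (enum 'I_m))) t) (GRing.Const 0) (msupp f).

Lemma eval_mpoly_term m k (f : mpoly m F) e :
  GRing.eval e (mpoly_term k f) = meval (fun j : 'I_m => e`_(k + j)) f.
Proof.
rewrite /mpoly_term mevalE; elim: (msupp f) => [|mm s IH]; rewrite ?big_nil ?big_cons//=.
rewrite IH; congr (_ * _ + _).
by rewrite -big_enum/=; elim: (enum 'I_m) => [|i r IHr] /=; rewrite ?big_nil ?big_cons ?IHr.
Qed.

Definition poly_term (p : seq F) (t : term) : term :=
  foldr (fun c a => GRing.Add (GRing.Mul a t) (GRing.Const c)) (GRing.Const 0) p.

Definition poly2_term (P : {poly {poly F}}) (tz tw : term) : term :=
  foldr (fun (c : {poly F}) a => GRing.Add (GRing.Mul a tw) (poly_term c tz))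
    (GRing.Const 0) P.

Lemma eval_poly_term (p : {poly F}) t e :
  GRing.eval e (poly_term p t) = p.[GRing.eval e t].
Proof. by rewrite /poly_term /horner; elim: (polyseq p) => [|c s IH] //=; rewrite IH. Qed.

Lemma eval_poly2_term (P : {poly {poly F}}) tz tw e :
  GRing.eval e (poly2_term P tz tw) = ev2 P (GRing.eval e tz) (GRing.eval e tw).
Proof.
rewrite /ev2 /poly2_term [P.[_]]/horner; elim: (polyseq P) => [|c s IH] /=; first by rewrite horner0.
by rewrite IH eval_poly_term hornerD hornerM hornerC.
Qed.

Definition slice (P : {poly {poly F}}) (z : F) : {poly F} := map_poly (horner_eval z) P.

Lemma horner_slice P z w : (slice P z).[w] = ev2 P z w.
Proof.
rewrite /ev2 /slice -[w in LHS](hornerC w z) -/(horner_eval z _).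
by rewrite horner_map.
Qed.

Lemma size_slice P z : (lead_coef P).[z] != 0 -> size (slice P z) = size P.
Proof. by move=> h; rewrite /slice size_map_poly_id0. Qed.

(** To have [n] distinct roots is a definable condition on [z]: generic for
    [n = 0] and exceptional for [n] beyond the degree, it changes from one to the
    other at some [n]. *)
Lemma generic_root_count (P : {poly {poly F}}) : P != 0 ->
  exists2 B : {poly F}, B != 0 & exists n, forall z, B.[z] != 0 ->
    (lead_coef P).[z] != 0 /\
    exists s, [/\ uniq s, size s = n & forall w, (w \in s) = root (slice P z) w].
Proof.
move=> P0; pose many n : formula :=
  foldr GRing.Exists
    (GRing.And
      (conj_all (iota 1 n) (fun i => GRing.Equal (poly2_term P (GRing.Var _ 0) (GRing.Var _ i)) (GRing.Const 0)))
      (conj_all (allpairs pair (iota 1 n) (iota 1 n))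
        (fun ij => if ij.1 == ij.2 then GRing.Bool true
                   else GRing.Not (GRing.Equal (GRing.Var _ ij.1) (GRing.Var _ ij.2)))))
    (iota 1 n).
have manyP n z : GRing.holds [:: z] (many n) <->
    exists s, [/\ uniq s, size s = n & all (root (slice P z)) s].
  rewrite (holds_exists_block [:: z]); split=> -[s].
    move=> sn /= [/holds_conj_all h1 /holds_conj_all h2]; exists s; split => //.
      apply/(uniqP 0) => i j; rewrite !inE sn => i_n j_n sij.
      apply/eqP/negPn/negP => ij.
      have /h2 : (i.+1, j.+1) \in [seq (i0, j0) | i0 <- iota 1 n, j0 <- iota 1 n].
        by rewrite allpairs_f// mem_iota/= add1n ltnS.
      by rewrite /= eqSS (negbTE ij)/=; apply.
    apply/(all_nthP 0) => i; rewrite sn => i_n.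
    have /h1 /= : i.+1 \in iota 1 n by rewrite mem_iota/= add1n ltnS.
    by rewrite eval_poly2_term/= rootE horner_slice => ->.
  move=> [us sn /all_nthP rs]; exists s => //=; split.
    apply/holds_conj_all => -[|i]; rewrite mem_iota//= add1n ltnS => i_n.
    rewrite eval_poly2_term/= -horner_slice; apply/rootP; rewrite rs ?sn//.
  apply/holds_conj_all => -[i j]; move/allpairsP => /= [[i' j'] /= [+ + [-> ->]]].
  rewrite !mem_iota /= !add1n; case: i' j' => [|i'] [|j']//; rewrite !ltnS => ii jj.
  rewrite eqSS; case: eqVneq => //= ij; apply/eqP.
  by rewrite nth_uniq ?sn.
pose generic n := exists2 B : {poly F}, B != 0 & forall z, B.[z] != 0 ->
  GRing.holds [:: z] (many n).
pose rare n := exists2 B : {poly F}, B != 0 & forall z, B.[z] != 0 ->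
  ~ GRing.holds [:: z] (many n).
have gr n : generic n \/ rare n.
  by have [B B0 [h|h]] := definable_line (many n) [::]; [left|right]; exists B.
have g0 : generic 0%N.
  by exists 1 => [|z _]; [exact: oner_neq0 | apply/manyP; exists [::]].
have lP0 : lead_coef P != 0 by rewrite lead_coef_eq0.
have rP : rare (size P).
  exists (lead_coef P) => // z lz /manyP[s [us sn rs]].
  have s0 : slice P z != 0 by rewrite -size_poly_eq0 size_slice// size_poly_eq0.
  by have := max_poly_roots s0 rs us; rewrite sn size_slice// ltnn.
have nonzero (B : {poly F}) : B != 0 -> exists z, B.[z] != 0.
  by move=> /closed_nonrootP[z]; exists z.
have [n [[B B0 hB] [B' B'0 hB']]] : exists n, generic n /\ rare n.+1.
  elim: (size P) rP => [|k IH] rk.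
    case: rk g0 => B B0 hB [B' B'0 hB'].
    have [z] := nonzero _ (mulf_neq0 B0 B'0).
    by rewrite hornerM mulf_eq0 negb_or => /andP[/hB + /hB'].
  by have [g|/IH//] := gr k; exists k.
exists (lead_coef P * (B * B')); first by rewrite !mulf_neq0.
exists n => z; rewrite !hornerM !mulf_eq0 !negb_or => /andP[lz /andP[Bz B'z]].
split=> //; have /manyP[s [us sn rs]] := hB z Bz.
exists s; split => // w; apply/idP/idP => [|rw]; first exact: (allP rs).
apply/negPn/negP => ws; apply: (hB' z B'z); apply/manyP; exists (w :: s).
by rewrite /= ws us sn rw rs.
Qed.

End Formulas.

(** Fibres and images of the coordinates of an algebraic set are definable. *)
Section AlgebraicProjections.
Variables (R : realType) (m : nat).
Local Notation C := R[i].
Variable Y : set (cspace R m).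
Hypothesis algY : algebraic_set Y.

Let point_at (k : nat) (e : seq C) : cspace R m := \row_j e`_(k + j).

Let co_point_at k e j : co (point_at k e) j = e`_(k + j).
Proof. by rewrite /co mxE. Qed.

Let point_atK (e s : seq C) (y : cspace R m) :
  point_at (size e) (e ++ [seq co y j | j <- enum 'I_m] ++ s) = y.
Proof.
apply/cspace_eqP => j; rewrite co_point_at nth_cat ltnNge leq_addr/= addKn.
by rewrite nth_cat size_map size_enum_ord ltn_ord (nth_map j) ?size_enum_ord// nth_ord_enum.
Qed.

Let membership : exists f : nat -> GRing.formula C,
  forall k e, GRing.holds e (f k) <-> Y (point_at k e).
Proof.
have [fs ->] := algY.
exists (fun k => conj_all fs (fun g => GRing.Equal (mpoly_term k g) (GRing.Const 0))) => k e.
rewrite holds_conj_all /=; split=> h g /h /=.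
  rewrite eval_mpoly_term => E; apply: etrans E.
  by apply: meval_eq => j; exact: co_point_at.
move=> E; rewrite eval_mpoly_term; apply: etrans E.
by apply: meval_eq => j; exact: esym (co_point_at _ _ _).
Qed.

Lemma projection_dichotomy (i j : 'I_m) : exists2 P : {poly {poly C}}, P != 0 &
  (forall z w, ev2 P z w != 0 -> exists2 y, Y y & co y i = z /\ co y j = w) \/
  (forall y, Y y -> ev2 P (co y i) (co y j) = 0).
Proof.
have [f hf] := membership.
pose g := GRing.And (f 2%N) (GRing.And
  (GRing.Equal (GRing.Var _ (2 + i)) (GRing.Var _ 0))
  (GRing.Equal (GRing.Var _ (2 + j)) (GRing.Var _ 1))).
have gP z w : GRing.holds [:: z; w] (foldr GRing.Exists g (iota 2 m)) <->
    exists2 y, Y y & co y i = z /\ co y j = w.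
  rewrite (holds_exists_block [:: z; w]); split=> [[s sm [/hf Ys /= [zE wE]]]|[y Yy [<- <-]]].
    by exists (point_at 2 ([:: z; w] ++ s)) => //; rewrite !co_point_at.
  exists [seq co y j | j <- enum 'I_m]; first by rewrite size_map size_enum_ord.
  split; first by apply/hf; rewrite -[X in _ ++ X]cats0 (@point_atK [:: _; _]).
  by split; rewrite /= add0n (nth_map i) ?size_enum_ord// nth_ord_enum.
have [P P0 [h|h]] := definable_plane (foldr GRing.Exists g (iota 2 m)) [::].
  by exists P => //; left => z w /h /gP.
exists P => //; right => y Yy; apply/eqP/negPn/negP => /h; apply; apply/gP.
by exists y.
Qed.

Lemma fiber_coordinate (i j : 'I_m) (z : C) : exists2 P : {poly C}, P != 0 &
  (forall w, P.[w] != 0 -> exists2 y, Y y & co y i = z /\ co y j = w) \/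
  (forall y, Y y -> co y i = z -> P.[co y j] = 0).
Proof.
have [f hf] := membership.
pose g := GRing.And (f 1%N) (GRing.And
  (GRing.Equal (GRing.Var _ (1 + i)) (GRing.Const z))
  (GRing.Equal (GRing.Var _ (1 + j)) (GRing.Var _ 0))).
have gP w : GRing.holds [:: w] (foldr GRing.Exists g (iota 1 m)) <->
    exists2 y, Y y & co y i = z /\ co y j = w.
  rewrite (holds_exists_block [:: w]); split=> [[s sm [/hf Ys /= [zE wE]]]|[y Yy [yz <-]]].
    by exists (point_at 1 ([:: w] ++ s)) => //; rewrite !co_point_at.
  exists [seq co y j | j <- enum 'I_m]; first by rewrite size_map size_enum_ord.
  split; first by apply/hf; rewrite -[X in _ ++ X]cats0 (@point_atK [:: _]).
  by split; rewrite /= add0n (nth_map i) ?size_enum_ord// nth_ord_enum.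
have [P P0 [h|h]] := definable_line (foldr GRing.Exists g (iota 1 m)) [::].
  by exists P => //; left => w /h /gP.
exists P => //; right => y Yy yz; apply/eqP/negPn/negP => /h; apply; apply/gP.
by exists y.
Qed.

Lemma generic_fiber (i : 'I_m) : exists2 P : {poly C}, P != 0 &
  (forall z, P.[z] != 0 -> exists2 y, Y y & co y i = z) \/
  (forall y, Y y -> P.[co y i] = 0).
Proof.
have [f hf] := membership.
pose g := GRing.And (f 1%N) (GRing.Equal (GRing.Var _ (1 + i)) (GRing.Var _ 0)).
have gP z : GRing.holds [:: z] (foldr GRing.Exists g (iota 1 m)) <->
    exists2 y, Y y & co y i = z.
  rewrite (holds_exists_block [:: z]); split=> [[s sm [/hf Ys /= zE]]|[y Yy <-]].
    by exists (point_at 1 ([:: z] ++ s)) => //; rewrite !co_point_at.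
  exists [seq co y j | j <- enum 'I_m]; first by rewrite size_map size_enum_ord.
  split; first by apply/hf; rewrite -[X in _ ++ X]cats0 (@point_atK [:: _]).
  by rewrite /= add0n (nth_map i) ?size_enum_ord// nth_ord_enum.
have [P P0 [h|h]] := definable_line (foldr GRing.Exists g (iota 1 m)) [::].
  by exists P => //; left => w /h /gP.
exists P => //; right => y Yy; apply/eqP/negPn/negP => /h; apply; apply/gP.
by exists y.
Qed.

Lemma generic_double_fiber (i : 'I_m) : exists2 P : {poly C}, P != 0 &
  (forall z, P.[z] != 0 -> exists y y', [/\ Y y, Y y', co y i = z, co y' i = z & y <> y']) \/
  (forall y y', Y y -> Y y' -> co y i = co y' i -> P.[co y i] != 0 -> y = y').
Proof.
have [f hf] := membership.
pose g := GRing.And (GRing.And (f 1%N) (f (1 + m)%N)) (GRing.And (GRing.And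
  (GRing.Equal (GRing.Var _ (1 + i)) (GRing.Var _ 0))
  (GRing.Equal (GRing.Var _ (1 + m + i)) (GRing.Var _ 0)))
  (GRing.Not (conj_all (enum 'I_m)
    (fun j => GRing.Equal (GRing.Var _ (1 + j)) (GRing.Var _ (1 + m + j)))))).
have gP z : GRing.holds [:: z] (foldr GRing.Exists g (iota 1 (m + m))) <->
    exists y y', [/\ Y y, Y y', co y i = z, co y' i = z & y <> y'].
  rewrite (holds_exists_block [:: z]); split.
    move=> [s sm [[/hf Ys /hf Ys'] /= [[zE wE] h]]].
    exists (point_at 1 ([:: z] ++ s)), (point_at (1 + m) ([:: z] ++ s)).
    rewrite !co_point_at; split => // yy; apply: h; apply/holds_conj_all => j _ /=.
    by have := congr1 (fun y => co y j) yy; rewrite !co_point_at.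
  move=> [y [y' [Yy Yy' yz yz' yy]]].
  pose s := [seq co y j | j <- enum 'I_m]; pose s' := [seq co y' j | j <- enum 'I_m].
  have sm : size s = m by rewrite size_map size_enum_ord.
  have yE : point_at 1 ([:: z] ++ s ++ s') = y by exact: (@point_atK [:: _]).
  have yE' : point_at (1 + m) ([:: z] ++ s ++ s') = y'.
    have := @point_atK ([:: z] ++ s) [::] y'.
    by rewrite size_cat sm cats0 -catA.
  exists (s ++ s'); first by rewrite size_cat sm size_map size_enum_ord.
  split; first by split; apply/hf; rewrite ?yE ?yE'.
  split.
    split; first exact: (etrans (esym (co_point_at 1 _ i)) (etrans (congr1 (fun y => co y i) yE) yz)).
    exact: (etrans (esym (co_point_at (1 + m) _ i)) (etrans (congr1 (fun y => co y i) yE') yz')).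
  move=> /holds_conj_all h; apply: yy; rewrite -yE -yE'; apply/cspace_eqP => j.
  by rewrite !co_point_at; apply: h; rewrite mem_enum.
have [P P0 [h|h]] := definable_line (foldr GRing.Exists g (iota 1 (m + m))) [::].
  by exists P => //; left => z /h /gP.
exists P => //; right => y y' Yy Yy' yy' Py.
have [//|/eqP ne] := eqVneq y y'.
by case: (h _ Py); apply/gP; exists y, y'.
Qed.

End AlgebraicProjections.

(** * Roots of complex polynomials *)

Lemma seq_gap (R : realType) (T : eqType) (s : seq T) (f : T -> R) :
  exists2 e, 0 < e & forall x, x \in s -> 0 < f x -> e <= f x.
Proof.
elim: s => [|a s [e e0 he]]; first by exists 1.
have [fa|fa] := ltP 0 (f a); last first.
  exists e => // x; rewrite inE => /orP[/eqP->|xs] fx; last exact: he.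
  by rewrite ltNge fa in fx.
exists (Order.min e (f a)); first by rewrite lt_min e0.
move=> x; rewrite inE ge_min => /orP[/eqP->|xs] fx; first by rewrite lexx orbT.
by rewrite he.
Qed.

Lemma div2_gt0 (R : realType) (x : R) : 0 < x -> 0 < x / 2.
Proof. by move=> x0; rewrite divr_gt0. Qed.

Section ComplexPolynomials.
Variable R : realType.
Local Notation C := R[i].
Implicit Types (p h B : {poly C}) (P : {poly {poly C}}) (z w t : C).

Lemma poly_bounded p (r : R) : exists2 b, 0 <= b & forall z, cm z <= r -> cm p.[z] <= b.
Proof.
elim/poly_ind: p => [|p c [b b0 hb]].
  by exists 0 => // z _; rewrite horner0 cm0.
exists (b * `|r| + cm c); first by rewrite addr_ge0 ?cm_ge0// mulr_ge0.
move=> z zr; rewrite hornerMXaddC (le_trans (cmD _ _))// lerD2r cmM ler_pM ?cm_ge0//.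
  exact: hb.
by rewrite (le_trans zr)// ler_norm.
Qed.

Lemma poly_continuous p z0 (e : R) : 0 < e -> exists2 d, 0 < d &
  forall z, cm (z - z0) < d -> cm (p.[z] - p.[z0]) < e.
Proof.
move=> e0; have /factor_theorem[q qE] : root (p - p.[z0]%:P) z0.
  by rewrite rootE hornerD hornerN hornerC subrr.
have [b b0 hb] := poly_bounded q (cm z0 + 1).
exists (Order.min 1 (e / (b + 1))); first by rewrite lt_min ltr01 divr_gt0// ltr_wpDl.
move=> z; rewrite lt_min => /andP[z1 ze].
have -> : p.[z] - p.[z0] = (p - p.[z0]%:P).[z] by rewrite hornerD hornerN hornerC.
rewrite qE hornerM hornerXsubC cmM.
have qb : cm q.[z] <= b.
  by rewrite hb// (le_trans (cm_leD z z0))// lerD2l ltW.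
apply: (@le_lt_trans _ _ ((b + 1) * cm (z - z0))).
  by rewrite ler_wpM2r ?cm_ge0// (le_trans qb)// lerDl.
by rewrite mulrC -ltr_pdivlMr// ltr_wpDl.
Qed.

Lemma poly_split p : exists rs : seq C, (forall w, p != 0 -> (w \in rs) = root p w) /\
  (p != 0 -> (size rs).+1 = size p) /\
  forall z, cm p.[z] = cm (lead_coef p) * \prod_(r <- rs) cm (z - r).
Proof.
have [rs pE] := closed_field_poly_normal p; exists rs; split; [|split].
- move=> w p0; rewrite [in RHS]pE rootZ ?lead_coef_eq0// root_prod_XsubC//.
- move=> p0; rewrite [in RHS]pE size_scale ?lead_coef_eq0//.
  by rewrite size_prod_XsubC.
move=> z; rewrite [in LHS]pE hornerZ cmM horner_prod cm_prod; congr (_ * _).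
by apply: eq_bigr => r _; rewrite hornerXsubC.
Qed.

Lemma prod_ge_exp (rs : seq C) (f : C -> R) (e : R) : 0 <= e ->
  (forall r, r \in rs -> e <= f r) -> e ^+ size rs <= \prod_(r <- rs) f r.
Proof.
move=> e0; elim: rs => [|r rs IH] h; first by rewrite big_nil expr0.
rewrite big_cons exprS ler_pM// ?exprn_ge0//; first by rewrite h// mem_head.
by apply: IH => x xr; rewrite h// inE xr orbT.
Qed.

(** At distance at least [e] from all the roots, the modulus of [h] is at least
    [e ^ deg h] times that of its leading coefficient. *)
Lemma root_close h (e : R) : h != 0 -> 0 < e -> exists2 eta, 0 < eta &
  forall t, cm h.[t] < eta -> exists2 r, root h r & cm (t - r) < e.
Proof.
move=> h0 e0; have [rs [rsE [_ rsP]]] := poly_split h.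
exists (cm (lead_coef h) * e ^+ size rs).
  by rewrite mulr_gt0 ?exprn_gt0// cm_gt0 lead_coef_eq0.
move=> t; rewrite rsP; apply: contraPP => hno; apply/negP; rewrite -leNgt.
rewrite ler_wpM2l ?cm_ge0// prod_ge_exp// ?ltW// => r rr; rewrite leNgt.
by apply/negP => tr; apply: hno; exists r => //; rewrite -rsE.
Qed.

Lemma poly_nonroot_near B z0 (e : R) : B != 0 -> 0 < e ->
  exists2 z, cm (z - z0) < e & B.[z] != 0.
Proof.
move=> B0 e0; pose s := [seq z0 + ((e / k.+2%:R)%:C)%C | k <- iota 0 (size B)].
have us : uniq s.
  rewrite map_inj_in_uniq ?iota_uniq// => k l _ _ /addrI/complexI.
  move=> /(mulfI (lt0r_neq0 e0))/invr_inj/eqP; rewrite eqr_nat eqSS => /eqP[].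
  by [].
have [|h] := boolP (all (root B) s).
  by move=> rs; have := max_poly_roots B0 rs us; rewrite size_map size_iota ltnn.
have /allPn[z /mapP[k _ ->] rz] := h; exists (z0 + ((e / k.+2%:R)%:C)%C) => //.
rewrite [_ + _ - _]addrC addKr cm_real ger0_norm ?divr_ge0 ?ltW//.
by rewrite ltr_pdivrMr// ltr_pMr// ltr1n.
Qed.

Lemma poly_nonzero_far B : B != 0 -> exists2 r, 0 <= r & forall z, r < cm z -> B.[z] != 0.
Proof.
move=> B0; have [rs [rsE _]] := poly_split B.
have sr0 (s : seq C) : 0 <= \sum_(r <- s) cm r by apply: sumr_ge0 => r _; exact: cm_ge0.
exists (\sum_(r <- rs) cm r) => // z zr; apply/negP => Bz.
have zrs : z \in rs by rewrite rsE.
move: zr; rewrite ltNge => /negP; apply; elim: rs {rsE} zrs => // a s IH.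
rewrite inE big_cons => /orP[/eqP->|/IH h]; first by rewrite lerDl.
by rewrite (le_trans h)// lerDr cm_ge0.
Qed.

Lemma ev2_nonzero_near P z0 w0 (e : R) : P != 0 -> 0 < e -> exists z w,
  [/\ cm (z - z0) < e, cm (w - w0) < e & ev2 P z w != 0].
Proof.
move=> P0 e0; have lP : lead_coef P != 0 by rewrite lead_coef_eq0.
have [z zz0 Bz] := poly_nonroot_near z0 lP e0.
have s0 : slice P z != 0 by rewrite -size_poly_eq0 size_slice// size_poly_eq0.
have [w ww0 rw] := poly_nonroot_near w0 s0 e0.
by exists z, w; rewrite -horner_slice.
Qed.

Lemma ev2_continuous P z0 w0 : ev2 P z0 w0 != 0 -> exists2 d : R, 0 < d &
  forall z w, cm (z - z0) < d -> cm (w - w0) < d -> ev2 P z w != 0.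
Proof.
have bnd (Q : {poly {poly C}}) : exists2 b : R, 0 <= b & forall z w,
    cm z <= cm z0 + 1 -> cm w <= cm w0 + 1 -> cm (ev2 Q z w) <= b.
  elim/poly_ind: Q => [|Q c [b b0 hb]].
    by exists 0 => // z w _ _; rewrite /ev2 horner0 horner0 cm0.
  have [b' b'0 hb'] := poly_bounded c (cm z0 + 1).
  exists (b * (cm w0 + 1) + b').
    by rewrite addr_ge0// mulr_ge0// addr_ge0// cm_ge0.
  move=> z w zz ww; rewrite /ev2 hornerMXaddC hornerD hornerM hornerC.
  by rewrite (le_trans (cmD _ _))// lerD ?hb'// cmM ler_pM ?cm_ge0//; exact: hb.
move=> P00; have n0 : 0 < cm (ev2 P z0 w0) by rewrite cm_gt0.
have [d d0 hd] := poly_continuous P.[w0%:P] z0 (div2_gt0 n0).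
have /factor_theorem[Q QE] : root (P - P.[w0%:P]%:P) w0%:P.
  by rewrite rootE hornerD hornerN hornerC subrr.
have [b b0 hb] := bnd Q.
exists (Order.min (Order.min 1 d) (cm (ev2 P z0 w0) / 2 / (b + 1))).
  by rewrite !lt_min ltr01 d0 !divr_gt0// ltr_wpDl.
move=> z w; rewrite !lt_min => /andP[/andP[z1 zd] _] /andP[/andP[w1 _] wb].
rewrite -cm_gt0; apply/negPn/negP; rewrite -leNgt => le0.
have e1 : ev2 P z w - ev2 P z w0 = ev2 Q z w * (w - w0).
  have -> : ev2 P z w - ev2 P z w0 = ev2 (P - P.[w0%:P]%:P) z w.
    by rewrite /ev2 hornerD hornerN hornerC hornerD hornerN.
  by rewrite QE /ev2 hornerM hornerXsubC hornerM hornerD hornerN !hornerC.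
have e2 : cm (ev2 P z w - ev2 P z w0) < cm (ev2 P z0 w0) / 2.
  rewrite e1 cmM; apply: (@le_lt_trans _ _ ((b + 1) * cm (w - w0))).
    rewrite ler_wpM2r ?cm_ge0// (@le_trans _ _ b) ?lerDl//.
    by rewrite hb// (le_trans (cm_leD _ _) (lerD (lexx _) (ltW _))).
  by rewrite mulrC -ltr_pdivlMr// ltr_wpDl.
have := hd z zd; rewrite -!/(ev2 _ _ _) => e3.
have := cm_tri (ev2 P z w0) (ev2 P z w) (ev2 P z0 w0).
have := cm_leD (ev2 P z0 w0) (ev2 P z w); rewrite [cm (ev2 P z0 w0 - _)]cm_distC.
by move: e2 e3 le0; lra.
Qed.

(** The product of the distances from [w0] to the roots of [P z] is the modulus of
    [P z w0] over that of the leading coefficient. The former tends to 0 as [z]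
    tends to [z0], while the latter stays away from 0. *)
Lemma roots_lower_continuous P z0 (s : seq C) (e : R) :
  (lead_coef P).[z0] != 0 -> all (root (slice P z0)) s -> 0 < e ->
  exists2 d, 0 < d & forall z, cm (z - z0) < d ->
    forall w0, w0 \in s -> exists2 w, root (slice P z) w & cm (w - w0) < e.
Proof.
move=> l0 + e0; elim: s => [|w0 s IH] /=; first by exists 1.
move=> /andP[rw /IH[d d0 hd]].
have c0 : 0 < cm (lead_coef P).[z0] by rewrite cm_gt0.
have [d1 d10 hd1] := poly_continuous (lead_coef P) z0 (div2_gt0 c0).
set n := (size P).-1; set c := cm (lead_coef P).[z0] in c0 hd1.
have eta0 : 0 < c / 2 * e ^+ n by rewrite mulr_gt0 ?divr_gt0// exprn_gt0.
have [d2 d20 hd2] := poly_continuous P.[w0%:P] z0 eta0.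
exists (Order.min d (Order.min d1 d2)); first by rewrite !lt_min d0 d10.
move=> z; rewrite !lt_min => /and3P[zd zd1 zd2] w; rewrite inE => /orP[/eqP->|]; last exact: hd.
have lz : c / 2 <= cm (lead_coef P).[z].
  have := hd1 z zd1; have := cm_leD (lead_coef P).[z0] (lead_coef P).[z].
  by rewrite cm_distC -/c; lra.
have lz0 : (lead_coef P).[z] != 0.
  by rewrite -cm_gt0 (lt_le_trans _ lz)// divr_gt0.
have sz0 : slice P z != 0.
  by rewrite -size_poly_eq0 size_slice// size_poly_eq0 -lead_coef_eq0; apply: contraNneq l0 => ->; rewrite horner0.
have lead : lead_coef (slice P z) = (lead_coef P).[z].
  by rewrite /slice lead_coef_map_eq.
have [rs [rsE [rsn rsP]]] := poly_split (slice P z).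
have := hd2 z zd2; rewrite -!/(ev2 _ _ _) -(horner_slice P z0) (rootP rw) subr0.
rewrite -horner_slice rsP lead; apply: contraPP => hno; apply/negP; rewrite -leNgt.
rewrite ler_pM ?divr_ge0 ?exprn_ge0 ?(ltW c0) ?(ltW e0)//.
have -> : n = size rs by rewrite /n -(size_slice lz0) -rsn.
apply: prod_ge_exp; first exact: ltW.
move=> r rr; rewrite leNgt; apply/negP => rw0; apply: hno; exists r; first by rewrite -rsE.
by rewrite cm_distC.
Qed.

(** The leading coefficient of P(z, t z) in the variable z is a polynomial h(t),
    the homogeneous part of top degree of P. Dividing the equation P(z, t z) = 0
    by the highest power of z shows that h(t) = O(1 / |z|) for |t| <= 1. *)
Lemma top_form P : P != 0 -> exists2 h : {poly C}, h != 0 &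
  forall e : R, 0 < e -> exists r, forall z w, cm w <= cm z -> r < cm z ->
    ev2 P z w = 0 -> exists2 rho, root h rho & cm (w / z - rho) < e.
Proof.
move=> P0.
pose G : {poly {poly C}} := (map_poly (map_poly polyC) P).['X * ('X)%:P].
have GE t z : ev2 G t z = ev2 P z (z * t).
  pose psi : {rmorphism {poly {poly C}} -> C} := horner_eval t \o horner_eval z%:P.
  rewrite -[LHS]/(psi G) /G -horner_map/= -map_poly_comp/=.
  have -> : horner_eval t (horner_eval z%:P ('X * ('X)%:P)) = z * t.
    by rewrite /horner_eval hornerM hornerX hornerC hornerM hornerC hornerX.
  rewrite -horner_slice /slice; congr horner; apply: eq_map_poly => p /=.
  rewrite /horner_eval; elim/poly_ind: p => [|p c IH].
    by rewrite map_poly0 !horner0.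
  by rewrite rmorphD rmorphM/= map_polyX map_polyC/= hornerD hornerM hornerX hornerC hornerD hornerM !hornerC IH hornerMXaddC.
have G0 : G != 0.
  have XP0 : 'X%:P * P != 0 by rewrite mulf_neq0// polyC_eq0 polyX_eq0.
  have [z [w [_ _]]] := ev2_nonzero_near 0 0 XP0 ltr01.
  rewrite /ev2 hornerM hornerC hornerM hornerX mulf_eq0 negb_or => /andP[z0 Pzw].
  apply/eqP => G00; have := GE (w / z) z; rewrite G00 /ev2 !horner0 mulrC divfK//.
  by move=> /esym/eqP; rewrite (negbTE Pzw).
have [n nE] : exists n, size G = n.+1.
  by exists (size G).-1; rewrite prednK// size_poly_gt0.
exists (lead_coef G); first by rewrite lead_coef_eq0.
move=> e e0; have lG0 : lead_coef G != 0 by rewrite lead_coef_eq0.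
have [eta eta0 heta] := root_close lG0 e0.
have /choice[b hb] : forall k : nat, exists b : R, 0 <= b /\ forall t, cm t <= 1 -> cm (G`_k).[t] <= b.
  by move=> k; have [b b0 hb] := poly_bounded G`_k 1; exists b.
pose S := \sum_(k < n) b k; have S0 : 0 <= S by apply: sumr_ge0 => k _; exact: (hb k).1.
exists (Order.max 1 (S / eta)) => z w wz; rewrite gt_max => /andP[z1 zS] Pzw.
have z0 : z != 0 by rewrite -cm_gt0 (lt_trans _ z1).
have cz0 : 0 < cm z by rewrite cm_gt0.
set t := w / z; apply: heta.
have t1 : cm t <= 1 by rewrite cmM cmV ler_pdivrMr// mul1r.
have : ev2 G t z = 0 by rewrite GE /t mulrC divfK.
rewrite /ev2 [G.[_]]horner_coef nE horner_sum big_ord_recr/= => /eqP.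
rewrite addrC addr_eq0 => /eqP lE.
have {}lE : (lead_coef G).[t] * z ^+ n = - \sum_(k < n) (G`_k).[t] * z ^+ k.
  rewrite /lead_coef nE/=; move: lE; rewrite hornerM -rmorphXn hornerC => ->.
  by congr (- _); apply: eq_bigr => k _; rewrite hornerM -rmorphXn hornerC.
have zn0 : 0 < cm z ^+ n by rewrite exprn_gt0.
rewrite -(ltr_pM2r zn0) -cmX -cmM lE cmN cmX.
apply: (@le_lt_trans _ _ (S * cm z ^+ n.-1)).
  rewrite (le_trans (cm_sum _ _ _))// /S mulr_suml; apply: ler_sum => k _.
  rewrite cmM cmX ler_pM ?((hb k).2 _ t1) ?exprn_ge0 ?cm_ge0//.
  by rewrite ler_weXn2l ?(ltW z1)// -ltnS prednK// (leq_ltn_trans _ (ltn_ord k)).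
case: n nE lE zn0 @S S0 zS => [|n] nE lE zn0 S S0 zS.
  by rewrite /S big_ord0 mul0r expr0 mulr1.
by rewrite /= exprS mulrA ltr_pM2r ?exprn_gt0// mulrC -ltr_pdivrMr.
Qed.

End ComplexPolynomials.

(** * Monodromy of roots over a rectangle *)

Section RootMonodromy.
Variable R : realType.
Local Notation C := R[i].
Local Notation U := (cspace R 1).

(** Over a rectangle where the number of roots is constant, the roots form a
    covering. *)
Lemma root_loop_closes (P : {poly {poly C}}) (n : nat) (a0 a1 b0 b1 : R)
    (zeta w : R -> U) :
  (forall u, rect a0 a1 b0 b1 u -> (lead_coef P).[cx u] != 0 /\
     exists s, [/\ uniq s, size s = n & forall w, (w \in s) = root (slice P (cx u)) w]) ->
  @cont_on R R^o U `[0, 1] zeta -> @cont_on R R^o U `[0, 1] w ->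
  (forall t, `[0, 1]%classic t -> rect a0 a1 b0 b1 (zeta t) /\
     ev2 P (cx (zeta t)) (cx (w t)) = 0) ->
  zeta 0 = zeta 1 -> w 0 = w 1.
Proof.
move=> hP cz cw h z01.
pose E (u v : U) := root (slice P (cx u)) (cx v).
(* Each root at [u0] has a root at [u] nearby; these are distinct, hence all the
   roots at [u], by counting. *)
have match_roots u0 : rect a0 a1 b0 b1 u0 -> exists2 s0 : R, 0 < s0 &
    (forall v v', E u0 v -> E u0 v' -> mdist v v' < s0 -> v = v') /\
    forall e, 0 < e -> e <= s0 / 4 -> exists2 d, 0 < d & forall u,
      rect a0 a1 b0 b1 u -> mdist u0 u < d -> exists f : U -> U,
        (forall v0, E u0 v0 -> E u (f v0) /\ mdist (f v0) v0 < e) /\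
        (forall v, E u v -> exists2 v0, E u0 v0 & v = f v0).
  move=> Q0; have [l0 [s [us sn sE]]] := hP _ Q0.
  have [g g0 hg] := @seq_gap R _ [seq (x, y) | x <- s, y <- s] (fun p => cm (p.1 - p.2)).
  have gap x y : x \in s -> y \in s -> cm (x - y) < g -> x = y.
    move=> xs ys; rewrite ltNge; apply: contraNeq => xy.
    by apply: (hg (x, y)); rewrite ?allpairs_f// cm_gt0 subr_eq0.
  exists g => //; split.
    move=> v v'; rewrite /E -!sE mdist_cx => vs vs' /(gap _ _ vs vs') vv'.
    by rewrite -(cxK v) vv' cxK.
  move=> e e0 eg.
  have rs : all (root (slice P (cx u0))) s by apply/allP => x; rewrite sE.
  have [d d0 hd] := roots_lower_continuous l0 rs e0.
  exists d => // u Qu uu0; rewrite mdist_cx cm_distC in uu0.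
  have /choice[f hf] : forall x, exists y, x \in s ->
      root (slice P (cx u)) y /\ cm (y - x) < e.
    move=> x; have [xs|xs] := boolP (x \in s); last by exists 0.
    by have [y ry yx] := hd _ uu0 _ xs; exists y.
  exists (fun v => pt (f (cx v))); split.
    move=> v0; rewrite /E -sE mdist_cx !ptK => /hf[]; split => //.
  move=> v Ev; have [_ [s' [us' sn' sE']]] := hP _ Qu.
  have inj : {in s &, injective f}.
    move=> x y xs ys fxy; apply: gap => //.
    have [_ xe] := hf x xs; have [_ ye] := hf y ys.
    apply: (le_lt_trans (cm_tri (f x) _ _)); rewrite cm_distC {2}fxy.
    by move: xe ye eg e0 g0; lra.
  have ufs : uniq (map f s) by rewrite map_inj_in_uniq.
  have sub : {subset map f s <= s'}.
    by move=> _ /mapP[x xs ->]; rewrite sE'; have [] := hf x xs.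
  have [_ eqs] := uniq_min_size ufs sub (eq_leq (etrans sn' (esym (etrans (size_map _ _) sn)))).
  have : cx v \in map f s by rewrite eqs sE'.
  move=> /mapP[x xs vx]; exists (pt x); first by rewrite /E ptK -sE.
  by rewrite ptK -vx cxK.
apply: (@rect_lift_closes R U E a0 a1 b0 b1 _ _ zeta w) => //.
- move=> u0 /match_roots[s s0 [sep hs]] e e0.
  have [||d d0 hd] := hs (Order.min e (s / 4)).
  + by rewrite lt_min e0 divr_gt0.
  + by rewrite ge_min lexx orbT.
  exists d => // u Qu uu0; have [f [hf1 hf2]] := hd _ Qu uu0; split.
    move=> v /hf2[v0 Ev0 ->]; exists v0 => //.
    by have [_] := hf1 _ Ev0; rewrite lt_min => /andP[].
  move=> v0 Ev0; exists (f v0); first by have [] := hf1 _ Ev0.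
  by have [_] := hf1 _ Ev0; rewrite lt_min => /andP[].
- move=> u0 /match_roots[s s0 [sep hs]].
  have s40 : 0 < s / 4 by rewrite divr_gt0.
  have [d d0 hd] := hs _ s40 (lexx _).
  exists (s / 4) => //; exists d => // u Qu uu0 v v' Ev Ev' vv'.
  have [f [hf1 hf2]] := hd _ Qu uu0.
  have [v0 Ev0 vE] := hf2 _ Ev; have [v0' Ev0' vE'] := hf2 _ Ev'.
  rewrite vE vE'; congr f; apply: sep => //.
  have [_ h1] := hf1 _ Ev0; have [_ h2] := hf1 _ Ev0'.
  have := metric_triangle v0 (f v0) v0'; have := metric_triangle (f v0) (f v0') v0'.
  rewrite -vE -vE' in h1 h2 *; rewrite (metric_sym v0 v).
  by move: h1 h2 vv' s0; lra.
move=> t /h[Qt Et]; split => //; rewrite /E rootE horner_slice.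
exact/eqP.
Qed.

End RootMonodromy.

(** * Inner distances *)

Section InnerMetricLemmas.
Variables (R : realType).
Implicit Types (M : metricType R).

Lemma polygonal_length_le M (g : R -> M) (L : R) (s : seq R) :
  (forall a b, a \in `[0, 1] -> b \in `[0, 1] -> mdist (g a) (g b) <= L * `|b - a|) ->
  itv_partition 0 1 s -> polygonal_length g s <= L.
Proof.
move=> lg [ps /eqP ls]; rewrite /polygonal_length/=.
have hk k : (k < size s)%N -> (0 <= nth 1 (0 :: s) k <= 1) && (0 <= nth 1 s k <= 1) &&
    (nth 1 (0 :: s) k <= nth 1 s k).
  move=> ks; have ps' : itv_partition 0 1 s by split => //; apply/eqP.
  have lt : nth 1 (0 :: s) k < nth 1 s k by apply: (pathP 1 ps).
  have := itv_partition_nth_ge (m := k) _ ps'; have := itv_partition_nth_ge (m := k.+1) _ ps'.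
  have := itv_partition_nth_le (m := k) _ ps'; have := itv_partition_nth_le (m := k.+1) _ ps'.
  by rewrite !ltnS ks (ltnW ks) /= => -> // -> // -> // -> //; rewrite ltW.
apply: (@le_trans _ _ (\sum_(0 <= k < size s) L * (nth 1 (0 :: s) k.+1 - nth 1 (0 :: s) k))).
  rewrite !big_nat; apply: ler_sum => k /andP[_ ks].
  move: (hk k ks) => /andP[/andP[h1 h2] h3] /=.
  rewrite (le_trans (lg _ _ _ _))// ?in_itv//.
  by rewrite ger0_norm ?subr_ge0.
rewrite -mulr_sumr telescope_sumr// subr0.
have -> : nth 1 (0 :: s) (size s) = 1 by rewrite -(last_nth 1) ls.
by rewrite mulr1.
Qed.

Lemma inner_le_lipschitz M (X : set M) (g : R -> M) (L : R) :
  (forall a b, a \in `[0, 1] -> b \in `[0, 1] -> mdist (g a) (g b) <= L * `|b - a|) ->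
  (forall t, t \in `[0, 1] -> X (g t)) ->
  (inner_dist X (g 0%R) (g 1%R) <= L%:E)%E.
Proof.
move=> lg Xg; apply: (@le_trans _ _ (curve_length g)).
  apply: ereal_inf_lbound; exists g => //; split => //.
  apply/cont_on_curve; apply: (@cont_on_lip R R^o M _ _ L) => a b a01 b01.
  by rewrite mdistRE; exact: lg.
apply: ge_ereal_sup => _ [s ps <-]; rewrite lee_fin.
exact: polygonal_length_le.
Qed.

Lemma curve_length_ge M (g : R -> M) t : t \in `[0, 1] ->
  ((mdist (g 0%R) (g t))%:E <= curve_length g)%E.
Proof.
rewrite in_itv/= => /andP[t0 t1].
have g01 : ((mdist (g 0%R) (g 1%R))%:E <= curve_length g)%E.
  apply: ereal_sup_ubound; exists [:: 1].
    by split; rewrite /= ?ltr01.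
  by rewrite /polygonal_length/= big_nat1.
have [t00|tn0] := eqVneq t 0.
  by rewrite t00 mdistxx (le_trans _ g01)// lee_fin mdist_ge0.
have [->//|tn1] := eqVneq t 1.
apply: (@le_trans _ _ (polygonal_length g [:: t; 1])%:E).
  by rewrite lee_fin /polygonal_length/= big_nat_recl// big_nat1/= lerDl mdist_ge0.
apply: ereal_sup_ubound; exists [:: t; 1] => //.
by split; rewrite /= ?andbT// !lt_neqAle eq_sym tn0 t0 tn1 t1.
Qed.

Lemma inner_ge_outer M (X : set M) x y : ((mdist x y)%:E <= inner_dist X x y)%E.
Proof.
apply: le_ereal_inf_tmp => _ [g [_ <- <- _] <-].
by apply: curve_length_ge; rewrite in_itv/= lexx ler01.
Qed.

(** The length of a curve bounds the distance from its origin to its points. *)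
Lemma inner_lt_curve M (X : set M) x y (c : R) : (inner_dist X x y < c%:E)%E ->
  exists2 g, curve_in X x y g & forall t, t \in `[0, 1] -> mdist x (g t) < c.
Proof.
move=> /ereal_inf_lt[_ [g cg <-] lc]; exists g => // t t01.
have [_ <- _ _] := cg; rewrite -lte_fin.
exact: le_lt_trans (curve_length_ge g t01) lc.
Qed.

Section Model.
Variables (M N : metricType R) (X : set M) (Y : set N) (F : M -> N).
Hypotheses (YE : Y = F @` X) (lneY : LNE Y)
  (bilF : bilipschitz X (inner_dist X) (inner_dist Y) F).

Lemma lne_curves : exists2 K : R, 0 < K & forall y y', Y y -> Y y' -> y <> y' ->
  exists2 g, curve_in Y y y' g &
    forall t, t \in `[0, 1] -> mdist y (g t) < K * mdist y y'.
Proof.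
have [K K0 hK] := lneY; exists (2 * K); first by rewrite mulr_gt0.
move=> y y' Yy Yy' /eqP ne; apply: inner_lt_curve.
have /andP[_ h] := hK _ _ Yy Yy'; apply: le_lt_trans h _.
rewrite /outer_dist -EFinM lte_fin -mulrA ltr_pMl ?ltr1n//.
by rewrite mulr_gt0// mdist_gt0.
Qed.

(** On an LNE set the inner distance is at most a multiple of the outer one, and
    inner distances dominate outer ones on [X]. *)
Lemma model_inverse_lipschitz : exists2 K : R, 0 < K & forall p q, X p -> X q ->
  mdist p q <= K * mdist (F p) (F q).
Proof.
have [K K0 hK] := lneY; have [L L0 hL] := bilF.
exists (L * K); first by rewrite mulr_gt0.
move=> p q Xp Xq; have Yp : Y (F p) by rewrite YE; exists p.
have Yq : Y (F q) by rewrite YE; exists q.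
have /andP[h1 _] := hL _ _ Xp Xq; have /andP[_ h2] := hK _ _ Yp Yq.
have h3 := inner_ge_outer X p q.
have : (L^-1%:E * (mdist p q)%:E <= K%:E * (mdist (F p) (F q))%:E)%E.
  apply: le_trans h2; apply: le_trans h1; rewrite lee_wpmul2l// lee_fin invr_ge0 ltW//.
by rewrite -!EFinM lee_fin mulrC ler_pdivrMr// mulrC mulrA.
Qed.

Lemma model_lipschitz : exists2 L : R, 0 < L & forall p q c, X p -> X q ->
  (inner_dist X p q <= c%:E)%E -> mdist (F p) (F q) <= L * c.
Proof.
have [L L0 hL] := bilF; exists L => // p q c Xp Xq pq.
have /andP[_ h] := hL _ _ Xp Xq; rewrite -lee_fin EFinM.
apply: le_trans (inner_ge_outer Y (F p) (F q)) _; apply: le_trans h _.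
by rewrite lee_wpmul2l// lee_fin ltW.
Qed.

End Model.
End InnerMetricLemmas.

(** * The affine elliptic curve y^2 = x - x^3 *)

Section TheCurve.
Variable R : realType.
Local Notation C := R[i].
Implicit Types (p q : cspace R 2) (x y z w : C).

Local Notation i0 := (ord0 : 'I_2).
Local Notation i1 := (lift ord0 ord0 : 'I_2).

Definition mk x y : cspace R 2 := \row_(j < 2) if j == i0 then x else y.

Lemma co_mk0 x y : co (mk x y) i0 = x. Proof. by rewrite /co mxE eqxx. Qed.
Lemma co_mk1 x y : co (mk x y) i1 = y. Proof. by rewrite /co mxE. Qed.

Lemma ord2P (P : 'I_2 -> Prop) : P i0 -> P i1 -> forall j, P j.
Proof.
move=> P0 P1 j; have [->//|->//] : j = i0 \/ j = i1.
by case: j => -[|[|//]] h; [left|right]; apply: val_inj.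
Qed.

Lemma mkK p : mk (co p i0) (co p i1) = p.
Proof. by apply/cspace_eqP; apply: ord2P; rewrite ?co_mk0 ?co_mk1. Qed.

Lemma mdist2_le p q :
  mdist p q <= cm (co p i0 - co q i0) + cm (co p i1 - co q i1).
Proof. by rewrite (le_trans (mdist_le_sum _ _))// big_ord_recl big_ord1. Qed.

(** An elliptic curve minus its point at infinity. *)
Definition curve : set (cspace R 2) :=
  [set p | co p i1 ^+ 2 = co p i0 - co p i0 ^+ 3].

Lemma curve_mk x y : curve (mk x y) <-> y ^+ 2 = x - x ^+ 3.
Proof. by rewrite /curve/= co_mk0 co_mk1. Qed.

Lemma curve_above x : exists y, curve (mk x y).
Proof. by exists (sqrtc (x - x ^+ 3)); apply/curve_mk; rewrite sqr_sqrtc. Qed.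

Local Notation MP := (mpoly 2 C).
Let X0 : MP := mpolyX C (mnm1 i0).
Let X1 : MP := mpolyX C (mnm1 i1).

Definition curve_eq : MP := X1 ^+ 2 - X0 + X0 ^+ 3.

Lemma peval_X0 p : peval X0 p = co p i0. Proof. exact: mevalXU. Qed.
Lemma peval_X1 p : peval X1 p = co p i1. Proof. exact: mevalXU. Qed.

Lemma pevalD m (f g : mpoly m C) (p : cspace R m) : peval (f + g) p = peval f p + peval g p.
Proof. exact: mevalD. Qed.
Lemma pevalN m (f : mpoly m C) (p : cspace R m) : peval (- f) p = - peval f p.
Proof. exact: mevalN. Qed.
Lemma pevalM m (f g : mpoly m C) (p : cspace R m) : peval (f * g) p = peval f p * peval g p.
Proof. exact: mevalM. Qed.
Lemma pevalX m (f : mpoly m C) (p : cspace R m) n : peval (f ^+ n) p = peval f p ^+ n.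
Proof. exact: rmorphXn. Qed.
Lemma pevalC m c (p : cspace R m) : peval (mpolyC m c) p = c.
Proof. exact: mevalC. Qed.

Let peval_subX0 c p : peval (X0 - mpolyC 2 c) p = co p i0 - c.
Proof. by rewrite pevalD pevalN pevalC peval_X0. Qed.
Let peval_subX1 c p : peval (X1 - mpolyC 2 c) p = co p i1 - c.
Proof. by rewrite pevalD pevalN pevalC peval_X1. Qed.

Lemma peval_curve_eq p : peval curve_eq p = co p i1 ^+ 2 - co p i0 + co p i0 ^+ 3.
Proof. by rewrite pevalD pevalD pevalN !pevalX peval_X0 peval_X1. Qed.

Lemma curve_eqP p : curve p <-> peval curve_eq p = 0.
Proof.
rewrite peval_curve_eq /curve/=; split=> [->|h]; first by ring.
by apply/eqP; rewrite -subr_eq0 -h; apply/eqP; ring.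
Qed.

Lemma algebraic_zeros m (f : mpoly m C) : algebraic_set [set p : cspace R m | peval f p = 0].
Proof.
exists [:: f]; apply/seteqP; split=> [p /= fp g|p /= h]; last by rewrite h// mem_head.
by rewrite inE => /eqP->.
Qed.

Lemma algebraic_curve : algebraic_set curve.
Proof.
have -> : curve = [set p | peval curve_eq p = 0].
  by apply/seteqP; split=> p /curve_eqP.
exact: algebraic_zeros.
Qed.

Let inX (a : {poly C}) : MP := horner_alg X0 a.

Lemma peval_inX a p : peval (inX a) p = a.[co p i0].
Proof.
rewrite /inX; elim/poly_ind: a => [|a c IH]; first by rewrite rmorph0 horner0 /peval meval0.
rewrite hornerMXaddC rmorphD rmorphM/= horner_algX horner_algC pevalD pevalM IH peval_X0.
congr (_ + _); rewrite -[_%:A]mul1r -scalerAr mulr1.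
by rewrite /peval mevalZ meval1 mulr1.
Qed.

Let inXD a b : inX (a + b) = inX a + inX b. Proof. exact: rmorphD. Qed.
Let inXB a b : inX (a - b) = inX a - inX b. Proof. exact: rmorphB. Qed.
Let inXM a b : inX (a * b) = inX a * inX b. Proof. exact: rmorphM. Qed.
Let inX_X : inX 'X = X0. Proof. exact: horner_algX. Qed.
Let inXZ c a : inX (c *: a) = c *: inX a. Proof. by rewrite /inX linearZ/= mulr_algl. Qed.
Let inX1 : inX 1 = 1. Proof. exact: rmorph1. Qed.
Let inX0 : inX 0 = 0. Proof. exact: rmorph0. Qed.

(** By division by the equation, which is monic in y. *)
Lemma curve_normal_form (f : MP) : exists (a b : {poly C}) (q : MP),
  f = inX a + inX b * X1 + q * curve_eq.
Proof.
have nfD (A : comRingType) (a b q a' b' q' t e : A) :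
  a + b * t + q * e + (a' + b' * t + q' * e) = (a + a') + (b + b') * t + (q + q') * e.
  by ring.
have nfM (A : comRingType) (a b q x t e : A) :
  x * (a + b * t + q * e) = a * x + b * x * t + q * x * e by ring.
have nfY (A : comRingType) (a b q x t e : A) : e = t ^+ 2 - x + x ^+ 3 ->
  t * (a + b * t + q * e) = b * (x - x * (x * x)) + a * t + (b + q * t) * e.
  by move=> ->; ring.
pose ok (f : MP) := exists (a b : {poly C}) (q : MP), f = inX a + inX b * X1 + q * curve_eq.
have okZ c g : ok g -> ok (c *: g).
  move=> [a [b [q ->]]]; exists (c *: a), (c *: b), (c *: q).
  by rewrite !inXZ -!scalerAl -!scalerDr.
have okD g h : ok g -> ok h -> ok (g + h).
  move=> [a [b [q ->]]] [a' [b' [q' ->]]]; exists (a + a'), (b + b'), (q + q').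
  by rewrite !inXD nfD.
have ok1 : ok 1 by exists 1, 0, 0; rewrite inX1 inX0 !mul0r !addr0.
have okX0 g n : ok g -> ok (X0 ^+ n * g).
  move=> og; elim: n => [|n [a [b [q IH]]]]; first by rewrite expr0 mul1r.
  exists (a * 'X), (b * 'X), (q * X0).
  by rewrite exprS -mulrA IH nfM !inXM inX_X.
have okX1 g n : ok g -> ok (X1 ^+ n * g).
  move=> og; elim: n => [|n [a [b [q IH]]]]; first by rewrite expr0 mul1r.
  exists (b * ('X - 'X * ('X * 'X))), a, (inX b + q * X1).
  by rewrite exprS -mulrA IH (nfY _ _ _ _ X0)// inXM inXB !inXM inX_X.
rewrite -/(ok f); elim/mpolyind: f => [|c m f _ _ IH].
  by rewrite -[0](scale0r 1); exact: okZ.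
apply: okD => //; apply: okZ; rewrite mpolyXE_id big_ord_recl big_ord1.
by apply: okX0; rewrite -[_ ^+ _]mulr1; exact: okX1.
Qed.

Let peval_normal_form a b (q : MP) p : curve p ->
  peval (inX a + inX b * X1 + q * curve_eq) p = a.[co p i0] + b.[co p i0] * co p i1.
Proof.
move=> /curve_eqP cp; rewrite (pevalD (inX a + inX b * X1)) (pevalD (inX a)).
rewrite (pevalM q curve_eq) cp.
rewrite mulr0.
rewrite addr0.
rewrite (peval_inX a).
rewrite (pevalM (inX b) X1).
rewrite (peval_inX b).
by rewrite peval_X1.
Qed.

(** The norm of [a + b y] over the polynomials in x. A square is not the product
    of a square by a polynomial of odd degree. *)
Lemma norm_eq0 (a b : {poly C}) :
  a ^+ 2 - b ^+ 2 * ('X - 'X ^+ 3) = 0 -> a = 0 /\ b = 0.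
Proof.
move=> /eqP; rewrite subr_eq0 => /eqP E.
have g3 : size ('X - 'X ^+ 3 : {poly C}) = 4.
  by rewrite addrC size_polyDl size_polyN size_polyXn// size_polyX.
have g0 : ('X - 'X ^+ 3 : {poly C}) != 0 by rewrite -size_poly_eq0 g3.
have [b0|b0] := eqVneq b 0.
  split => //; apply/eqP; rewrite -sqrf_eq0 E b0 expr0n mul0r//.
have a0 : a != 0 by rewrite -sqrf_eq0 E mulf_neq0// sqrf_eq0.
have := congr1 (fun p : {poly C} => odd (size p)) E.
rewrite (@size_mul _ (b ^+ 2)) ?sqrf_eq0// g3 !expr2 !size_mul//.
move: a0 b0; rewrite -!size_poly_gt0; case: (size a) (size b) => [//|m] [//|n] _ _.
by rewrite !addnS !addSn /= ?oddD ?addbb.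
Qed.

(** The norm of a function that vanishes at a point vanishes at its abscissa. *)
Lemma curve_vanishing (f : MP) : vanishes_on curve f \/
  exists2 B : {poly C}, B != 0 & forall p, curve p -> peval f p = 0 -> B.[co p i0] = 0.
Proof.
have [a [b [q fE]]] := curve_normal_form f.
have [N0|N0] := eqVneq (a ^+ 2 - b ^+ 2 * ('X - 'X ^+ 3)) 0.
  have [a0 b0] := norm_eq0 N0; left => p cp.
  by rewrite fE peval_normal_form// a0 b0 !horner0 mul0r addr0.
right; exists (a ^+ 2 - b ^+ 2 * ('X - 'X ^+ 3)) => // p cp.
rewrite fE peval_normal_form// => /eqP; rewrite addr_eq0 => /eqP aE.
rewrite !(hornerD, hornerM, hornerN, hornerX, expr2, exprS, expr0, mulr1) aE.
rewrite /curve/= in cp.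
transitivity (b.[co p i0] ^+ 2 * (co p i1 ^+ 2 - (co p i0 - co p i0 ^+ 3))); first by ring.
by rewrite cp subrr mulr0.
Qed.

Lemma vanishing_multiple (f : MP) : vanishes_on curve f -> exists q : MP, f = q * curve_eq.
Proof.
move=> vf; have [a [b [q fE]]] := curve_normal_form f.
suff N0 : a ^+ 2 - b ^+ 2 * ('X - 'X ^+ 3) = 0.
  by have [a0 b0] := norm_eq0 N0; exists q; rewrite fE a0 b0 inX0 mul0r !add0r.
apply/eqP/negPn/negP => /closed_nonrootP[x]; rewrite rootE => /negP; apply.
have [y cp] := curve_above x; have := vf _ cp; move: (cp) => /curve_mk yx.
rewrite fE peval_normal_form// co_mk0 co_mk1 => /eqP; rewrite addr_eq0 => /eqP aE.
rewrite !(hornerD, hornerM, hornerN, hornerX, expr2, exprS, expr0, mulr1) aE.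
apply/eqP; transitivity (b.[x] ^+ 2 * (y ^+ 2 - (x - x ^+ 3))); first by ring.
by rewrite yx subrr mulr0.
Qed.

Lemma algebraic_contains_curve (A : set (cspace R 2)) : algebraic_set A ->
  curve `<=` A \/
  exists2 B : {poly C}, B != 0 & forall p, curve p -> A p -> B.[co p i0] = 0.
Proof.
move=> [fs ->].
have [h|h] := pselect (forall f, f \in fs -> vanishes_on curve f).
  by left => p cp f /h; apply.
right; move: h => /existsNP[f /not_implyP[ffs nv]].
have [//|[B B0 hB]] := curve_vanishing f; exists B => // p cp Ap.
by apply: hB => //; exact: Ap.
Qed.

Lemma curve_irreducible : irreducible_set curve.
Proof.
split; first exact: algebraic_curve.
  by have [y cy] := curve_above 0; exists (mk 0 y).
move=> A B /algebraic_contains_curve[|[P P0 hP]]; first by left.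
move=> /algebraic_contains_curve[|[Q Q0 hQ] cAB]; first by right.
have [x] := closed_nonrootP _ (mulf_neq0 P0 Q0).
have [y cp] := curve_above x; rewrite rootE hornerM mulf_eq0 negb_or => /andP[Px Qx].
case: (cAB _ cp) => [/(hP _ cp)|/(hQ _ cp)]; rewrite co_mk0 => /eqP.
  by rewrite (negbTE Px).
by rewrite (negbTE Qx).
Qed.

(** By induction: the zeros of a product are the union of those of its factors. *)
Lemma irreducible_factor m (Z : set (cspace R m)) (fs : seq (mpoly m C)) :
  irreducible_set Z -> (forall u, Z u -> exists2 f, f \in fs & peval f u = 0) ->
  exists2 f, f \in fs & vanishes_on Z f.
Proof.
move=> [_ [p0 Zp0] irr]; elim: fs => [|f fs IH] h; first by case: (h _ Zp0).
pose g := \prod_(f <- fs) f.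
have gE (p : cspace R m) : peval g p = 0 -> exists2 f, f \in fs & peval f p = 0.
  rewrite /g; elim: (fs) => [|k ks IHk]; first by rewrite big_nil /peval meval1 => /eqP; rewrite oner_eq0.
  rewrite big_cons pevalM => /eqP; rewrite mulf_eq0 => /orP[/eqP kp|/eqP/IHk[l lk lp]].
    by exists k => //; rewrite mem_head.
  by exists l => //; rewrite inE lk orbT.
have gE' (p : cspace R m) l : l \in fs -> peval l p = 0 -> peval g p = 0.
  move=> + lp; rewrite /g; elim: (fs) => [//|k ks IHk].
  rewrite inE big_cons pevalM => /orP[/eqP <-|/IHk ->]; first by rewrite lp mul0r.
  by rewrite mulr0.
have [p Zp|Zf|Zg] := irr _ _ (algebraic_zeros f) (algebraic_zeros g).
- have [l] := h _ Zp; rewrite inE => /orP[/eqP -> lp|lfs lp]; first by left.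
  by right; exact: gE' lp.
- by exists f; [rewrite mem_head|exact: Zf].
have [p Zp|l lfs lZ] := IH; first exact/gE/Zg.
by exists l => //; rewrite inE lfs orbT.
Qed.

(** The polynomial [B] splits into linear factors, so the abscissa is constant on
    [Z]; then so is the ordinate, as its square is constant. *)
Lemma small_irreducible (Z : set (cspace R 2)) (B : {poly C}) : irreducible_set Z ->
  Z `<=` curve -> B != 0 -> (forall p, Z p -> B.[co p i0] = 0) ->
  exists p, Z = [set p].
Proof.
move=> irrZ Zc B0 hB; have [rs [rsE _]] := poly_split B.
have [p Zp|_ /mapP[x _ ->] Zx] := @irreducible_factor 2 Z [seq X0 - mpolyC 2 r | r <- rs] irrZ.
  exists (X0 - mpolyC 2 (co p i0)).
    by apply: map_f; rewrite rsE// rootE hB.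
  by rewrite peval_subX0 subrr.
have xE p : Z p -> co p i0 = x.
  move=> /Zx; rewrite peval_subX0 => /eqP.
  by rewrite subr_eq0 => /eqP.
pose y := sqrtc (x - x ^+ 3).
have [p Zp|k ks Zy] := @irreducible_factor 2 Z [seq X1 - mpolyC 2 r | r <- [:: y; - y]] irrZ.
  have := Zc _ Zp; rewrite /curve/= xE// -(sqr_sqrtc (x - x ^+ 3)) -/y => /eqP.
  rewrite eqf_sqr => /orP[/eqP yE|/eqP yE].
    exists (X1 - mpolyC 2 y); first by rewrite /= mem_head.
    by rewrite peval_subX1 yE subrr.
  exists (X1 - mpolyC 2 (- y)); first by rewrite /= !inE eqxx orbT.
  by rewrite peval_subX1 yE subrr.
case/mapP: ks Zy => y' _ -> Zy.
have [_ [p0 Zp0] _] := irrZ; exists p0; apply/seteqP; split=> [p Zp|p ->//].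
have h q : Z q -> co q i1 = y'.
  by move=> /Zy; rewrite peval_subX1 => /eqP; rewrite subr_eq0 => /eqP.
by rewrite /= -(mkK p) -(mkK p0) !xE// !h.
Qed.

Lemma singleton_irreducible p : irreducible_set [set p].
Proof.
split; last 2 first.
- by exists p.
- by move=> A B _ _ h; have [|] := h p erefl; [left|right] => _ ->.
exists [:: X0 - mpolyC 2 (co p i0); X1 - mpolyC 2 (co p i1)].
apply/seteqP; split=> [q -> f|q h].
  by rewrite !inE => /orP[|]/eqP->; rewrite ?peval_subX0 ?peval_subX1 subrr.
rewrite /= -(mkK p) -(mkK q); congr mk; apply/eqP; rewrite -subr_eq0.
  by have := h (X0 - mpolyC 2 (co p i0)); rewrite mem_head peval_subX0 => ->.
have := h (X1 - mpolyC 2 (co p i1)); rewrite !inE eqxx orbT peval_subX1.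
by move=> ->.
Qed.

(** A proper algebraic subset of the curve has finitely many abscissas, so it is a
    point if it is irreducible. *)
Lemma curve_dim : algebraic_dim curve 1.
Proof.
split.
  exists (fun k => if k is 0%N then [set mk 0 0] else curve).
  have c0 : curve (mk 0 0) by apply/curve_mk; rewrite !expr0n/= subr0.
  split.
  - by move=> [|k] _; [exact: singleton_irreducible|exact: curve_irreducible].
  - by move=> [|k] _ //= q ->.
  - move=> [|//] _; split; first by move=> q ->.
    move=> h; have c1 : curve (mk 1 0) by apply/curve_mk; rewrite expr0n expr1n subrr.
    have /(congr1 (fun q => co q i0)) := h _ c1; rewrite !co_mk0 => /eqP.
    by rewrite oner_eq0.
move=> e [Z [irrZ ZX ltZ]]; rewrite leqNgt; apply/negP => e2.
have [Z01 n01] := ltZ 0%N (leq_trans (isT : 0 < 2)%N e2).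
have [Z12 n12] := ltZ 1%N e2.
have irr1 := irrZ 1%N (ltnW e2); have [alg1 _ _] := irr1.
have [cZ1|[B B0 hB]] := algebraic_contains_curve alg1.
  by apply: n12 => q /(ZX _ e2) /cZ1.
have [p pE] := @small_irreducible _ B irr1 (ZX _ (ltnW e2)) B0
  (fun p Zp => hB p (ZX _ (ltnW e2) p Zp) Zp).
apply: n01; rewrite pE => _ ->.
have [_ [q Zq] _] := irrZ 0%N (leq0n _).
by have := Z01 _ Zq; rewrite pE /= => <-.
Qed.

Let pderiv (f : MP) i p : C := peval (mderiv i f) p.

Let pderivD f g i p : pderiv (f + g) i p = pderiv f i p + pderiv g i p.
Proof. by rewrite /pderiv mderivD pevalD. Qed.
Let pderivN f i p : pderiv (- f) i p = - pderiv f i p.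
Proof. by rewrite /pderiv mderivN pevalN. Qed.
Let pderivM f g i p :
  pderiv (f * g) i p = pderiv f i p * peval g p + peval f p * pderiv g i p.
Proof. by rewrite /pderiv mderivM pevalD !pevalM. Qed.
Let pderivXU j i p : pderiv (mpolyX C (mnm1 j)) i p = (j == i)%:R.
Proof.
rewrite /pderiv mderivX mnm1E /peval mevalZ; case: eqVneq => [->|]; last by rewrite mul0r.
have -> : mnm_sub (mnm1 i) (mnm1 i) = @mnm0 2 by apply/mnmP => k; rewrite mnmBE mnm0E subnn.
by rewrite mpolyX0 meval1 mulr1.
Qed.

Let curve_eq_expanded : curve_eq = X1 * X1 + (- X0 + X0 * (X0 * X0)).
Proof. by rewrite addrA /curve_eq !exprS expr0 !mulr1. Qed.

Let pderiv_curve0 p : pderiv curve_eq i0 p = 3 * co p i0 ^+ 2 - 1.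
Proof.
rewrite curve_eq_expanded (pderivD (X1 * X1)) (pderivD (- X0)) pderivN !pderivM.
by rewrite !pderivXU peval_X0 peval_X1 (pevalM X0 X0) peval_X0 /=; ring.
Qed.

Let pderiv_curve1 p : pderiv curve_eq i1 p = 2 * co p i1.
Proof.
rewrite curve_eq_expanded (pderivD (X1 * X1)) (pderivD (- X0)) pderivN !pderivM.
by rewrite !pderivXU peval_X0 peval_X1 (pevalM X0 X0) peval_X0 /=; ring.
Qed.

(** The functions that vanish on the curve are the multiples of its equation, so
    the tangent space is the kernel of one nonzero linear form. *)
Lemma curve_smooth : smooth_of_dim curve 1.
Proof.
move=> p cp; set x := co p i0; set y := co p i1.
pose v : 'rV[C]_2 := \row_(j < 2) if j == i0 then 2 * y else 1 - 3 * x ^+ 2.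
have two0 : (2 : C) != 0 by rewrite pnatr_eq0.
have grad0 : y = 0 -> 1 - 3 * x ^+ 2 != 0.
  move=> y0; apply/eqP => h1.
  have := cp; rewrite /curve/= -/x -/y y0 expr0n/= => /esym h2.
  have x0 : x = 0.
    apply: (mulfI two0); rewrite mulr0.
    transitivity (3 * (x - x ^+ 3) - (1 - 3 * x ^+ 2) * x); first by ring.
    by rewrite h1 h2 mulr0 mul0r subr0.
  by move: h1; rewrite x0 expr0n/= mulr0 subr0 => /eqP; rewrite oner_eq0.
have v0 : v != 0.
  apply/eqP => /matrixP v0; have := v0 ord0 i1; have := v0 ord0 i0; rewrite !mxE/= => /eqP.
  by rewrite mulf_eq0 (negbTE two0)/= => /eqP/grad0/eqP.
have tangentE f (u : 'rV[C]_2) : \sum_(i < 2) peval (mderiv i f) p * u ord0 i =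
    pderiv f i0 p * u ord0 i0 + pderiv f i1 p * u ord0 i1.
  by rewrite big_ord_recl big_ord1.
exists <[v]>%VS; first by rewrite dim_vline v0.
move=> u; split.
  move=> /vlineP[k ->] f /vanishing_multiple[q ->].
  rewrite tangentE !(pderivM q curve_eq) pderiv_curve0 pderiv_curve1.
  have /curve_eqP -> := cp; rewrite !mxE/= -/x -/y; ring.
move=> /(_ curve_eq); rewrite tangentE pderiv_curve0 pderiv_curve1 -/x -/y => h.
have {}h : (3 * x ^+ 2 - 1) * u ord0 i0 + 2 * y * u ord0 i1 = 0.
  by apply: h => q /curve_eqP.
apply/vlineP.
suff [k [k0 k1]] : exists k, u ord0 i0 = k * (2 * y) /\ u ord0 i1 = k * (1 - 3 * x ^+ 2).
  by exists k; apply/rowP; apply: ord2P; rewrite !mxE.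
have [y0|y0] := eqVneq y 0.
  have g0 := grad0 y0; exists (u ord0 i1 / (1 - 3 * x ^+ 2)); rewrite divfK//; split => //.
  apply: (mulfI g0); rewrite y0 !mulr0; move: h; rewrite y0 mulr0 mul0r addr0.
  by move=> /(congr1 -%R); rewrite oppr0 => <-; ring.
exists (u ord0 i0 / (2 * y)); rewrite divfK ?mulf_neq0//; split => //.
apply: (mulfI (mulf_neq0 two0 y0)).
rewrite mulrA [_ * (_ / _)]mulrCA divff ?mulf_neq0// mulr1.
by apply/eqP; rewrite -subr_eq0 -h; apply/eqP; ring.
Qed.

End TheCurve.

(** * Lipschitz charts of the curve *)

Section ComplexSquareRoot.
Variable R : realType.
Local Notation C := R[i].
Implicit Types (z w : C).

Lemma Re_sqrtc_ge z (c : R) : 0 <= c -> c ^+ 2 <= complex.Re z -> c <= complex.Re (sqrtc z).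
Proof.
case: z => a b /= c0 ca.
have a0 : 0 <= a by rewrite (le_trans _ ca)// sqr_ge0.
rewrite -(ger0_norm c0) -sqrtr_sqr ler_wsqrtr// ler_pdivlMr// (le_trans (y := a * 2))//.
  by rewrite ler_wpM2r.
have : `|a| <= Num.sqrt (a ^+ 2 + b ^+ 2) by rewrite -sqrtr_sqr ler_wsqrtr// lerDl sqr_ge0.
rewrite ger0_norm//; lra.
Qed.

Lemma sqrtc_unique z w : w ^+ 2 = z -> 0 < complex.Re w -> 0 < complex.Re (sqrtc z) ->
  w = sqrtc z.
Proof.
move=> wz w0 s0; have /eqP : w ^+ 2 = sqrtc z ^+ 2 by rewrite sqr_sqrtc.
rewrite eqf_sqr => /orP[/eqP//|/eqP wE].
by move: w0; rewrite wE ReN oppr_gt0 => /(lt_trans s0); rewrite ltxx.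
Qed.

Lemma sqrtc_sub z w : cm (sqrtc z - sqrtc w) * cm (sqrtc z + sqrtc w) = cm (z - w).
Proof. by rewrite -cmM -subr_sqr !sqr_sqrtc. Qed.

Lemma sqrtc_lipschitz z w : 1 / 4 <= complex.Re z -> 1 / 4 <= complex.Re w ->
  cm (sqrtc z - sqrtc w) <= cm (z - w).
Proof.
move=> z4 w4; rewrite -sqrtc_sub ler_peMr ?cm_ge0//.
have h0 : (1 / 2 : R) ^+ 2 = 1 / 4 by field.
have h1 : 1 / 2 <= complex.Re (sqrtc z) by apply: Re_sqrtc_ge => //; rewrite h0.
have h2 : 1 / 2 <= complex.Re (sqrtc w) by apply: Re_sqrtc_ge => //; rewrite h0.
apply: le_trans (Re_le_cm _); apply: le_trans (ler_norm _); rewrite ReD; lra.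
Qed.

Lemma sqrtc_upper z : 0 <= complex.Im z ->
  0 <= complex.Re (sqrtc z) /\ 0 <= complex.Im (sqrtc z).
Proof.
case: z => a b /= b0; split; first exact: sqrtr_ge0.
case: eqP => _; first by rewrite mul1r sqrtr_ge0.
by rewrite mulr_ge0// ?sqrtr_ge0// sgr_ge0.
Qed.

(** The principal square root maps the closed upper half plane to the closed first
    quadrant, where the modulus of a difference is at most that of the sum. *)
Lemma sqrtc_hoelder z w : 0 <= complex.Im z -> 0 <= complex.Im w ->
  cm (sqrtc z - sqrtc w) ^+ 2 <= cm (z - w).
Proof.
move=> /sqrtc_upper[a0 b0] /sqrtc_upper[c0 d0].
rewrite expr2 -sqrtc_sub ler_wpM2l ?cm_ge0//.
rewrite -(@ler_pXn2r _ 2)// ?nnegrE ?cm_ge0// !cmsq !ReD !ImD !ReN !ImN.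
by move: a0 b0 c0 d0; nra.
Qed.

End ComplexSquareRoot.

Section Charts.
Variable R : realType.
Local Notation C := R[i].
Implicit Types (x y z w u v : C).

Lemma poly_lipschitz (p : {poly C}) (r : R) : exists2 L, 0 <= L & forall u v,
  cm u <= r -> cm v <= r -> cm (p.[u] - p.[v]) <= L * cm (u - v).
Proof.
elim/poly_ind: p => [|p c [L L0 hL]].
  by exists 0 => // u v _ _; rewrite !horner0 subr0 cm0 mul0r.
have [b b0 hb] := poly_bounded p r.
exists (b + L * `|r|); first by rewrite addr_ge0// mulr_ge0.
move=> u v ur vr; rewrite !hornerMXaddC.
have -> : p.[u] * u + c - (p.[v] * v + c) = p.[u] * (u - v) + (p.[u] - p.[v]) * v by ring.
rewrite (le_trans (cmD _ _))// !cmM mulrDl lerD ?ler_wpM2r ?hb ?cm_ge0//.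
rewrite mulrAC ler_pM ?cm_ge0// ?hL//.
by rewrite (le_trans vr)// ler_norm.
Qed.

(** The last condition says that [phi] maps every neighbourhood of 0 onto a
    neighbourhood of [p] in [X]. *)
Definition lipschitz_chart (X : set (cspace R 2)) (p : cspace R 2)
    (phi : C -> cspace R 2) (r L : R) : Prop :=
  [/\ forall u, cm u <= r -> X (phi u),
      forall u v, cm u <= r -> cm v <= r -> mdist (phi u) (phi v) <= L * cm (u - v),
      phi 0 = p &
      forall d, 0 < d -> exists2 e, 0 < e & forall q, X q -> mdist p q < e ->
        exists2 u, cm u < d & phi u = q].

(* All the charts have this form, with [h] close to 1 on the disc. *)
Let sqrt_param (a b h : {poly C}) u : cspace R 2 := mk a.[u] (b.[u] * sqrtc h.[u]).

Let near_one z : cm (z - 1) <= 1 / 2 -> 1 / 4 <= complex.Re z.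
Proof.
move=> h; have := le_trans (Re_le_cm _) h; rewrite ReD ReN/= ler_norml => /andP[+ _].
lra.
Qed.

Let near_one_ge z : cm (z - 1) <= 1 / 2 -> 1 / 2 <= complex.Re (sqrtc z).
Proof.
by move=> /near_one h; apply: Re_sqrtc_ge => //; rewrite (_ : (1 / 2) ^+ 2 = 1 / 4)//; field.
Qed.

Let sqrt_param_lipschitz (a b h : {poly C}) (r : R) :
  (forall u, cm u <= r -> cm (h.[u] - 1) <= 1 / 2) ->
  exists2 L, 0 < L & forall u v, cm u <= r -> cm v <= r ->
    mdist (sqrt_param a b h u) (sqrt_param a b h v) <= L * cm (u - v).
Proof.
move=> h1.
have [La La0 hLa] := poly_lipschitz a r; have [Lb Lb0 hLb] := poly_lipschitz b r.
have [Lh Lh0 hLh] := poly_lipschitz h r; have [B B0 hB] := poly_bounded b r.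
exists (La + (B * Lh + Lb * 2) + 1).
  by rewrite ltr_wpDl// addr_ge0// addr_ge0// mulr_ge0.
move=> u v ur vr; apply: (le_trans (mdist2_le _ _)); rewrite !co_mk0 !co_mk1.
set s := sqrtc h.[u]; set t := sqrtc h.[v].
have -> : b.[u] * s - b.[v] * t = b.[u] * (s - t) + (b.[u] - b.[v]) * t by ring.
have st : cm (s - t) <= Lh * cm (u - v).
  by rewrite (le_trans (sqrtc_lipschitz _ _))//; [exact/near_one/h1|exact/near_one/h1|exact: hLh].
have t2 : cm t <= 2.
  rewrite -(@ler_pXn2r _ 2)// ?nnegrE ?cm_ge0// -cmX sqr_sqrtc.
  have := h1 v vr; have := cm_leD h.[v] 1; rewrite cm1 => ? ?.
  rewrite (_ : (2 : R) ^+ 2 = 4); [lra|by ring].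
have := hLb _ _ ur vr; move: (b.[u] - b.[v]) => bb hbb.
rewrite !mulrDl mul1r -addrA lerD ?hLa// -[leLHS]addr0 lerD ?cm_ge0//.
apply: (le_trans (cmD _ _)); rewrite !cmM lerD//.
  by rewrite -mulrA ler_pM ?cm_ge0// hB.
by rewrite mulrAC ler_pM ?cm_ge0.
Qed.

Lemma curve_chart p : @curve R p -> exists phi r L,
  [/\ 0 < r, 0 < L & lipschitz_chart (@curve R) p phi r L].
Proof.
move=> cp; set x0 := co p ord0; set y0 := co p (lift ord0 ord0).
have pE : p = mk x0 y0 by rewrite mkK.
have {}cp : y0 ^+ 2 = x0 - x0 ^+ 3 by move: cp; rewrite pE => /curve_mk.
have half0 : (0 : R) < 1 / 2 by rewrite divr_gt0.
have mk_near q e : mdist p q < e -> cm (co q ord0 - x0) < e /\ cm (co q (lift ord0 ord0) - y0) < e.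
  by move=> pq; split; rewrite cm_distC; apply: le_lt_trans pq; exact: co_le_mdist.
have [y00|y00] := eqVneq y0 0.
  (* At a branch point the ordinate is a local coordinate, up to a factor that has a
     square root: with x = x0 + v, the equation reads y^2 = v (h0 - 3 x0 v - v^2). *)
  pose h0 : C := 1 - 3 * x0 ^+ 2.
  have h00 : h0 != 0.
    apply/eqP => h00; move: cp; rewrite y00 expr0n/= => /esym c0.
    have two0 : (2 : C) != 0 by rewrite pnatr_eq0.
    have x00 : x0 = 0.
      apply: (mulfI two0); rewrite mulr0.
      transitivity (3 * (x0 - x0 ^+ 3) - h0 * x0); first by rewrite /h0; ring.
      by rewrite h00 c0 mulr0 mul0r subr0.
    by move: h00; rewrite /h0 x00 expr0n/= mulr0 subr0 => /eqP; rewrite oner_eq0.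
  pose h : {poly C} := h0^-1 *: (h0%:P - (3 * x0) *: 'X - 'X ^+ 2).
  have hE v : h0 * h.[v] = h0 - 3 * x0 * v - v ^+ 2.
    by rewrite /h hornerZ mulrA divff// mul1r !(hornerD, hornerN, hornerZ, hornerX, hornerXn, hornerC).
  have gE v : (x0 + v) - (x0 + v) ^+ 3 = v * (h0 * h.[v]).
    rewrite hE; transitivity ((x0 - x0 ^+ 3) + v * (h0 - 3 * x0 * v - v ^+ 2)).
      by rewrite /h0; ring.
    by rewrite -cp y00 expr0n add0r.
  have h1 : h.[0] = 1.
    apply: (mulfI h00); rewrite hE; ring.
  pose k := sqrtc h0; have k2 : k ^+ 2 = h0 by rewrite sqr_sqrtc.
  have k0 : k != 0 by rewrite -sqrf_eq0 k2.
  pose hh := h \Po 'X ^+ 2.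
  have hhE u : hh.[u] = h.[u ^+ 2] by rewrite horner_comp hornerXn.
  have [d d0 hd] := poly_continuous h 0 half0.
  have [d' d'0 hd'] := poly_continuous hh 0 half0.
  pose r := d' / 2; have r0 : 0 < r by rewrite divr_gt0.
  have hhr u : cm u <= r -> cm (hh.[u] - 1) <= 1 / 2.
    move=> ur; have := hd' u; rewrite subr0 (hhE 0) expr0n/= h1 => H; apply/ltW/H.
    by rewrite (le_lt_trans ur)// ltr_pdivrMr// ltr_pMr// ltr1n.
  have [L L0 hL] := @sqrt_param_lipschitz (x0%:P + 'X ^+ 2) (k *: 'X) hh r hhr.
  exists (sqrt_param (x0%:P + 'X ^+ 2) (k *: 'X) hh), r, L; split => //; split => //.
  - move=> u ur; apply/curve_mk; rewrite exprMn sqr_sqrtc hornerZ hornerX hornerD hornerC hornerXn gE.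
    by rewrite hhE exprMn k2; ring.
  - rewrite pE y00 /sqrt_param !(hornerD, hornerC, hornerXn, hornerZ, hornerX).
    by rewrite expr0n/= addr0 mulr0 mul0r.
  move=> e e0; exists (Order.min d (e * cm k / 2)).
    by rewrite lt_min d0 !divr_gt0// mulr_gt0// cm_gt0.
  move=> q cq /mk_near[]; rewrite y00 subr0 !lt_min => /andP[xd _] /andP[_ ye].
  set x := co q ord0 in xd *; set y := co q (lift ord0 ord0) in ye *.
  pose v := x - x0; have xE : x = x0 + v by rewrite /v addrC subrK.
  have hv : cm (h.[v] - 1) <= 1 / 2.
    by have := hd v; rewrite subr0 h1 => H; apply/ltW/H.
  pose s := sqrtc h.[v]; have s12 := near_one_ge hv.
  have s0 : s != 0.
    apply/eqP => s0; move: s12; rewrite -/s s0 /=; apply/negP; rewrite -ltNge//.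
  have yE : y ^+ 2 = v * (h0 * h.[v]) by rewrite -gE -xE; exact: cq.
  pose u := y / (k * s).
  have u2 : u ^+ 2 = v.
    rewrite /u expr_div_n exprMn k2 sqr_sqrtc yE mulrK//.
    by rewrite unitfE mulf_neq0// -(sqr_sqrtc h.[v]) sqrf_eq0.
  exists u.
    rewrite /u cmM cmV cmM ltr_pdivrMr ?mulr_gt0 ?cm_gt0//.
    apply: (lt_le_trans ye); rewrite -mulrA ler_pM2l// ler_pM2l ?cm_gt0//.
    have := le_trans s12 (le_trans (ler_norm _) (Re_le_cm _)); rewrite -/s; lra.
  rewrite -(mkK q) -/x -/y /sqrt_param !(hornerD, hornerC, hornerXn, hornerZ, hornerX).
  rewrite hhE u2 -xE -/s; congr mk; rewrite /u; field.
  by rewrite k0 s0.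
(* Elsewhere the abscissa is a local coordinate. *)
pose g : {poly C} := (x0%:P + 'X) - (x0%:P + 'X) ^+ 3.
have gE v : g.[v] = (x0 + v) - (x0 + v) ^+ 3.
  by rewrite /g !(hornerD, hornerN, horner_exp, hornerC, hornerX).
pose h := (y0 ^+ 2)^-1 *: g.
have y20 : y0 ^+ 2 != 0 by rewrite sqrf_eq0.
have hE v : y0 ^+ 2 * h.[v] = (x0 + v) - (x0 + v) ^+ 3.
  by rewrite /h hornerZ mulrA divff// mul1r gE.
have h1 : h.[0] = 1 by apply: (mulfI y20); rewrite hE addr0 -cp mulr1.
have [d d0 hd] := poly_continuous h 0 half0.
pose r := d / 2; have r0 : 0 < r by rewrite divr_gt0.
have hr u : cm u < d -> cm (h.[u] - 1) <= 1 / 2.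
  by move=> ud; have := hd u; rewrite subr0 h1 => H; exact/ltW/H.
have rd u : cm u <= r -> cm u < d.
  by move=> ur; rewrite (le_lt_trans ur)// ltr_pdivrMr// ltr_pMr// ltr1n.
have [|L L0 hL] := @sqrt_param_lipschitz (x0%:P + 'X) y0%:P h r.
  by move=> u /rd/hr.
exists (sqrt_param (x0%:P + 'X) y0%:P h), r, L; split => //; split => //.
- by move=> u ur; apply/curve_mk; rewrite exprMn sqr_sqrtc !(hornerD, hornerC, hornerX) hE.
- by rewrite pE /sqrt_param !(hornerD, hornerC, hornerX) addr0 h1 sqrtc1 mulr1.
move=> e e0; exists (Order.min (Order.min d e) (cm y0)).
  by rewrite !lt_min d0 e0 cm_gt0.
move=> q cq /mk_near[]; rewrite !lt_min => /andP[/andP[xd xe] _] /andP[_ ye].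
set x := co q ord0 in xd xe *; set y := co q (lift ord0 ord0) in ye *.
pose v := x - x0; have xE : x = x0 + v by rewrite /v addrC subrK.
exists v => //.
rewrite -(mkK q) -/x -/y /sqrt_param !(hornerD, hornerC, hornerX) -xE; congr mk.
have -> : sqrtc h.[v] = y / y0.
  apply/esym/sqrtc_unique.
  - rewrite expr_div_n; apply: (mulfI y20); rewrite hE -xE mulrCA divff// mulr1; exact: cq.
  - have : cm (y / y0 - 1) < 1.
      by rewrite -(divff y00) -mulrBl cmM cmV ltr_pdivrMr ?cm_gt0// mul1r.
    move=> /(le_lt_trans (Re_le_cm _)); rewrite ReD ReN/= ltr_norml => /andP[+ _].
    lra.
  - exact: lt_le_trans half0 (near_one_ge (hr _ xd)).
by rewrite mulrC divfK.
Qed.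

(** The chart maps the segment from [u] to [v] to a curve in [X]. *)
Lemma chart_inner_dist X p phi r L u v : 0 < L -> lipschitz_chart X p phi r L ->
  cm u <= r -> cm v <= r -> (inner_dist X (phi u) (phi v) <= (L * cm (u - v))%:E)%E.
Proof.
move=> L0 [Xphi lip _ _] ur vr.
pose g (t : R) := phi (u + (t%:C)%C * (v - u)).
have conv t : t \in `[0, 1] -> cm (u + (t%:C)%C * (v - u)) <= r.
  rewrite in_itv/= => /andP[t0 t1].
  have -> : u + (t%:C)%C * (v - u) = ((1 - t)%:C)%C * u + (t%:C)%C * v.
    by rewrite rmorphB rmorph1; ring.
  rewrite (le_trans (cmD _ _))// !cmM !cm_real !ger0_norm ?subr_ge0//.
  by move: ur vr t0 t1; nra.
have -> : phi u = g 0 by rewrite /g mul0r addr0.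
have -> : phi v = g 1 by rewrite /g mul1r addrC subrK.
apply: inner_le_lipschitz => [a b a01 b01|t t01]; last exact/Xphi/conv.
apply: (le_trans (lip _ _ (conv _ a01) (conv _ b01))).
rewrite opprD addrACA subrr add0r -mulrBl -rmorphB cmM cm_real distrC.
by rewrite [cm (v - u)]cm_distC [`|_| * _]mulrC mulrA.
Qed.

End Charts.

(** * Connectedness of the curve and of its end *)

Section ComplexContinuity.
Variables (R : realType) (M : metricType R).
Local Notation C := R[i].
Implicit Types (A : set M) (f g : M -> C).

Definition ccont A f := forall x, A x -> forall e, 0 < e -> exists2 d, 0 < d &
  forall y, A y -> mdist x y < d -> cm (f x - f y) < e.

Lemma ccont_cst A c : ccont A (fun=> c).
Proof. by move=> x _ e e0; exists 1 => // y _ _; rewrite subrr cm0. Qed.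

Lemma ccontD A f g : ccont A f -> ccont A g -> ccont A (fun x => f x + g x).
Proof.
move=> cf cg x Ax e e0; have e20 : 0 < e / 2 by rewrite divr_gt0.
have [d d0 hd] := cf x Ax _ e20; have [d' d'0 hd'] := cg x Ax _ e20.
exists (Order.min d d'); first by rewrite lt_min d0.
move=> y Ay; rewrite lt_min => /andP[xy xy'].
rewrite opprD addrACA (le_lt_trans (cmD _ _))// [ltRHS]splitr ltrD//; first exact: hd.
exact: hd'.
Qed.

Lemma ccontM A f g : ccont A f -> ccont A g -> ccont A (fun x => f x * g x).
Proof.
move=> cf cg x Ax e e0.
have p0 (h : M -> C) : 0 < cm (h x) + 1 by rewrite ltr_wpDl ?cm_ge0.
have ef : 0 < e / 2 / (cm (g x) + 1) by rewrite !divr_gt0.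
have eg : 0 < Order.min 1 (e / 2 / (cm (f x) + 1)) by rewrite lt_min ltr01 !divr_gt0.
have [d d0 hd] := cf x Ax _ ef; have [d' d'0 hd'] := cg x Ax _ eg.
exists (Order.min d d'); first by rewrite lt_min d0.
move=> y Ay; rewrite lt_min => /andP[/(hd _ Ay) fxy /(hd' _ Ay)].
rewrite lt_min => /andP[g1 gxy].
have -> : f x * g x - f y * g y = f x * (g x - g y) + (f x - f y) * g y by ring.
rewrite (le_lt_trans (cmD _ _))// [ltRHS]splitr !cmM; apply: ltrD.
  rewrite mulrC; apply: (@le_lt_trans _ _ (cm (g x - g y) * (cm (f x) + 1))).
    by rewrite ler_wpM2l ?cm_ge0// lerDl.
  by rewrite -ltr_pdivlMr.
apply: (@le_lt_trans _ _ (cm (f x - f y) * (cm (g x) + 1))).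
  rewrite ler_wpM2l ?cm_ge0//; have := cm_leD (g y) (g x); rewrite cm_distC.
  by move: g1; lra.
by rewrite -ltr_pdivlMr.
Qed.

Lemma ccontX A f n : ccont A f -> ccont A (fun x => f x ^+ n).
Proof.
move=> cf; elim: n => [|n IH]; first exact: ccont_cst.
by move=> x Ax e e0; have [d d0 h] := ccontM cf IH Ax e0; exists d => // y; rewrite !exprS; exact: h.
Qed.

Lemma ccont_ext A f g : (forall x, f x = g x) -> ccont A f -> ccont A g.
Proof. by move=> /funext ->. Qed.

Lemma ccont_sum A (I : Type) (r : seq I) (F : I -> M -> C) :
  (forall i, ccont A (F i)) -> ccont A (fun x => \sum_(i <- r) F i x).
Proof.
move=> cF; elim: r => [|i r IH].
  by apply: (ccont_ext _ (@ccont_cst A 0)) => x; rewrite big_nil.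
by apply: (ccont_ext _ (ccontD (cF i) IH)) => x; rewrite big_cons.
Qed.

Lemma ccont_prod A (I : Type) (r : seq I) (F : I -> M -> C) :
  (forall i, ccont A (F i)) -> ccont A (fun x => \prod_(i <- r) F i x).
Proof.
move=> cF; elim: r => [|i r IH].
  by apply: (ccont_ext _ (@ccont_cst A 1)) => x; rewrite big_nil.
by apply: (ccont_ext _ (ccontM (cF i) IH)) => x; rewrite big_cons.
Qed.

Lemma cont_on_ccont m A (f : M -> cspace R m) :
  (forall j, ccont A (fun x => co (f x) j)) -> cont_on A f.
Proof. by move=> h; apply: cont_on_coP => j; exact: h. Qed.

Lemma ccont_cont_on m A (f : M -> cspace R m) j :
  cont_on A f -> ccont A (fun x => co (f x) j).
Proof.
move=> cf x Ax e e0; have [d d0 hd] := cf x Ax e e0; exists d => // y Ay xy.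
exact: le_lt_trans (co_le_mdist _ _ _) (hd _ Ay xy).
Qed.

Lemma closed_ccont_zero f : ccont setT f -> closed [set x | f x = 0].
Proof.
move=> cf; apply/closedP_mdist => x h /=; apply/eqP/negPn/negP; rewrite -cm_gt0 => fx0.
have [d d0 hd] := cf x I _ fx0; have [y /= fy0 xy] := h d d0.
by have := hd y I xy; rewrite fy0 subr0 ltxx.
Qed.

End ComplexContinuity.

Section AlgebraicClosed.
Variables (R : realType) (m : nat).

Lemma ccont_co (A : set (cspace R m)) j : ccont A (fun x => co x j).
Proof. by move=> x Ax e e0; exists e => // y _; exact: le_lt_trans (co_le_mdist _ _ _). Qed.

Lemma ccont_peval (f : mpoly m R[i]) : ccont setT (peval f).
Proof.
apply: (@ccont_ext _ _ _ (fun x => \sum_(mm <- msupp f) mcoeff mm f *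
    \prod_(i <- index_enum 'I_m) co x i ^+ mm i)) => [x|].
  by rewrite /peval mevalE.
apply: ccont_sum => mm; apply: ccontM; first exact: ccont_cst.
by apply: ccont_prod => i; apply: ccontX; exact: ccont_co.
Qed.

Lemma algebraic_closed (Y : set (cspace R m)) : algebraic_set Y -> closed Y.
Proof.
move=> [fs ->].
have -> : [set x : cspace R m | forall f, f \in fs -> peval f x = 0] =
    \bigcap_(f in [set f | f \in fs]) [set x | peval f x = 0].
  by apply/seteqP; split=> x h f /= ffs; exact: h.
by apply: closed_bigI => f _; apply: closed_ccont_zero; exact: ccont_peval.
Qed.

End AlgebraicClosed.

Lemma convex_connected (R : realType) (m : nat) (K : set (cspace R m)) :
  (forall u v t, K u -> K v -> 0 <= t <= 1 -> K (seg u v t)) -> connected K.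
Proof.
move=> conv; have [->|/set0P[u0 Ku0]] := eqVneq K set0; first exact: connected0.
have -> : K = \bigcup_(v in K) (seg u0 v @` `[0, 1]%classic).
  apply/seteqP; split=> [v Kv|w [v Kv [t]]].
    by exists v => //; exists 1; rewrite ?seg1// /= in_itv/= lexx ler01.
  by rewrite /= in_itv/= => t01 <-; exact: conv.
apply: bigcup_connected.
  by exists u0 => v Kv; exists 0; rewrite ?seg0// /= in_itv/= lexx ler01.
by move=> v Kv; apply: curve_connected; exact: cont_seg.
Qed.

Section Sheets.
Variable R : realType.
Local Notation C := R[i].
Local Notation U := (cspace R 1).
Implicit Types (z w x y : C).
Local Notation i0 := (ord0 : 'I_2).
Local Notation i1 := (lift ord0 ord0 : 'I_2).

Let upper : set U := [set u | 0 <= complex.Im (cx u)].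

Let upper_shift c u : complex.Im c = 0 -> upper u -> 0 <= complex.Im (cx u + c).
Proof. by move=> c0 uu; rewrite ImD c0 addr0. Qed.

Let ccont_sqrtc_shift c : complex.Im c = 0 -> ccont upper (fun u => sqrtc (cx u + c)).
Proof.
move=> c0 u uu e e0; exists (e ^+ 2); first by rewrite exprn_gt0.
move=> v uv; rewrite mdist_cx => uve.
rewrite -(@ltr_pXn2r _ 2)// ?nnegrE ?cm_ge0 ?ltW//.
apply: le_lt_trans uve; apply: le_trans (sqrtc_hoelder _ _) _; try exact: upper_shift.
by rewrite opprD addrACA subrr addr0.
Qed.

(** A square root of x - x^3, continuous on the closed upper half plane because
    the three shifts of x stay in this half plane. *)
Let G (x : C) : C := 'i%C * (sqrtc (x + 0) * (sqrtc (x + (- 1)) * sqrtc (x + 1))).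

Let G2 x : G x ^+ 2 = x - x ^+ 3.
Proof. rewrite /G !exprMn !sqr_sqrtc sqr_i; ring. Qed.

Let ccont_G : ccont upper (fun u => G (cx u)).
Proof.
apply: ccontM; first exact: ccont_cst.
apply: ccontM; first by apply: ccont_sqrtc_shift.
by apply: ccontM; apply: ccont_sqrtc_shift; rewrite ?ImN /= ?oppr0.
Qed.

Let sheet (s : C) (u : U) : cspace R 2 := mk (cx u) (s * G (cx u)).

Let cont_sheet s : cont_on upper (sheet s).
Proof.
apply: cont_on_ccont; apply: ord2P.
  apply: (ccont_ext (f := fun u => cx u)); first by move=> u; rewrite co_mk0.
  exact: ccont_co.
apply: (ccont_ext (f := fun u => s * G (cx u))); first by move=> u; rewrite co_mk1.
by apply: ccontM; [exact: ccont_cst|exact: ccont_G].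
Qed.

Definition cj (p : cspace R 2) : cspace R 2 := mk (conjc (co p i0)) (conjc (co p i1)).

Let cm_conj z : cm (conjc z) = cm z.
Proof. by case: z => a b; rewrite !cmE/= sqrrN. Qed.

Let cont_cj A : cont_on A cj.
Proof.
apply: cont_on_ccont; apply: ord2P => x Ax e e0; exists e => // y Ay xy;
  rewrite /cj ?co_mk0 ?co_mk1 -rmorphB cm_conj; exact: le_lt_trans (co_le_mdist _ _ _) xy.
Qed.

Let curve_cj p : @curve R p -> @curve R (cj p).
Proof.
move=> cp; apply/curve_mk; rewrite -!rmorphXn -rmorphB; congr conjc; exact: cp.
Qed.

Let sheet_curve s u : s ^+ 2 = 1 -> @curve R (sheet s u).
Proof. by move=> s2; apply/curve_mk; rewrite exprMn s2 mul1r G2. Qed.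

(** Over the upper half plane the curve has the two sheets y = s G(x), with s = 1
    or -1; conjugation, for [b = true], gives the sheets over the lower one. *)
Let sheet_over (K : set U) (s : C) (b : bool) : set (cspace R 2) :=
  (fun u => if b then cj (sheet s u) else sheet s u) @` K.

Let sheet_over_connected K s b : K `<=` upper -> connected K -> connected (sheet_over K s b).
Proof.
move=> KU cK; apply: connected_image => //; case: b.
  apply: (@cont_on_comp _ _ _ _ K setT (sheet s) cj) => //.
  exact: cont_on_sub KU (cont_sheet s).
exact: cont_on_sub KU (cont_sheet s).
Qed.

Let sheets_cover (V : set C) (K : set U) : K = upper `&` [set u | V (cx u)] ->
  (forall x, V (conjc x) <-> V x) ->
  @curve R `&` [set p | V (co p i0)] =
   (sheet_over K 1 false `|` sheet_over K 1 true) `|`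
   (sheet_over K (-1) false `|` sheet_over K (-1) true).
Proof.
move=> KE Vc; apply/seteqP; split.
  have half p : @curve R p -> V (co p i0) -> 0 <= complex.Im (co p i0) ->
      exists2 s, s = 1 \/ s = -1 & exists2 u, K u & sheet s u = p.
    move=> cp Vp p0; have : G (co p i0) ^+ 2 = co p i1 ^+ 2 by rewrite G2; exact: esym cp.
    move=> /eqP; rewrite eqf_sqr => /orP[/eqP Gp|/eqP Gp].
      exists 1; first by left.
      exists (pt (co p i0)); first by rewrite KE; split; rewrite /upper/= ptK.
      by rewrite /sheet ptK Gp mul1r mkK.
    exists (-1); first by right.
    exists (pt (co p i0)); first by rewrite KE; split; rewrite /upper/= ptK.
    by rewrite /sheet ptK Gp mulN1r opprK mkK.
  move=> p [cp Vp]; have [p0|p0] := leP 0 (complex.Im (co p i0)).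
    have [s + [u Ku <-]] := half p cp Vp p0.
    by case=> ->; [left; left|right; left]; exists u.
  have [|||s + [u Ku uE]] := half (cj p).
  - exact: curve_cj.
  - by rewrite co_mk0; apply/Vc.
  - by rewrite co_mk0; case: (co p i0) p0 => a b /= b0; rewrite oppr_ge0 ltW.
  have cjK : cj (sheet s u) = p.
    by rewrite uE /cj !co_mk0 !co_mk1 !conjcK mkK.
  by case=> sE; [left; right|right; right]; exists u => //; rewrite -sE.
have one2 : (1 : C) ^+ 2 = 1 by rewrite expr1n.
have mone2 : (-1 : C) ^+ 2 = 1 by rewrite sqrrN expr1n.
have cs s (b : bool) p : s ^+ 2 = 1 -> sheet_over K s b p ->
    (@curve R `&` [set p | V (co p i0)]) p.
  move=> s2 [u + <-]; rewrite KE => -[_ /= Vu]; case: b; split.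
  - exact/curve_cj/sheet_curve.
  - by rewrite /= /cj /sheet !co_mk0; apply/Vc.
  - exact: sheet_curve.
  - by rewrite /= /sheet co_mk0.
by move=> p [[|]|[|]]; exact: cs.
Qed.

Let upper_convex u v t : upper u -> upper v -> 0 <= t <= 1 -> upper (seg u v t).
Proof.
move=> uu uv t01; rewrite /upper/= /cx co_seg ImD Im_realM ImD ImN.
exact: segR_ge.
Qed.

(** The four sheets are images of half planes, and contain the origin. *)
Lemma curve_connected_set : connected (@curve R).
Proof.
have -> : @curve R = @curve R `&` [set p | setT (co p i0)].
  by apply/seteqP; split=> p //; case.
rewrite (@sheets_cover setT upper)//; last by apply/seteqP; split=> u //; case.
have cu : connected upper by apply: convex_connected.
have z0 : upper (pt 0) by rewrite /upper/= ptK.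
have o (s : C) : sheet s (pt 0) = mk 0 0.
  by rewrite /sheet ptK /G addr0 sqrtc0 !(mul0r, mulr0).
have oc (s : C) b : sheet_over upper s b (mk 0 0).
  by exists (pt 0) => //; case: b; rewrite o// /cj !co_mk0 !co_mk1 conjc0.
have sc s b : connected (sheet_over upper s b) by exact: sheet_over_connected.
apply: connectedU; last 2 first.
- by apply: connectedU => //; exists (mk 0 0).
- by apply: connectedU => //; exists (mk 0 0).
by exists (mk 0 0); split; left.
Qed.

Let sqr_neg_real z (a : R) : a <= 0 -> z ^+ 2 = (a%:C)%C -> conjc z = - z.
Proof.
case: z => p q a0; rewrite expr2; simpc => -[h1 h2].
have {}h2 : p * q = 0 by lra.
move: h2 => /eqP; rewrite mulf_eq0 => /orP[/eqP p0|/eqP q0].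
  by apply/eqP; rewrite eq_complex /= p0 oppr0 !eqxx.
have p0 : p = 0 by apply/eqP; rewrite -sqrf_eq0 expr2; apply/eqP; nra.
by apply/eqP; rewrite eq_complex /= p0 q0 !oppr0 !eqxx.
Qed.

Let sqr_pos_real z (a : R) : 0 <= a -> z ^+ 2 = (a%:C)%C -> conjc z = z.
Proof.
case: z => p q a0; rewrite expr2; simpc => -[h1 h2].
have {}h2 : p * q = 0 by lra.
move: h2 => /eqP; rewrite mulf_eq0 => /orP[/eqP p0|/eqP q0].
  have q0 : q = 0 by apply/eqP; rewrite -sqrf_eq0 expr2; apply/eqP; nra.
  by apply/eqP; rewrite eq_complex /= q0 oppr0 !eqxx.
by apply/eqP; rewrite eq_complex /= q0 oppr0 !eqxx.
Qed.

(** The exterior of a square rather than of a disc, to be a union of half planes. *)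
Definition outer (r : R) : set C :=
  [set x | r <= `|complex.Re x| \/ r <= `|complex.Im x|].

(** The curve has a single end: far along the negative real axis, where x - x^3 is
    positive, each sheet meets its conjugate; far along the positive real axis,
    where x - x^3 is negative, it meets the conjugate of the opposite sheet. *)
Lemma curve_end_connected (r : R) : 1 <= r ->
  connected (@curve R `&` [set p | outer r (co p i0)]).
Proof.
move=> r1; have r0 : 0 <= r by exact: le_trans r1.
pose K := upper `&` [set u | outer r (cx u)].
have KU : K `<=` upper by move=> u [].
have cK : connected K.
  pose K1 := upper `&` [set u | r <= complex.Re (cx u)].
  pose K2 := upper `&` [set u | r <= complex.Im (cx u)].
  pose K3 := upper `&` [set u | complex.Re (cx u) <= - r].
  have -> : K = (K1 `|` K2) `|` K3.
    apply/seteqP; split.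
      move=> u [uu [|]] /=; rewrite ler_normr => /orP[h|h].
      - by left; left.
      - by right; split => //=; rewrite lerNr.
      - by left; right.
      - by left; right; split => //=; move: uu h; rewrite /upper/=; lra.
    move=> u [[[uu /= h]|[uu /= h]]|[uu /= h]]; split => //.
    - by left; rewrite (le_trans h)// ler_norm.
    - by right; rewrite (le_trans h)// ler_norm.
    - by left; rewrite ler_normr lerNr h orbT.
  have c1 : connected K1.
    apply: convex_connected => u v t [? ?] [? ?] t01; split; first exact: upper_convex.
    by rewrite /= /cx co_seg ReD Re_realM ReD ReN; exact: segR_ge.
  have c2 : connected K2.
    apply: convex_connected => u v t [? ?] [? ?] t01; split; first exact: upper_convex.
    by rewrite /= /cx co_seg ImD Im_realM ImD ImN; exact: segR_ge.
  have c3 : connected K3.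
    apply: convex_connected => u v t [? ?] [? ?] t01; split; first exact: upper_convex.
    by rewrite /= /cx co_seg ReD Re_realM ReD ReN; exact: segR_le.
  apply: connectedU => //; last first.
    apply: connectedU => //; exists (pt (r +i* r)%C).
    by split; split; rewrite /upper/= ptK.
  exists (pt ((- r) +i* r)%C); split; last by split; rewrite /upper/= ptK.
  by right; split; rewrite /upper/= ptK.
rewrite (@sheets_cover (outer r) K)//; last first.
  by move=> [a b]; rewrite /outer/= normrN.
have sc s b : connected (sheet_over K s b) by exact: sheet_over_connected.
have Kpos : K (pt (r%:C)%C).
  by split; rewrite /upper/= ?ptK//=; left; rewrite ger0_norm.
have Kneg : K (pt ((- r)%:C)%C).
  by split; rewrite /upper/= ?ptK//=; left; rewrite normrN ger0_norm.
have r3 : r <= r ^+ 3 by rewrite exprS ler_peMr// exprn_ege1.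
have Gneg : conjc (G ((- r)%:C)%C) = G ((- r)%:C)%C.
  apply: (@sqr_pos_real _ (- r + r ^+ 3)); first by rewrite addrC subr_ge0.
  by rewrite G2 -rmorphXn -rmorphB; congr (real_complex _ _); ring.
have Gpos : conjc (G (r%:C)%C) = - G (r%:C)%C.
  apply: (@sqr_neg_real _ (r - r ^+ 3)); first by rewrite subr_le0.
  by rewrite G2 -rmorphXn -rmorphB.
have conjM (a b : C) : conjc (a * b) = conjc a * conjc b by exact: rmorphM.
have same s : s = 1 \/ s = -1 -> sheet_over K s false `&` sheet_over K s true !=set0.
  move=> sE; exists (sheet s (pt ((- r)%:C)%C)); split; exists (pt ((- r)%:C)%C) => //.
  rewrite /cj /sheet !co_mk0 !co_mk1 ptK conjM Gneg conjc_real; congr (mk _ (_ * _)).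
  by case: sE => ->; rewrite ?rmorphN rmorph1.
have swap : sheet_over K 1 true `&` sheet_over K (-1) false !=set0.
  exists (sheet (-1) (pt (r%:C)%C)); split; exists (pt (r%:C)%C) => //.
  rewrite /cj /sheet !co_mk0 !co_mk1 ptK mul1r Gpos conjc_real; congr mk.
  by rewrite mulN1r.
apply: connectedU; last 2 first.
- by apply: connectedU => //; apply: same; left.
- by apply: connectedU => //; apply: same; right.
by have [p [? ?]] := swap; exists p; split; [right|left].
Qed.

End Sheets.

(** * Lipschitz images of discs are thin *)

(** Row vectors form a complete normed module, as Baire's theorem requires. *)
HB.instance Definition _ (R : realType) (n : nat) := NormedModule.on 'rV[R]_n.+1.

Section Thin.
Variable R : realType.
Local Notation C := R[i].
Local Notation i0 := (ord0 : 'I_2).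
Local Notation i1 := (lift ord0 ord0 : 'I_2).

Let of_real4 (v : 'rV[R]_4) : cspace R 2 :=
  mk (v ord0 (inord 0) +i* v ord0 (inord 1))%C (v ord0 (inord 2) +i* v ord0 (inord 3))%C.

Let of_real4_continuous : continuous of_real4.
Proof.
move=> v P /nbhs_mdistP[e e0 hP].
have e4 : 0 < e / 4 by rewrite divr_gt0.
apply/nbhs_ballP; exists (e / 4) => //= w [_ vw]; apply: hP.
have h k : `|v ord0 k - w ord0 k| < e / 4 by exact: vw.
apply: (le_lt_trans (mdist2_le _ _)); rewrite !co_mk0 !co_mk1.
have := cm_le_ReIm ((v ord0 (inord 0) +i* v ord0 (inord 1))%C - (w ord0 (inord 0) +i* w ord0 (inord 1))%C).
have := cm_le_ReIm ((v ord0 (inord 2) +i* v ord0 (inord 3))%C - (w ord0 (inord 2) +i* w ord0 (inord 3))%C).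
rewrite !ReD !ImD !ReN !ImN /=.
have := h (inord 0); have := h (inord 1); have := h (inord 2); have := h (inord 3).
lra.
Qed.

Let of_real4_near v y e : mdist (of_real4 v) y < e -> exists2 w, ball v e w & of_real4 w = y.
Proof.
move=> vy; exists (\row_(k < 4) [:: complex.Re (co y i0); complex.Im (co y i0);
    complex.Re (co y i1); complex.Im (co y i1)]`_k); last first.
  rewrite /of_real4 !mxE !inordK//= -[RHS]mkK; congr mk; [by case: (co y i0)|by case: (co y i1)].
split; first by rewrite (le_lt_trans _ vy)// mdist_ge0.
move=> a k; rewrite (ord1 a) mxE.
have h0 := le_lt_trans (co_le_mdist (of_real4 v) y i0) vy.
have h1 := le_lt_trans (co_le_mdist (of_real4 v) y i1) vy.
have := le_lt_trans (Re_le_cm _) h0; have := le_lt_trans (Im_le_cm _) h0.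
have := le_lt_trans (Re_le_cm _) h1; have := le_lt_trans (Im_le_cm _) h1.
rewrite !ReD !ImD !ReN !ImN /of_real4 co_mk0 co_mk1/=.
have kE : k = inord k by rewrite inord_val.
rewrite /ball/= kE; case: k kE => -[|[|[|[|//]]]] kk _ h3 h2 h4 h5; rewrite ?inordK//=.
Qed.

Lemma baire_plane (A : nat -> set (cspace R 2)) :
  (forall n, closed (A n)) ->
  (forall n x e, 0 < e -> exists2 y, mdist x y < e & ~ A n y) ->
  exists y, forall n, ~ A n y.
Proof.
move=> clA thin.
have : dense (\bigcap_n (of_real4 @^-1` ~` A n)).
  apply: (@Baire R ('rV[R]_4 : completeNormedModType R) (fun n => of_real4 @^-1` ~` A n)) => n; split.
    by apply: open_comp; [move=> v _; exact: of_real4_continuous|exact: closed_openC].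
  move=> O [v Ov] oO; have [e /= e0 eO] := (nbhs_ballP _ _).1 (open_nbhs_nbhs (conj oO Ov)).
  have [y vy nA] := thin n (of_real4 v) e e0.
  have [w vw wy] := of_real4_near vy.
  by exists w; split; [exact: eO|rewrite /= wy].
move=> /(_ setT)[|//|v [_ h]]; first by exists 0.
  exact: openT.
by exists (of_real4 v) => n; exact: h.
Qed.

(** A ball of C^2 contains a number of points of order K^4 with mutual distances of
    order 1 / K, while the discs can be cut into a number of cells of order K^2
    whose images are too small to contain two of them. *)
Lemma lipschitz_discs_thin (M : nat) (phi : nat -> C -> cspace R 2) (L : R) : 0 < L ->
  (forall k, (k < M)%N -> forall u v, cm u <= 1 -> cm v <= 1 ->
     mdist (phi k u) (phi k v) <= L * cm (u - v)) ->
  forall x e, 0 < e -> exists2 y, mdist x y < e &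
    ~ exists k u, [/\ (k < M)%N, cm u <= 1 & phi k u = y].
Proof.
move=> L0 lip x e e0; apply: contrapT => hno.
have hcov y : mdist x y < e -> exists k u, [/\ (k < M)%N, cm u <= 1 & phi k u = y].
  by move=> xy; apply: contrapT => h; apply: hno; exists y.
pose Q := (Num.truncn (32 * L / e * 2)).+1.
pose K := (M * Q + 1)%N.
have K0 : 0 < K%:R :> R by rewrite /K addn1 ltr0n.
pose s := e / (8 * K%:R); have s0 : 0 < s by rewrite divr_gt0// mulr_gt0.
pose c := s / (4 * L); have c0 : 0 < c by rewrite divr_gt0// mulr_gt0.
pose N := (Q * K)%N.
have QN : 2 / c < N%:R.
  have -> : 2 / c = 32 * L / e * 2 * K%:R.
    by rewrite /c /s; field; rewrite !lt0r_neq0.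
  by rewrite /N natrM ltr_pM2r// /Q truncnS_gt.
have KN : (M * (N * N) < K * K * (K * K))%N.
  have K1 : (0 < K)%N by rewrite /K addn1.
  have -> : (M * (N * N) = M * (Q * Q) * (K * K))%N by rewrite /N; lia.
  rewrite ltn_pmul2r ?muln_gt0 ?K1// /K.
  by case: (M) => [|k]; nia.
pose grid (t : 'I_K * 'I_K * ('I_K * 'I_K)) : cspace R 2 :=
  mk (co x i0 + (s * t.1.1%:R +i* (s * t.1.2%:R))%C)
     (co x i1 + (s * t.2.1%:R +i* (s * t.2.2%:R))%C).
have sK (a : 'I_K) : 0 <= s * a%:R <= e / 8.
  rewrite mulr_ge0 ?(ltW s0)//= /s -mulrA ler_pM2l// invfM -mulrA ler_piMr//.
  by rewrite ler_pdivrMl// mulr1 ler_nat ltnW.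
have gridx t : mdist x (grid t) < e.
  apply: (le_lt_trans (mdist2_le _ _)); rewrite /grid co_mk0 co_mk1 !opprD !addrA !subrr !sub0r !cmN.
  case: t => -[a b] [a' b'] /=.
  have := cm_le_ReIm (s * a%:R +i* (s * b%:R))%C.
  have := cm_le_ReIm (s * a'%:R +i* (s * b'%:R))%C => /=.
  move: (sK a) (sK b) (sK a') (sK b') => /andP[p1 q1] /andP[p2 q2] /andP[p3 q3] /andP[p4 q4].
  by rewrite !ger0_norm//; lra.
have grid_sep t t' : mdist (grid t) (grid t') < s -> t = t'.
  have nat_eq (a b : nat) : `|s * a%:R - s * b%:R| < s -> a = b.
    rewrite -mulrBr normrM (ger0_norm (ltW s0)) gtr_pMr// => h.
    wlog ab : a b h / (a <= b)%N.
      move=> H; case: (leqP a b) => [|/ltnW] ab; first exact: H.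
      by apply/esym/H => //; rewrite distrC.
    apply/eqP; rewrite eqn_leq ab/=; move: h.
    by rewrite distrC -natrB// ger0_norm// -[1]/(1%:R) ltr_nat; lia.
  case: t t' => -[a b] [a' b'] [[p q] [p' q']] h.
  have h0 := le_lt_trans (co_le_mdist _ _ i0) h.
  have h1 := le_lt_trans (co_le_mdist _ _ i1) h.
  rewrite /grid /= !co_mk0 opprD addrACA subrr add0r in h0.
  rewrite /grid /= !co_mk1 opprD addrACA subrr add0r in h1.
  have := le_lt_trans (Re_le_cm _) h0; have := le_lt_trans (Im_le_cm _) h0.
  have := le_lt_trans (Re_le_cm _) h1; have := le_lt_trans (Im_le_cm _) h1.
  rewrite !ReD !ImD !ReN !ImN/= => /nat_eq/val_inj -> /nat_eq/val_inj ->.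
  by move=> /nat_eq/val_inj -> /nat_eq/val_inj ->.
have /choice[ku hku] : forall t, exists ku : nat * C, [/\ (ku.1 < M)%N, cm ku.2 <= 1 & phi ku.1 ku.2 = grid t].
  by move=> t; have [k [u [? ? ?]]] := hcov _ (gridx t); exists (k, u).
pose cell (a : R) : nat := Num.truncn ((a + 1) / c).
have cellN a : `|a| <= 1 -> (cell a < N)%N.
  rewrite ler_norml => /andP[a1 a2]; rewrite -(ltr_nat R); apply: le_lt_trans QN.
  have ac : 0 <= (a + 1) / c by rewrite divr_ge0 ?(ltW c0)//; lra.
  have /andP[+ _] := truncn_itv ac; move=> /le_trans; apply.
  by rewrite ler_pM2r ?invr_gt0//; lra.
have cell_close a b : `|a| <= 1 -> `|b| <= 1 -> cell a = cell b -> `|a - b| < c.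
  rewrite !ler_norml => /andP[a1 a2] /andP[b1 b2] ab.
  have ac : 0 <= (a + 1) / c by rewrite divr_ge0 ?(ltW c0)//; lra.
  have bc : 0 <= (b + 1) / c by rewrite divr_ge0 ?(ltW c0)//; lra.
  have /andP[h1 h2] := truncn_itv ac; have /andP[h3 h4] := truncn_itv bc.
  rewrite -/(cell a) ab in h1 h2; rewrite -/(cell b) in h3 h4.
  rewrite ler_pdivlMr// in h1; rewrite ltr_pdivrMr// in h2.
  rewrite ler_pdivlMr// in h3; rewrite ltr_pdivrMr// in h4.
  rewrite -natr1 mulrDl mul1r in h2 h4.
  by rewrite ltr_norml; apply/andP; split; lra.
have kM t : ((ku t).1 < M)%N by have [] := hku t.
have u1 t : cm (ku t).2 <= 1 by have [] := hku t.
pose f t : 'I_M * ('I_N * 'I_N) := (Ordinal (kM t),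
  (Ordinal (cellN _ (le_trans (Re_le_cm _) (u1 t))),
   Ordinal (cellN _ (le_trans (Im_le_cm _) (u1 t))))).
have f_inj : injective f.
  move=> t t' [kk' /cell_close cr /cell_close ci]; apply: grid_sep.
  have [_ _ <-] := hku t; have [_ _ <-] := hku t'; rewrite kk'.
  apply: (le_lt_trans (lip _ (kM t') _ _ (u1 t) (u1 t'))).
  have := cr (le_trans (Re_le_cm _) (u1 t)) (le_trans (Re_le_cm _) (u1 t')).
  have := ci (le_trans (Im_le_cm _) (u1 t)) (le_trans (Im_le_cm _) (u1 t')).
  have := cm_le_ReIm ((ku t).2 - (ku t').2); rewrite ReD ImD ReN ImN => h1 h2 h3.
  have h4 : cm ((ku t).2 - (ku t').2) < 2 * c by lra.
  have sE : s = 4 * (L * c) by rewrite /c; field; rewrite lt0r_neq0.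
  by rewrite sE; nra.
have := leq_card f f_inj; rewrite !card_prod !card_ord leqNgt => /negP; apply.
exact: KN.
Qed.

End Thin.

(** * Coordinates of a model are algebraically dependent *)

(** Finite subcovers are available for compact sets in pointed spaces. *)
HB.instance Definition _ (R : realType) (n : nat) :=
  isPointed.Build (cspace R n) (0 : 'rV[R[i]]_n).

Section CurvePatches.
Variable R : realType.
Local Notation C := R[i].
Local Notation i0 := (ord0 : 'I_2).
Local Notation i1 := (lift ord0 ord0 : 'I_2).
Local Notation X := (@curve R).

Definition curve_ball (r : R) : set (cspace R 2) := X `&` [set p | cm (co p i0) <= r].

Lemma curve_ball_compact r : compact (curve_ball r).
Proof.
have clX : closed X by apply: algebraic_closed; exact: algebraic_curve.
apply: (@cspace_compact _ _ _ (`|r| + (1 + `|r| + `|r| ^+ 3))).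
  apply: closedI => //; apply: closed_le_lip => x y.
  have := cm_leD (co x i0) (co y i0); have := cm_leD (co y i0) (co x i0).
  have := co_le_mdist x y i0; rewrite [cm (co y i0 - _)]cm_distC => ? ? ?.
  by rewrite /= ler_norml; apply/andP; split; lra.
move=> p [cp xr]; have r0 : 0 <= `|r| by [].
have xr' : cm (co p i0) <= `|r| by rewrite (le_trans xr)// ler_norm.
have r30 : 0 <= `|r| ^+ 3 by rewrite exprn_ge0.
apply: ord2P; first by lra.
have y2 : cm (co p i1) ^+ 2 <= `|r| + `|r| ^+ 3.
  rewrite -cmX [_ ^+ 2](cp) (le_trans (cmB _ _))// cmX lerD// lerXn2r// ?nnegrE ?cm_ge0//.
have := cm_ge0 (co p i1); nra.
Qed.

(** By compactness, from the charts rescaled to the unit disc. *)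
Lemma curve_patches r : exists (M : nat) (phi : nat -> C -> cspace R 2) (L : R),
  [/\ 0 < L,
      forall k, (k < M)%N -> forall u v, cm u <= 1 -> cm v <= 1 ->
        [/\ X (phi k u), X (phi k v) &
            (inner_dist X (phi k u) (phi k v) <= (L * cm (u - v))%:E)%E] &
      forall q, curve_ball r q -> exists k u, [/\ (k < M)%N, cm u <= 1 & phi k u = q]].
Proof.
have /choice[ch hch] : forall p : cspace R 2, exists phr : (C -> cspace R 2) * R * R * R,
    X p -> let: (phi, rho, L, e) := phr in
    [/\ 0 < rho, 0 < L, 0 < e, lipschitz_chart X p phi rho L &
        forall q, X q -> mdist p q < e -> exists2 u, cm u <= rho & phi u = q].
  move=> p; have [cp|ncp] := pselect (X p); last by exists (fun=> p, 0, 0, 0).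
  have [phi [rho [L [r0 L0 hphi]]]] := curve_chart cp.
  have [_ _ _ /(_ _ r0)[e e0 he]] := hphi.
  exists (phi, rho, L, e) => _; split => // q cq pq.
  by have [u ur uq] := he q cq pq; exists u => //; exact: ltW.
pose ph p := (ch p).1.1.1; pose rho p := (ch p).1.1.2; pose Lc p := (ch p).1.2; pose ee p := (ch p).2.
have {}hch p : X p -> [/\ 0 < rho p, 0 < Lc p, 0 < ee p, lipschitz_chart X p (ph p) (rho p) (Lc p) &
    forall q, X q -> mdist p q < ee p -> exists2 u, cm u <= rho p & ph p u = q].
  by move=> /hch; rewrite /ph /rho /Lc /ee; case: (ch p) => -[[? ?] ?] ?.
have : compact (curve_ball r) by exact: curve_ball_compact.
rewrite compact_cover.
move=> /(_ _ (curve_ball r) (fun p => interior [set q | mdist p q < ee p])) [].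
- by move=> p _; exact: open_interior.
- move=> p [cp xp]; exists p => //; apply/nbhs_mdistP; have [_ _ e0 _ _] := hch p cp.
  by exists (ee p).
move=> D' D'sub cov; pose s : seq (cspace R 2) := finmap.enum_fset D'.
have sX p : p \in s -> X p by move=> ps; have /set_mem[] := D'sub _ ps.
have s0 : 0 <= \sum_(p <- s) `|rho p * Lc p| by apply: sumr_ge0.
exists (size s), (fun k u => let p := nth 0 s k in ph p (((rho p)%:C)%C * u)),
  (\sum_(p <- s) `|rho p * Lc p| + 1); split; first by rewrite ltr_wpDl.
  move=> k ks u v u1 v1 /=; set p := nth 0 s k.
  have ps : p \in s by exact: mem_nth.
  have [r0 L0 _ hc _] := hch p (sX _ ps).
  have rs w : cm w <= 1 -> cm (((rho p)%:C)%C * w) <= rho p.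
    by move=> w1; rewrite cmM cm_real gtr0_norm// ler_piMr// ltW.
  have [Xphi _ _ _] := hc; split; [exact/Xphi/rs|exact/Xphi/rs|].
  apply: (le_trans (chart_inner_dist L0 hc (rs _ u1) (rs _ v1))).
  rewrite lee_fin -mulrBr cmM cm_real gtr0_norm// mulrA.
  rewrite ler_wpM2r ?cm_ge0// (@le_trans _ _ `|rho p * Lc p|)//.
    by rewrite mulrC ler_norm.
  apply: (@le_trans _ _ (\sum_(p <- s) `|rho p * Lc p|)); last by rewrite lerDl.
  rewrite (perm_big _ (perm_to_rem ps)) big_cons/= lerDl.
  by apply: sumr_ge0.
move=> q qr; have [p /= pD' /interior_subset /= pq] := cov q qr.
have ps : p \in s by [].
have [r0 L0 _ hc cvr] := hch p (sX _ ps).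
have [u ur uq] := cvr q qr.1 pq.
exists (index p s), (((rho p)^-1%:C)%C * u); split.
- by rewrite index_mem.
- rewrite cmM cm_real ger0_norm ?invr_ge0 ?(ltW r0)//.
  by rewrite mulrC ler_pdivrMr// mul1r.
- rewrite /= nth_index// mulrA -rmorphM divff ?lt0r_neq0// rmorph1 mul1r//.
Qed.

End CurvePatches.

Section ModelOfCurve.
Variables (R : realType) (m : nat) (Y : set (cspace R m)) (F : cspace R 2 -> cspace R m).
Local Notation C := R[i].
Local Notation X := (@curve R).
Hypotheses (algY : algebraic_set Y) (YE : Y = F @` X) (lneY : LNE Y)
  (bilF : bilipschitz X (inner_dist X) (inner_dist Y) F).

(** In a chart the inner distance to the centre is small. *)
Lemma model_cont : cont_on X F.
Proof.
have [L L0 hL] := model_lipschitz bilF.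
move=> p cp e e0; have [phi [r [K [r0 K0 hphi]]]] := curve_chart cp.
have [Xphi _ phi0 near] := hphi.
pose d := Order.min r (e / (L * K)).
have d0 : 0 < d by rewrite lt_min r0 divr_gt0// mulr_gt0.
have [d' d'0 hd'] := near d d0; exists d' => // q cq pq.
have [u ud <-] := hd' q cq pq; move: ud; rewrite lt_min => /andP[ur ue].
have r00 : cm (0 : C) <= r by rewrite cm0 ltW.
rewrite -phi0; apply: (@le_lt_trans _ _ (L * (K * cm (0 - u)))).
  apply: hL; [exact: Xphi|exact/Xphi/ltW|].
  by apply: (chart_inner_dist K0 hphi) => //; exact: ltW.
by rewrite sub0r cmN mulrA mulrC -ltr_pdivlMr// mulr_gt0.
Qed.

(** Otherwise the projection of [Y] to these two coordinates would contain the
    complement of an algebraic curve, but it is a countable union of closed sets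
    with empty interior. *)
Lemma model_dependent (i j : 'I_m) : exists2 P : {poly {poly C}}, P != 0 &
  forall y, Y y -> ev2 P (co y i) (co y j) = 0.
Proof.
have [P P0 [onto|]] := projection_dichotomy algY i j; last by move=> h; exists P.
exfalso; pose pr (y : cspace R m) := mk (co y i) (co y j).
have prD y y' : mdist (pr y) (pr y') <= 2 * mdist y y'.
  rewrite (le_trans (mdist2_le _ _))// /pr !co_mk0 !co_mk1.
  have := co_le_mdist y y' i; have := co_le_mdist y y' j; lra.
have cpr : cont_on X (pr \o F).
  apply: (@cont_on_comp _ _ _ _ X setT F pr) => //; first exact: model_cont.
  by apply: cont_on_lip => x y _ _; exact: prD.
pose A n : set (cspace R 2) := if n is n'.+1 then (pr \o F) @` curve_ball n'%:R
  else [set p | ev2 P (co p ord0) (co p (lift ord0 ord0)) = 0].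
have [n|n x e e0|y hy] := @baire_plane R A.
- case: n => [|n].
    apply/closedP_mdist => x h /=; apply/eqP/negPn/negP => nz.
    have [d d0 hd] := ev2_continuous nz; have [y /= y0 xy] := h d d0.
    have : ev2 P (co y ord0) (co y (lift ord0 ord0)) != 0.
      by apply: hd; rewrite cm_distC; apply: le_lt_trans xy; exact: co_le_mdist.
    by rewrite y0 eqxx.
  apply: (@closed_image R _ _ (curve_ball n%:R) (pr \o F)); first exact: curve_ball_compact.
  by apply: cont_on_sub cpr => q [].
- case: n => [|n].
    have e20 : 0 < e / 2 by rewrite divr_gt0.
    have [z [w [zx wx zw]]] := ev2_nonzero_near (co x ord0) (co x (lift ord0 ord0)) P0 e20.
    exists (mk z w); last by rewrite /A/= co_mk0 co_mk1; apply/eqP.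
    rewrite (le_lt_trans (mdist2_le _ _))// co_mk0 co_mk1 [ltRHS]splitr.
    by rewrite cm_distC [cm (_ - w)]cm_distC ltrD.
  have [M [phi [K [K0 lip cov]]]] := @curve_patches R n%:R.
  have [L L0 hL] := model_lipschitz bilF.
  have [||y xy hy] := @lipschitz_discs_thin R M (fun k u => pr (F (phi k u))) (2 * (L * K)) _ _ x e e0.
  - by rewrite !mulr_gt0.
  - move=> k kM u v u1 v1; have [Xu Xv uv] := lip k kM u v u1 v1.
    apply: (le_trans (prD _ _)); rewrite -!mulrA ler_pM2l//; exact: hL.
  exists y => // -[q qn qy]; apply: hy; have [k [u [kM u1 uq]]] := cov q qn.
  by exists k, u; split => //; rewrite uq.
have yE : ev2 P (co y ord0) (co y (lift ord0 ord0)) != 0 by apply/eqP; exact: hy 0%N.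
have [y' Yy' [zE wE]] := onto _ _ yE; rewrite YE in Yy'; have [q cq qy'] := Yy'.
apply: (hy (Num.truncn (cm (co q ord0))).+2); exists q.
  by split => //=; apply/ltW; exact: truncnS_gt.
by rewrite /= /pr qy' zE wE mkK.
Qed.

End ModelOfCurve.

(** * The direction at infinity of a model *)

Section Asymptotics.
Variables (R : realType) (m : nat) (Y : set (cspace R m)) (F : cspace R 2 -> cspace R m).
Local Notation C := R[i].
Local Notation X := (@curve R).
Hypotheses (algY : algebraic_set Y) (YE : Y = F @` X) (lneY : LNE Y)
  (bilF : bilipschitz X (inner_dist X) (inner_dist Y) F).

Definition nrm (y : cspace R m) : R := mdist (0 : cspace R m) y.

Lemma co_le_nrm y j : cm (co y j) <= nrm y.
Proof. by have := co_le_mdist (0 : cspace R m) y j; rewrite /co !mxE sub0r cmN. Qed.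

Lemma nrm_le_sum y : nrm y <= \sum_j cm (co y j).
Proof.
apply: le_trans (mdist_le_sum _ _) _; apply: ler_sum => j _.
by rewrite {1}/co mxE sub0r cmN.
Qed.

Lemma nrm_lip x y : `|nrm x - nrm y| <= mdist x y.
Proof.
have := metric_triangle (0 : cspace R m) x y.
have := metric_triangle (0 : cspace R m) y x.
rewrite (metric_sym y x) -!/(nrm _) => ? ?.
by rewrite ler_norml; apply/andP; split; lra.
Qed.

Let E (r : R) : set (cspace R m) := F @` (X `&` [set p | outer r (co p ord0)]).

Lemma end_connected r : 1 <= r -> connected (E r).
Proof.
move=> r1; apply: connected_image; first exact: curve_end_connected.
by apply: cont_on_sub (model_cont bilF) => p [].
Qed.

(** [F] and its inverse preserve closeness to infinity, by the Lipschitz inverse in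
    one direction and by compactness in the other ([far_end]). *)
Lemma end_far (r : R) : exists2 s, 1 <= s & forall y, E s y -> r < nrm y.
Proof.
have [K K0 hK] := model_inverse_lipschitz YE lneY bilF.
have c0 : X (mk 0 0) by apply/curve_mk; rewrite !expr0n/= subr0.
exists (1 + K * `|r + nrm (F (mk 0 0)) + 1|); first by rewrite lerDl mulr_ge0// ltW.
move=> _ [p [cp /= op] <-].
have sx : 1 + K * `|r + nrm (F (mk 0 0)) + 1| <= cm (co p ord0).
  by case: op => h; apply: (le_trans h); [exact: Re_le_cm|exact: Im_le_cm].
have := co_le_mdist (mk 0 0) p ord0; rewrite co_mk0 sub0r cmN => xp.
have := hK _ _ c0 cp; have := metric_triangle (F (mk 0 0)) (0 : cspace R m) (F p).
rewrite (metric_sym (F (mk 0 0)) (0 : cspace R m)) -!/(nrm _) => tr lip.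
have h : K * `|r + nrm (F (mk 0 0)) + 1| < K * mdist (F (mk 0 0)) (F p) by lra.
rewrite ltr_pM2l// in h; have := ler_norm (r + nrm (F (mk 0 0)) + 1); lra.
Qed.

Lemma far_end (s : R) : exists r, forall y, Y y -> r < nrm y -> E s y.
Proof.
have cK := compact_image (@curve_ball_compact R (2 * s))
   (cont_on_sub (@subIsetl _ _ _) (model_cont bilF)).
have [b hb] := compact_bounded_from (0 : cspace R m) cK.
exists b => y Yy by_; move: Yy; rewrite YE => -[p cp py]; exists p => //; split => //=.
apply: contrapT => /not_orP[/negP + /negP]; rewrite -!ltNge => h1 h2.
suff : nrm y <= b by rewrite leNgt by_.
apply: hb; exists p => //; split => //=.
by have := cm_le_ReIm (co p ord0); lra.
Qed.

Lemma model_unbounded (r : R) : exists2 y, Y y & r < nrm y.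
Proof.
have [s s1 hs] := end_far r.
have [y cy] := curve_above (s%:C)%C.
have Es : E s (F (mk (s%:C)%C y)).
  by exists (mk (s%:C)%C y) => //; split => //=; left; rewrite co_mk0 /= ler_norm.
by exists (F (mk (s%:C)%C y)); [rewrite YE; exists (mk (s%:C)%C y)|exact: hs].
Qed.

(** When [a] has [i]-th coordinate 1, this measures the distance from [y] to the
    line spanned by [a], by projection along the other coordinates. *)
Let dev (a : cspace R m) (i : 'I_m) (y : cspace R m) : R :=
  \sum_j cm (co y j - co a j * co y i).

Let dev_lip a i : exists L, forall x y, `|dev a i x - dev a i y| <= L * mdist x y.
Proof.
exists (\sum_j (1 + cm (co a j))) => x y; rewrite /dev -sumrB mulr_suml.
apply: (le_trans (ler_norm_sum _ _ _)); apply: ler_sum => j _.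
set u := co x j - _; set v := co y j - _.
apply: (@le_trans _ _ (cm (u - v))).
  have := cm_leD u v; have := cm_leD v u; rewrite (cm_distC v u) => ? ?.
  by rewrite ler_norml; apply/andP; split; lra.
have -> : u - v = (co x j - co y j) - co a j * (co x i - co y i).
  by rewrite /u /v; ring.
rewrite mulrDl mul1r (le_trans (cmB _ _))// lerD ?co_le_mdist//.
by rewrite cmM ler_wpM2l ?cm_ge0 ?co_le_mdist.
Qed.

(** When the [i]-th coordinate is the largest, [top_form] confines each quotient by
    it to a finite set; a direction is a choice of [i] and of a root for each other
    coordinate, given by its rank in the list of roots. *)
Let finitely_many_directions : exists (J : finType) (dir : J -> cspace R m) (pos : J -> 'I_m),
  (forall a, co (dir a) (pos a) = 1) /\
  forall e : R, 0 < e -> exists r, forall y, Y y -> r < nrm y -> exists a : J,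
    (forall j, cm (co y j - co (dir a) j * co y (pos a)) <= e * nrm y) /\
    nrm y <= m%:R * cm (co y (pos a)).
Proof.
have /choice[h hh] : forall ij : 'I_m * 'I_m, exists h : {poly C}, h != 0 /\
    forall e : R, 0 < e -> exists r, forall y, Y y ->
      cm (co y ij.2) <= cm (co y ij.1) -> r < cm (co y ij.1) ->
      exists2 rho, root h rho & cm (co y ij.2 / co y ij.1 - rho) < e.
  move=> [i j]; have [P P0 hP] := model_dependent algY YE bilF i j.
  have [h h0 hh] := top_form P0; exists h; split => // e e0.
  have [r hr] := hh e e0; exists r => y Yy yij yr.
  exact: hr yij yr (hP _ Yy).
have /choice[rs hrs] : forall ij : 'I_m * 'I_m, exists s : seq C,
    forall w, root (h ij) w -> w \in s.
  move=> ij; have [s [sE _]] := poly_split (h ij); exists s => w rw.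
  by rewrite sE// (hh ij).1.
pose N := \max_(ij : 'I_m * 'I_m) size (rs ij).
pose J := ('I_m * {ffun 'I_m -> 'I_N.+1})%type.
pose dir (a : J) : cspace R m := \row_j if j == a.1 then 1 else (rs (a.1, j))`_(a.2 j).
have dirE a j : co (dir a) j = if j == a.1 then 1 else (rs (a.1, j))`_(a.2 j).
  by rewrite /co mxE.
exists J, dir, (fun a => a.1); split; first by move=> a; rewrite dirE eqxx.
move=> e e0.
have /choice[rr hrr] : forall ij : 'I_m * 'I_m, exists r : R, forall y, Y y ->
    cm (co y ij.2) <= cm (co y ij.1) -> r < cm (co y ij.1) ->
    exists2 rho, root (h ij) rho & cm (co y ij.2 / co y ij.1 - rho) < e.
  by move=> ij; have [r hr] := (hh ij).2 e e0; exists r.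
pose T := \sum_(ij : 'I_m * 'I_m) `|rr ij|.
have T0 : 0 <= T by apply: sumr_ge0.
have rT ij : rr ij <= T.
  rewrite (le_trans (ler_norm _))// /T (bigD1 ij)//= lerDl.
  by apply: sumr_ge0.
exists (m%:R * T) => y Yy yT.
have m0 : (0 < m)%N.
  rewrite lt0n; apply/eqP => m0; move: yT; rewrite {1}m0 mul0r ltNge.
  rewrite (le_trans (nrm_le_sum y))// big1// => j _.
  by have := ltn_ord j; rewrite {2}m0.
pose i := [arg max_(i > Ordinal m0) cm (co y i)]%O.
have imax j : cm (co y j) <= cm (co y i).
  by rewrite /i; case: arg_maxP => //= k _ hk; exact: hk.
have ni : nrm y <= m%:R * cm (co y i).
  rewrite (le_trans (nrm_le_sum y))// (le_trans (ler_sum _ (fun j _ => imax j)))//.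
  by rewrite sumr_const card_ord mulr_natl.
have Ti : T < cm (co y i).
  by rewrite -(ltr_pM2l (_ : 0 < m%:R)) ?ltr0n// (lt_le_trans yT).
have yi0 : co y i != 0 by rewrite -cm_gt0 (le_lt_trans T0).
have /choice[f hf] : forall j, exists k : 'I_N.+1, j != i ->
    cm (co y j / co y i - (rs (i, j))`_k) < e.
  move=> j; have [|rho rrho yrho] := hrr (i, j) y Yy (imax j).
    exact: le_lt_trans (rT _) Ti.
  have rin := hrs _ _ rrho.
  have kN : (index rho (rs (i, j)) < N.+1)%N.
    rewrite ltnS (leq_trans (index_size _ _))//.
    exact: (leq_bigmax_cond (F := fun ij => size (rs ij))).
  by exists (Ordinal kN) => _; rewrite nth_index.
exists (i, [ffun j => f j]); split => //= j.
rewrite dirE/= ffunE; have [->|ji] := eqVneq j i.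
  by rewrite mul1r subrr cm0 mulr_ge0 ?(ltW e0)// mdist_ge0.
have -> : co y j - (rs (i, j))`_(f j) * co y i =
    (co y j / co y i - (rs (i, j))`_(f j)) * co y i.
  by rewrite mulrBl divfK.
by rewrite cmM ler_pM ?cm_ge0 ?co_le_nrm// ltW// hf.
Qed.

(** Close to infinity, the angle of [y] with a fixed direction takes values near a
    finite set, so it is either small or bounded below. It cannot pass from one
    case to the other as the end of [Y] is connected. *)
Lemma single_direction : exists (i : 'I_m) (a : cspace R m), co a i = 1 /\
  forall e : R, 0 < e -> exists r, forall y, Y y -> r < nrm y ->
    forall j, cm (co y j - co a j * co y i) <= e * nrm y.
Proof.
have [J [dir [pos [dir1 hdir]]]] := finitely_many_directions.
pose delta (p : J * J) := dev (dir p.1) (pos p.1) (dir p.2).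
have [k k0 hk] := @seq_gap R _ (enum {: J * J}) delta.
have {}hk a b : delta (a, b) = 0 \/ k <= delta (a, b).
  have d0 : 0 <= delta (a, b) by apply: sumr_ge0 => j _; exact: cm_ge0.
  have [|d1] := eqVneq (delta (a, b)) 0; [by left|right].
  by apply: hk; rewrite ?mem_enum// lt_neqAle eq_sym d1.
pose c := \sum_(a : J) \sum_j (1 + cm (co (dir a) j)) + 1.
have c0 : 0 < c.
  rewrite ltr_wpDl//; apply: sumr_ge0 => a _; apply: sumr_ge0 => j _.
  by rewrite addr_ge0// cm_ge0.
have ca a : \sum_j (1 + cm (co (dir a) j)) <= c.
  rewrite /c (bigD1 a)//= -addrA lerDl addr_ge0//; apply: sumr_ge0 => b _.
  by apply: sumr_ge0 => j _; rewrite addr_ge0// cm_ge0.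
pose k' := k / (m%:R + 1); have k'0 : 0 < k' by rewrite divr_gt0// ltr_wpDl.
(* [delta (a, b)] vanishes when the directions [a] and [b] span the same line. *)
have gap e a b y : 0 < e ->
    (forall j, cm (co y j - co (dir b) j * co y (pos b)) <= e * nrm y) ->
    nrm y <= m%:R * cm (co y (pos b)) ->
    (delta (a, b) = 0 -> dev (dir a) (pos a) y <= c * e * nrm y) /\
    (k <= delta (a, b) -> (k' - c * e) * nrm y <= dev (dir a) (pos a) y).
  move=> e0 yb ny; set l := co y (pos b).
  pose err := \sum_j (1 + cm (co (dir a) j)) * (e * nrm y).
  have errc : err <= c * e * nrm y.
    by rewrite /err -mulr_suml -mulrA ler_wpM2r// mulr_ge0 ?(ltW e0)// mdist_ge0.
  pose s j := co y j - co (dir a) j * co y (pos a).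
  pose t j := l * (co (dir b) j - co (dir a) j * co (dir b) (pos a)).
  have st j : cm (s j - t j) <= (1 + cm (co (dir a) j)) * (e * nrm y).
    have -> : s j - t j = (co y j - co (dir b) j * l) -
        co (dir a) j * (co y (pos a) - co (dir b) (pos a) * l) by rewrite /s /t; ring.
    rewrite (le_trans (cmB _ _))// mulrDl mul1r; apply: lerD; first exact: yb.
    by rewrite cmM ler_wpM2l ?cm_ge0//; exact: yb.
  have tE : \sum_j cm (t j) = cm l * delta (a, b).
    by rewrite mulr_sumr; apply: eq_bigr => j _; rewrite cmM.
  have dE : dev (dir a) (pos a) y = \sum_j cm (s j) by [].
  split=> hd.
    rewrite dE (le_trans _ errc)// /err; apply: (@le_trans _ _ (\sum_j (cm (t j) + cm (s j - t j)))).
      by apply: ler_sum => j _; exact: cm_leD.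
    by rewrite big_split/= tE hd mulr0 add0r; exact: ler_sum.
  rewrite mulrBl lerBlDr (le_trans _ (lerD (lexx _) errc))//.
  apply: (@le_trans _ _ (\sum_j cm (t j))).
    rewrite tE /k' mulrAC ler_pdivrMr ?ltr_wpDl// mulrC.
    have l0 := cm_ge0 l; have : nrm y <= cm l * (m%:R + 1) by rewrite mulrDr mulr1 mulrC; lra.
    move=> h; rewrite mulrC -mulrA [delta _ * _]mulrC mulrA.
    by rewrite mulrC ler_pM ?mdist_ge0// ltW.
  rewrite dE /err -big_split/=; apply: ler_sum => j _.
  by have := cm_leD (t j) (s j); have := st j; rewrite (cm_distC (s j)); lra.
pose e0 := k' / (3 * c); have e00 : 0 < e0 by rewrite divr_gt0// mulr_gt0.
have ce0 : c * e0 = k' / 3 by rewrite /e0; field; rewrite lt0r_neq0.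
have [r0 hr0] := hdir e0 e00.
have [s s1 hs] := end_far (Num.max r0 0).
have EY y : E s y -> Y y by move=> [p [cp _] <-]; rewrite YE; exists p.
have Es y : E s y -> r0 < nrm y /\ 0 < nrm y.
  by move=> /hs; rewrite gt_max => /andP[].
have [ys Eys] : exists y, E s y.
  have [y cy] := curve_above (s%:C)%C; exists (F (mk (s%:C)%C y)), (mk (s%:C)%C y) => //.
  by split => //=; left; rewrite co_mk0/= ler_norm.
have [a [ya _]] := hr0 ys (EY _ Eys) (Es _ Eys).1.
exists (pos a), (dir a); split => // e epos.
have small y : E s y -> dev (dir a) (pos a) y < k' / 2 * nrm y.
  move=> Ey; rewrite ltNge; apply/negP => big.
  have [L hL] := dev_lip (dir a) (pos a).
  pose g y := dev (dir a) (pos a) y - k' / 2 * nrm y.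
  have cg : @cont_on R (cspace R m) R^o (E s) g.
    apply: (@cont_on_lip R _ R^o _ _ (L + k' / 2)) => u v _ _; rewrite mdistRE /g.
    have := hL v u; have := nrm_lip u v; rewrite (metric_sym v u) => h1 h2.
    have -> : dev (dir a) (pos a) v - k' / 2 * nrm v - (dev (dir a) (pos a) u - k' / 2 * nrm u) =
       (dev (dir a) (pos a) v - dev (dir a) (pos a) u) + k' / 2 * (nrm u - nrm v) by ring.
    rewrite (le_trans (ler_normD _ _))// mulrDl lerD// normrM gtr0_norm ?divr_gt0//.
    by rewrite ler_pM2l// divr_gt0.
  have gap0 z : E s z -> g z <> 0.
    move=> Ez gz; have [nr n0] := Es _ Ez.
    have [b [zb nz]] := hr0 z (EY _ Ez) nr.
    have [g1 g2] := gap e0 a b z e00 zb nz.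
    move/eqP: gz; rewrite /g subr_eq0 => /eqP gz.
    case: (hk a b) => [/g1|/g2]; rewrite gz ce0.
      by rewrite ler_pM2r//; lra.
    by rewrite ler_pM2r//; lra.
  have gys : g ys < 0.
    have [_ n0] := Es _ Eys; rewrite /g subr_lt0.
    apply: (@le_lt_trans _ _ (c * e0 * nrm ys)); last by rewrite ce0 ltr_pM2r//; lra.
    have en0 : 0 <= e0 * nrm ys by rewrite mulr_ge0 ?(ltW e00) ?(ltW n0).
    apply: (@le_trans _ _ (\sum_j (1 + cm (co (dir a) j)) * (e0 * nrm ys))).
      apply: ler_sum => j _; rewrite (le_trans (ya j))// mulrDl mul1r lerDl.
      by rewrite mulr_ge0// cm_ge0.
    by rewrite -mulr_suml -mulrA ler_wpM2r.
  have gy : 0 < g y.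
    by rewrite lt_neqAle eq_sym /g subr_ge0 big andbT; apply/eqP; exact: gap0.
  have [z Ez gz] := connected_ivt (end_connected s1) cg Eys Ey gys gy.
  exact: gap0 Ez gz.
pose e1 := Num.min e0 (e / c).
have e10 : 0 < e1 by rewrite lt_min e00 divr_gt0.
have [r1 hr1] := hdir e1 e10; have [r2 hr2] := far_end s.
exists (Num.max r1 r2) => y Yy; rewrite gt_max => /andP[y1 y2] j.
have Ey := hr2 y Yy y2; have [_ n0] := Es _ Ey.
have [b [yb ny]] := hr1 y Yy y1.
have [g1 g2] := gap e1 a b y e10 yb ny.
have ce1 : c * e1 <= k' / 3.
  by rewrite -ce0 ler_pM2l// ge_min lexx.
have ce : c * e1 <= e.
  by rewrite mulrC -ler_pdivlMr// ge_min lexx orbT.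
have d : dev (dir a) (pos a) y <= e * nrm y.
  case: (hk a b) => [/g1 h|/g2 h].
    by rewrite (le_trans h)// ler_wpM2r// ltW.
  have : (k' - c * e1) * nrm y < k' / 2 * nrm y by exact: le_lt_trans h (small _ Ey).
  by rewrite ltr_pM2r//; lra.
apply: le_trans d; rewrite /dev (bigD1 j)//= lerDl.
by apply: sumr_ge0 => l _; exact: cm_ge0.
Qed.

End Asymptotics.

(** * A model is a graph over a line *)

Section Graph.
Variables (R : realType) (m : nat) (Y : set (cspace R m)) (F : cspace R 2 -> cspace R m).
Local Notation C := R[i].
Local Notation U := (cspace R 1).
Local Notation X := (@curve R).
Hypotheses (algY : algebraic_set Y) (YE : Y = F @` X) (lneY : LNE Y)
  (bilF : bilipschitz X (inner_dist X) (inner_dist Y) F).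
Variables (i : 'I_m) (a : cspace R m).
Hypothesis dir_a : forall e : R, 0 < e -> exists r, forall y, Y y -> r < nrm y ->
  forall j, cm (co y j - co a j * co y i) <= e * nrm y.

Let zc (y : cspace R m) : U := pt (co y i).

Let zc_lip x y : mdist (zc x) (zc y) <= mdist x y.
Proof. by rewrite mdist_cx !ptK co_le_mdist. Qed.

Let cont_zc (A : set (cspace R m)) : cont_on A zc.
Proof. by apply: (@cont_on_lip _ _ _ _ _ 1) => x y _ _; rewrite mul1r zc_lip. Qed.

(** The sum of the moduli of the coordinates is O(|y_i|) + o(|y|). *)
Lemma coordinate_proper : exists A b : R, [/\ 0 < A, 0 <= b &
  forall y, Y y -> nrm y <= A * cm (co y i) + b].
Proof.
have e0 : 0 < 1 / (2 * (m%:R + 1)) :> R by rewrite divr_gt0// mulr_gt0// ltr_wpDl.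
have [r hr] := dir_a e0; pose S := \sum_j cm (co a j).
have S0 : 0 <= S by apply: sumr_ge0 => j _; exact: cm_ge0.
exists (2 * S + 1), `|r|; split => //; first by rewrite ltr_wpDl// mulr_ge0.
move=> y Yy; have [yr|ry] := leP (nrm y) r.
  rewrite (le_trans yr)// (le_trans (ler_norm _))// lerDr mulr_ge0 ?cm_ge0//.
  by rewrite addr_ge0// mulr_ge0.
have n0 : 0 <= nrm y by exact: mdist_ge0.
suff h : nrm y <= nrm y / 2 + S * cm (co y i).
  have := normr_ge0 r; have := cm_ge0 (co y i); rewrite mulrDl mul1r; lra.
apply: (le_trans (nrm_le_sum y)).
apply: (@le_trans _ _ (\sum_(j < m) (1 / (2 * (m%:R + 1)) * nrm y + cm (co a j) * cm (co y i)))).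
  apply: ler_sum => j _; rewrite -cmM (le_trans (cm_leD _ (co a j * co y i)))// addrC lerD2r.
  exact: hr.
rewrite big_split/= -[X in _ + X]mulr_suml lerD2r sumr_const card_ord -[leLHS]mulr_natl.
rewrite mulrA [leRHS]mulrC ler_wpM2r// mul1r ler_pdivrMr ?mulr_gt0 ?ltr_wpDl//.
by have : (0 : R) <= m%:R by []; lra.
Qed.

Lemma bounded_part_compact (P : set (cspace R m)) (r : R) : closed P ->
  (forall y, P y -> cm (co y i) <= r) -> compact (Y `&` P).
Proof.
move=> clP Pr; have [A [b [A0 b0 hA]]] := coordinate_proper.
apply: (@cspace_compact _ _ _ (A * r + b)).
  by apply: closedI => //; exact: algebraic_closed.
move=> y [Yy Py] j; rewrite (le_trans (co_le_nrm _ _))// (le_trans (hA _ Yy))//.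
by rewrite lerD2r ler_pM2l// Pr.
Qed.

Let closed_co_le (j : 'I_m) (w : C) (r : R) : closed [set y : cspace R m | cm (co y j - w) <= r].
Proof.
apply: closed_le_lip => x y /=.
have := cm_leD (co x j - w) (co y j - w); have := cm_leD (co y j - w) (co x j - w).
have -> : co x j - w - (co y j - w) = co x j - co y j by ring.
have -> : co y j - w - (co x j - w) = co y j - co x j by ring.
have := co_le_mdist x y j; rewrite (cm_distC (co y j) (co x j)) => ? ? ?.
by rewrite ler_norml; apply/andP; split; lra.
Qed.

Let closed_co_ge (j : 'I_m) (w : C) (r : R) : closed [set y : cspace R m | r <= cm (co y j - w)].
Proof.
have -> : [set y : cspace R m | r <= cm (co y j - w)] = [set y | - cm (co y j - w) <= - r].
  by apply/seteqP; split=> y /=; rewrite lerN2.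
apply: closed_le_lip => x y /=; rewrite -opprD normrN.
have := cm_leD (co x j - w) (co y j - w); have := cm_leD (co y j - w) (co x j - w).
have -> : co x j - w - (co y j - w) = co x j - co y j by ring.
have -> : co y j - w - (co x j - w) = co y j - co x j by ring.
have := co_le_mdist x y j; rewrite (cm_distC (co y j) (co x j)) => ? ? ?.
by rewrite ler_norml; apply/andP; split; lra.
Qed.

(** Two points of the model with the same large [i]-th coordinate are close to
    each other, hence joined by a short path; the projection of this path is a
    loop that stays away from the branch points. *)
Lemma far_injective : exists r : R, forall y y', Y y -> Y y' -> co y i = co y' i ->
  r < cm (co y i) -> y = y'.
Proof.
have /choice[P hP] : forall j, exists P : {poly {poly C}}, P != 0 /\
    forall y, Y y -> ev2 P (co y i) (co y j) = 0.
  by move=> j; have [P P0 hP] := model_dependent algY YE bilF i j; exists P.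
have /choice[B hB] : forall j, exists B : {poly C}, B != 0 /\ exists n, forall z, B.[z] != 0 ->
    (lead_coef (P j)).[z] != 0 /\
    exists s, [/\ uniq s, size s = n & forall w, (w \in s) = root (slice (P j) z) w].
  by move=> j; have [B B0 hB] := generic_root_count (hP j).1; exists B.
have BB0 : \prod_j B j != 0 by apply/prodf_neq0 => j _; exact: (hB j).1.
have [rB rB0 hrB] := poly_nonzero_far BB0.
have [K K0 hK] := lne_curves lneY.
have [A [b [A0 b0 hA]]] := coordinate_proper.
pose e := 1 / (32 * K * (m%:R + 1) * A).
have m10 : 0 < m%:R + 1 :> R by rewrite ltr_wpDl.
have e0 : 0 < e by rewrite divr_gt0// !mulr_gt0.
have [r hr] := dir_a e0.
exists (Num.max (2 * rB) (Num.max (b / A) (`|r|))) => y y' Yy Yy' yy'.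
rewrite !gt_max => /and3P[zB zA zr]; apply: contrapT => ne.
set z0 := co y i in yy' zB zA zr *.
have z00 : 0 < cm z0 by rewrite (le_lt_trans _ zr).
have bz : b <= A * cm z0 by rewrite ltr_pdivrMr// in zA; rewrite mulrC ltW.
have near j x : Y x -> co x i = z0 -> cm (co x j - co a j * z0) <= e * (2 * A * cm z0).
  move=> Yx xz; have nx : r < nrm x.
    by apply: le_lt_trans (ler_norm r) _; apply: lt_le_trans zr _; rewrite -xz co_le_nrm.
  have := hr x Yx nx j; rewrite xz => h; apply: (le_trans h); rewrite ler_pM2l//.
  by have := hA x Yx; rewrite xz; lra.
have dyy : K * mdist y y' <= cm z0 / 8.
  rewrite mulrC -ler_pdivlMr// (le_trans (mdist_le_sum _ _))//.
  apply: (@le_trans _ _ (\sum_(j < m) (2 * (e * (2 * A * cm z0))))).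
    apply: ler_sum => j _.
    have h1 := near j y Yy erefl; have h2 := near j y' Yy' (esym yy').
    have := cm_tri (co a j * z0) (co y j) (co y' j).
    by rewrite (cm_distC (co a j * z0)); lra.
  rewrite sumr_const card_ord -[leLHS]mulr_natr.
  have -> : 2 * (e * (2 * A * cm z0)) * m%:R = cm z0 / 8 / K * (m%:R / (m%:R + 1)).
    by rewrite /e; field; rewrite !lt0r_neq0.
  rewrite ler_piMr// ?divr_ge0 ?(ltW K0) ?cm_ge0//.
  by rewrite ler_pdivrMr// mul1r lerDl.
have [g [cg g0 g1 Yg] gK] := hK y y' Yy Yy' ne.
have gz t : t \in `[0, 1] -> cm (co (g t) i - z0) <= cm z0 / 8.
  move=> t01; rewrite cm_distC (le_trans (co_le_mdist _ _ i))//.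
  by rewrite (le_trans (ltW (gK t t01))).
apply: ne; apply/cspace_eqP => j.
have [n hn] := (hB j).2.
pose d := cm z0 / 8.
have cgc := (cont_on_curve _ _).1 cg.
have := @root_loop_closes R (P j) n (complex.Re z0 - d) (complex.Re z0 + d)
  (complex.Im z0 - d) (complex.Im z0 + d) (fun t => pt (co (g t) i)) (fun t => pt (co (g t) j)).
rewrite g0 g1 -yy' => H.
rewrite -[LHS]ptK -[RHS]ptK; congr cx; apply: H => //.
- move=> u [u1 u2 u3 u4]; apply: hn.
  have uz : cm (cx u - z0) <= cm z0 / 4.
    have := cm_le_ReIm (cx u - z0); rewrite ReD ReN ImD ImN => h; apply: (le_trans h).
    have : `|complex.Re (cx u) - complex.Re z0| <= d by rewrite ler_norml; apply/andP; split; lra.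
    have : `|complex.Im (cx u) - complex.Im z0| <= d by rewrite ler_norml; apply/andP; split; lra.
    by rewrite /d; lra.
  have : (\prod_j B j).[cx u] != 0.
    by apply: hrB; have := cm_leD z0 (cx u); rewrite cm_distC; lra.
  by rewrite horner_prod => /prodf_neq0; exact.
- apply: (@cont_on_comp R R^o _ _ `[0, 1]%classic setT g zc) => //; exact: cont_zc.
- apply: (@cont_on_comp R R^o _ _ `[0, 1]%classic setT g (fun y => pt (co y j))) => //.
  by apply: (@cont_on_lip _ _ _ _ _ 1) => u v _ _; rewrite mul1r mdist_cx !ptK co_le_mdist.
move=> t t01; split; last by rewrite !ptK; apply: (hP j).2; exact: Yg.
have := gz t t01; rewrite -/d => h.
have := le_trans (Re_le_cm _) h; have := le_trans (Im_le_cm _) h.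
rewrite ReD ReN ImD ImN !ler_norml => /andP[? ?] /andP[? ?].
by split; rewrite ptK; lra.
Qed.

Let generically_bijective : exists P : {poly C}, [/\ P != 0,
  forall z, P.[z] != 0 -> exists2 y, Y y & co y i = z &
  forall y y', Y y -> Y y' -> co y i = co y' i -> P.[co y i] != 0 -> y = y'].
Proof.
have [r hr] := far_injective; have [A [b [A0 b0 hA]]] := coordinate_proper.
have far_nonroot (P : {poly C}) (s : R) : P != 0 -> exists2 z, P.[z] != 0 & s < cm z.
  move=> P0; have [r' r'0 hr'] := poly_nonzero_far P0.
  exists ((`|s| + r' + 1)%:C)%C; rewrite ?hr'// cm_real ger0_norm ?addr_ge0//.
    by have := normr_ge0 s; lra.
  by have := ler_norm s; lra.
have [P P0 hP] : exists2 P : {poly C}, P != 0 &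
    forall z, P.[z] != 0 -> exists2 y, Y y & co y i = z.
  have [P P0 [h|h]] := generic_fiber algY i; first by exists P.
  have [r' r'0 hr'] := poly_nonzero_far P0.
  have [y Yy yn] := model_unbounded YE lneY bilF (A * r' + b).
  have := hA y Yy => ny; have : r' < cm (co y i).
    by rewrite -(ltr_pM2l A0); lra.
  by move=> /hr'; rewrite h ?eqxx.
have [Q Q0 hQ] : exists2 Q : {poly C}, Q != 0 &
    forall y y', Y y -> Y y' -> co y i = co y' i -> Q.[co y i] != 0 -> y = y'.
  have [Q Q0 [h|h]] := generic_double_fiber algY i; last by exists Q.
  have [z Qz rz] := far_nonroot Q r Q0.
  have [y [y' [Yy Yy' yz yz' ne]]] := h z Qz.
  by case: ne; apply: hr; rewrite ?yz ?yz'.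
exists (P * Q); split; first exact: mulf_neq0.
  by move=> z; rewrite hornerM mulf_eq0 negb_or => /andP[/hP].
move=> y y' Yy Yy' yy'; rewrite hornerM mulf_eq0 negb_or => /andP[_]; exact: hQ.
Qed.

Let image_closed (P : set (cspace R m)) (r : R) : closed P ->
  (forall y, P y -> cm (co y i) <= r) -> closed (zc @` (Y `&` P)).
Proof. by move=> clP Pr; exact: (@closed_image R _ _ _ zc (@bounded_part_compact _ _ clP Pr) (@cont_zc _)). Qed.

(** The image of the projection is closed and cofinite. *)
Lemma coordinate_surjective z : exists2 y, Y y & co y i = z.
Proof.
have [P [P0 hP _]] := generically_bijective.
have cl : closed (zc @` (Y `&` [set y | cm (co y i - z) <= 1])).
  apply: (@image_closed _ (cm z + 1)); first exact: closed_co_le.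
  by move=> y /= h; rewrite (le_trans (cm_leD _ z))// lerD2l.
have [e e0|y [Yy _] yz] := (closedP_mdist _).1 cl (pt z).
  have e10 : 0 < Num.min e 1 by rewrite lt_min e0 ltr01.
  have [w wz Pw] := poly_nonroot_near z P0 e10; have [y Yy yw] := hP w Pw.
  move: wz; rewrite lt_min => /andP[we w1].
  exists (pt w); last by rewrite mdist_cx !ptK cm_distC.
  by exists y; [split => //=; rewrite yw ltW|rewrite /zc yw].
by exists y => //; rewrite -[LHS]ptK -/(zc y) yz ptK.
Qed.

(** The projection is proper, hence closed. *)
Lemma unique_section_continuous (S : set U) (sg : U -> cspace R m) :
  (forall u, S u -> Y (sg u) /\ zc (sg u) = u) ->
  (forall y, Y y -> S (zc y) -> y = sg (zc y)) -> cont_on S sg.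
Proof.
move=> hsg uniq u0 Su0 e e0; have [Ys us] := hsg u0 Su0.
pose P : set (cspace R m) := [set y | cm (co y i - cx u0) <= 1] `&` [set y | e <= mdist (sg u0) y].
have cl : closed (zc @` (Y `&` P)).
  apply: (@image_closed _ (cm (cx u0) + 1)).
    apply: closedI; first exact: closed_co_le.
    have -> : [set y : cspace R m | e <= mdist (sg u0) y] = [set y | - mdist (sg u0) y <= - e].
      by apply/seteqP; split=> y /=; rewrite lerN2.
    apply: closed_le_lip => x y /=; rewrite -opprD normrN.
    have := metric_triangle (sg u0) x y; have := metric_triangle (sg u0) y x.
    by rewrite (metric_sym y x) => ? ?; rewrite ler_norml; apply/andP; split; lra.
  by move=> y [/= h _]; rewrite (le_trans (cm_leD _ (cx u0)))// lerD2l.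
apply: contrapT => hno.
have : (zc @` (Y `&` P)) u0.
  apply: ((closedP_mdist _).1 cl) => d d0.
  apply: contrapT => hno'; apply: hno; exists (Num.min d 1); first by rewrite lt_min d0 ltr01.
  move=> u Su; rewrite lt_min => /andP[ud u1]; rewrite ltNge; apply/negP => eu.
  have [Yu uu] := hsg u Su.
  apply: hno'; exists u => //; exists (sg u) => //; split => //; split => //=.
  by rewrite -[co (sg u) i]ptK -/(zc (sg u)) uu cm_distC -mdist_cx ltW.
move=> [y [Yy [_ /= ey]] yu]; have := uniq y Yy; rewrite yu => /(_ Su0) yE.
by move: ey; rewrite yE mdistxx leNgt e0.
Qed.

(** A punctured square is a union of four convex halves. *)
Let punctured (z : C) (e : R) : set U := [set u |
  [/\ `|complex.Re (cx u - z)| < e, `|complex.Im (cx u - z)| < e & cx u <> z]].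

Let punctured_connected z e : 0 < e -> connected (punctured z e).
Proof.
move=> e0; pose re (u : U) := complex.Re (cx u - z); pose im (u : U) := complex.Im (cx u - z).
pose box (p q r s : R) : set U := [set u | [/\ p < re u, re u < q, r < im u & im u < s]].
have re_seg u v t : re (seg u v t) = re u + t * (re v - re u).
  by rewrite /re /cx co_seg !ReD Re_realM !ReD !ReN -!/(cx _); ring.
have im_seg u v t : im (seg u v t) = im u + t * (im v - im u).
  by rewrite /im /cx co_seg !ImD Im_realM !ImD !ImN -!/(cx _); ring.
have box_conn p q r s : connected (box p q r s).
  have lt_conv (x y t c : R) : 0 <= t <= 1 -> c < x -> c < y -> c < x + t * (y - x).
    move=> /andP[t0 t1] cx0 cy0; have [xy|yx] := leP x y.
      by rewrite ltr_wpDr// mulr_ge0// subr_ge0.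
    have : t * (x - y) <= x - y by rewrite ler_piMl// subr_ge0 ltW.
    lra.
  have gt_conv (x y t c : R) : 0 <= t <= 1 -> x < c -> y < c -> x + t * (y - x) < c.
    move=> t01 xc yc; have := lt_conv (- x) (- y) t (- c) t01; rewrite !ltrN2 => /(_ xc yc).
    lra.
  apply: convex_connected => u v t [? ? ? ?] [? ? ? ?] t01.
  by rewrite /box/= re_seg im_seg; split; (exact: lt_conv || exact: gt_conv).
have -> : punctured z e = ((box 0 e (- e) e `|` box (- e) e 0 e) `|` box (- e) 0 (- e) e) `|` box (- e) e (- e) 0.
  apply/seteqP; split=> u.
    move=> []; rewrite !ltr_norml -/(re u) -/(im u) => /andP[? ?] /andP[? ?] uz.
    have [r0|r0|r0] := ltgtP 0 (re u).
    - by left; left; left.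
    - by left; right.
    - have [s0|s0|s0] := ltgtP 0 (im u).
      + by left; left; right.
      + by right.
      + by case: uz; apply/eqP; rewrite -subr_eq0 eq_complex -/(re u) -/(im u) -r0 -s0 !eqxx.
  have nz : (re u != 0) || (im u != 0) -> cx u <> z.
    by move=> + uz; rewrite /re /im uz subrr /= eqxx.
  by case=> [[[|]|]|] [? ? ? ?]; split; rewrite ?ltr_norml -/(re u) -/(im u);
    try (apply/andP; split; lra); apply: nz; apply/orP;
    [left|right|left|right]; first [exact: lt0r_neq0|exact: ltr0_neq0].
pose c (x y : R) : U := pt (z + (x +i* y)%C).
have bc p q r s x y : p < x < q -> r < y < s -> box p q r s (c x y).
  move=> /andP[? ?] /andP[? ?]; rewrite /box/= /re /im ptK addrC addKr /=; by split.
have i1 : 0 < e / 2 < e by apply/andP; split; lra.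
have i2 : - e < - (e / 2) < 0 by apply/andP; split; lra.
have i3 : - e < e / 2 < e by apply/andP; split; lra.
have i4 : - e < - (e / 2) < e by apply/andP; split; lra.
apply: connectedU => //.
  exists (c (e / 2) (- (e / 2))); split; last exact: bc.
  by left; left; exact: bc.
apply: connectedU => //.
  exists (c (- (e / 2)) (e / 2)); split; last exact: bc.
  by right; exact: bc.
apply: connectedU => //.
by exists (c (e / 2) (e / 2)); split; exact: bc.
Qed.

(** Suppose that [y1] and [y2] are two points over [z] whose [j]-th coordinates
    differ. Over a punctured neighbourhood of [z] the model is the graph of a
    continuous map, which comes close to both points; by connectedness the
    distance of its [j]-th coordinate to that of [y1] takes every value [c] in
    between. Letting the neighbourhood shrink, [c] is attained in the fibre over
    [z], but this fibre is finite. *)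
Lemma coordinate_injective y1 y2 : Y y1 -> Y y2 -> co y1 i = co y2 i -> y1 = y2.
Proof.
move=> Y1 Y2 z12; apply: contrapT => ne; set z := co y1 i in z12.
have [j wj] : exists j, co y1 j <> co y2 j.
  by apply: contrapT => /forallNP h; apply: ne; apply/cspace_eqP => j; apply: contrapT; exact: h.
have [A [b [A0 b0 hA]]] := coordinate_proper.
(* The fibre over [z] is bounded and definable, hence finite. *)
have /choice[rs hrs] : forall k, exists s : seq C, forall y, Y y -> co y i = z -> co y k \in s.
  move=> k; have [P P0 [h|h]] := fiber_coordinate algY i k z.
    have [r r0 hr] := poly_nonzero_far P0.
    have c0 : 0 <= A * cm z + b + r + 1 by rewrite !addr_ge0// mulr_ge0 ?cm_ge0// ltW.
    have [|y Yy [yz yw]] := h ((A * cm z + b + r + 1)%:C)%C.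
      apply: hr; rewrite cm_real ger0_norm//.
      have : 0 <= A * cm z by rewrite mulr_ge0 ?cm_ge0// ltW.
      by lra.
    have := le_trans (co_le_nrm y k) (hA _ Yy).
    by rewrite yz yw cm_real ger0_norm//; lra.
  have [s [sE _]] := poly_split P; exists s => y Yy yz.
  by rewrite sE// rootE h.
(* A curve of the model that leaves [y] leaves the finite fibre of [y]. *)
have escape y y' e : Y y -> Y y' -> co y i = z -> y <> y' -> 0 < e -> exists x,
    [/\ Y x, mdist y x < e & co x i <> z].
  move=> Yy Yy' yz yy' e0; have [K K0 hK] := lne_curves lneY.
  have [g [cg g0 g1 Yg] _] := hK y y' Yy Yy' yy'.
  have /choice[gp hgp] : forall k, exists d : R, 0 < d /\ forall x, Y x -> co x i = z ->
      cm (co x k - co y k) < d -> co x k = co y k.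
    move=> k; have [d d0 hd] := @seq_gap R _ (rs k) (fun w => cm (w - co y k)).
    exists d; split => // x Yx xz; apply: contraPP => /eqP wk; apply/negP; rewrite -leNgt.
    by apply: hd; [exact: hrs|rewrite cm_gt0 subr_eq0].
  pose d := Num.min (Num.min e (mdist y y')) (\big[Order.min/1]_k gp k).
  have d0 : 0 < d.
    rewrite !lt_min e0 mdist_gt0; apply/andP; split; first by apply/eqP.
    by apply: lt_bigmin => // k _; exact: (hgp k).1.
  have i0 : `[0, 1]%classic (0 : R) by rewrite /= in_itv/= lexx ler01.
  have i1 : `[0, 1]%classic (1 : R) by rewrite /= in_itv/= lexx ler01.
  have cgc := (cont_on_curve _ _).1 cg.
  have cd : @cont_on R R^o R^o `[0, 1]%classic (fun t => mdist y (g t)).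
    apply: (@cont_on_comp R R^o (cspace R m) R^o `[0, 1]%classic setT g (mdist y)) => //.
    apply: (@cont_on_lip R _ R^o _ _ 1) => u v _ _; rewrite mdistRE mul1r.
    have := metric_triangle y u v; have := metric_triangle y v u.
    by rewrite (metric_sym v u) => ? ?; rewrite ler_norml; apply/andP; split; lra.
  have [||t t01 gt] := @connected_ivt R R^o `[0, 1]%classic (fun t => mdist y (g t)) 0 1 (d / 2)
     (@segment_connected R 0 1) cd i0 i1.
  - by rewrite g0 mdistxx divr_gt0.
  - rewrite g1; apply: (@lt_le_trans _ _ d).
      by rewrite ltr_pdivrMr// ltr_pMr// ltr1n.
    by rewrite !ge_min lexx orbT.
  have gd : mdist y (g t) < d by rewrite gt ltr_pdivrMr// ltr_pMr// ltr1n.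
  exists (g t); split.
  - exact: Yg.
  - by move: gd; rewrite !lt_min => /andP[/andP[]].
  move=> gz; have : g t = y.
    apply/cspace_eqP => k; apply: (hgp k).2 => //; first exact: Yg.
    rewrite cm_distC (le_lt_trans (co_le_mdist _ _ k))// (lt_le_trans gd)//.
    by rewrite ge_min bigmin_le_cond ?orbT.
  by move=> gy; move: gt; rewrite gy mdistxx => /eqP; rewrite eq_sym gt_eqF// divr_gt0.
pose w1 := co y1 j; pose D := cm (co y2 j - w1).
have D0 : 0 < D by rewrite cm_gt0 subr_eq0; apply/eqP => E; apply: wj; rewrite E.
have [gp gp0 hgp] := @seq_gap R _ (rs j) (fun w => cm (w - w1)).
pose c := Num.min gp D / 2.
have m0 : 0 < Num.min gp D by rewrite lt_min gp0.
have c0 : 0 < c by rewrite divr_gt0.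
have cg : c < gp /\ c < D.
  by apply/andP; rewrite -lt_min /c ltr_pdivrMr// ltr_pMr// ltr1n.
(* The points of the model where the value [c] is taken form a set whose projection
   is closed and does not contain [z]. *)
pose P : set (cspace R m) := [set y | cm (co y i - z) <= 1] `&`
  ([set y | cm (co y j - w1) <= c] `&` [set y | c <= cm (co y j - w1)]).
have cl : closed (zc @` (Y `&` P)).
  apply: (@image_closed _ (cm z + 1)).
    by apply: closedI; [exact: closed_co_le|apply: closedI; [exact: closed_co_le|exact: closed_co_ge]].
  by move=> y [/= h _]; rewrite (le_trans (cm_leD _ z))// lerD2l.
have [e e0 he] : exists2 e, 0 < e & forall y, Y y -> cm (co y i - z) < e -> cm (co y j - w1) <> c.
  apply: contrapT => hno.
  have : (zc @` (Y `&` P)) (pt z).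
    apply: ((closedP_mdist _).1 cl) => e e0; apply: contrapT => hno'.
    apply: hno; exists (Num.min e 1); first by rewrite lt_min e0 ltr01.
    move=> y Yy; rewrite lt_min => /andP[ye y1'] yc; apply: hno'; exists (zc y).
      by exists y => //; split => //; split; [exact: ltW|split; rewrite /= yc lexx].
    by rewrite mdist_cx !ptK cm_distC.
  move=> [y [Yy [_ [/= h1 h2]]] yz].
  have yiz : co y i = z by rewrite -[LHS]ptK -/(zc y) yz ptK.
  have yc : cm (co y j - w1) = c by apply/eqP; rewrite eq_le h1.
  have := hgp _ (hrs j y Yy yiz); rewrite yc => /(_ c0); rewrite leNgt.
  by rewrite cg.1.
have [Q [Q0 hQ1 hQ2]] := generically_bijective.
have [e' e'0 he'] : exists2 e', 0 < e' & forall x, cm (x - z) < e' -> x <> z -> Q.[x] != 0.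
  have [s [sE _]] := poly_split Q.
  have [d d0 hd] := @seq_gap R _ s (fun w => cm (w - z)).
  exists d => // x xd xz; apply/negP => Qx.
  have := hd x; rewrite sE// => /(_ Qx); rewrite cm_gt0 subr_eq0 leNgt xd.
  by move=> /(_ (introN eqP xz)).
pose d := Num.min e e' / 2.
have d0 : 0 < d by rewrite divr_gt0// lt_min e0.
have ring_near u : punctured z d u -> cm (cx u - z) < e /\ cm (cx u - z) < e'.
  move=> [u1 u2 _]; apply/andP; rewrite -lt_min; have := cm_le_ReIm (cx u - z).
  by move: u1 u2; rewrite /d; lra.
have /choice[sg hsg] : forall u : U, exists y, Y y /\ zc y = u.
  move=> u; have [y Yy yu] := coordinate_surjective (cx u).
  by exists y; rewrite /zc yu cxK.
have csg : cont_on (punctured z d) sg.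
  apply: unique_section_continuous => [u _|y Yy Sy]; first exact: hsg.
  have [Ys zs] := hsg (zc y); apply: hQ2 => //.
    by rewrite -[LHS]ptK -[RHS]ptK -!/(zc _) zs.
  have [_ h2] := ring_near _ Sy; case: Sy => _ _; rewrite ptK in h2 * => nz.
  exact: he'.
pose f (u : U) : R := cm (co (sg u) j - w1).
have cf : @cont_on R U R^o (punctured z d) f.
  apply: (@cont_on_comp R U (cspace R m) R^o (punctured z d) setT sg (fun y => cm (co y j - w1))) => //.
  apply: (@cont_on_lip R _ R^o _ _ 1) => x y _ _; rewrite mdistRE mul1r.
  have := cm_leD (co x j - w1) (co y j - w1); have := cm_leD (co y j - w1) (co x j - w1).
  have -> : co x j - w1 - (co y j - w1) = co x j - co y j by ring.
  have -> : co y j - w1 - (co x j - w1) = co y j - co x j by ring.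
  have := co_le_mdist x y j; rewrite (cm_distC (co y j) (co x j)) => ? ? ?.
  by rewrite ler_norml; apply/andP; split; lra.
have in_ring y y0 : Y y -> co y0 i = z -> mdist y0 y < d -> co y i <> z -> punctured z d (zc y) /\ sg (zc y) = y.
  move=> Yy y0z yd yz.
  have h : cm (co y i - z) < d.
    by rewrite cm_distC -y0z; apply: le_lt_trans yd; exact: co_le_mdist.
  have ry : punctured z d (zc y).
    by split; rewrite ptK //; apply: le_lt_trans h; [exact: Re_le_cm|exact: Im_le_cm].
  split => //; have [Ys zs] := hsg (zc y); apply: hQ2 => //.
    by rewrite -[LHS]ptK -[RHS]ptK -!/(zc _) zs.
  rewrite -[co (sg _) i]ptK -/(zc (sg _)) zs; apply: he' => //.
    by have [] := ring_near _ ry.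
  by rewrite ptK.
have d1 : 0 < Num.min d c by rewrite lt_min d0 c0.
have d2 : 0 < Num.min d (D - c) by rewrite lt_min d0 subr_gt0 cg.2.
have [x1 [X1 x1d x1z]] := escape y1 y2 _ Y1 Y2 erefl ne d1.
have [x2 [X2 x2d x2z]] := escape y2 y1 _ Y2 Y1 (esym z12) (fun E => ne (esym E)) d2.
move: x1d x2d; rewrite !lt_min => /andP[x1d x1c] /andP[x2d x2c].
have [r1 s1] := in_ring x1 y1 X1 erefl x1d x1z.
have [r2 s2] := in_ring x2 y2 X2 (esym z12) x2d x2z.
have f1 : f (zc x1) < c.
  by rewrite /f s1 cm_distC; apply: le_lt_trans x1c; exact: co_le_mdist.
have f2 : c < f (zc x2).
  rewrite /f s2; have := co_le_mdist y2 x2 j.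
  have := cm_leD (co y2 j - w1) (co x2 j - w1).
  have -> : co y2 j - w1 - (co x2 j - w1) = co y2 j - co x2 j by ring.
  by rewrite -/D; lra.
have [u ru fu] := connected_ivt (@punctured_connected z d d0) cf r1 r2 f1 f2.
have [Yu zu] := hsg u.
apply: (he _ Yu _ fu); rewrite -[co _ i]ptK -/(zc _) zu.
by have [] := ring_near _ ru.
Qed.

Lemma model_is_graph : exists sg : U -> cspace R m,
  [/\ forall u, Y (sg u), forall y, Y y -> sg (zc y) = y & cont_on setT sg].
Proof.
have /choice[sg hsg] : forall u : U, exists y, Y y /\ zc y = u.
  move=> u; have [y Yy yu] := coordinate_surjective (cx u).
  by exists y; rewrite /zc yu cxK.
have inv y : Y y -> sg (zc y) = y.
  move=> Yy; have [Ys zs] := hsg (zc y); apply: coordinate_injective => //.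
  by rewrite -[LHS]ptK -[RHS]ptK -!/(zc _) zs.
exists sg; split => //; first by move=> u; have [] := hsg u.
by apply: unique_section_continuous => [u _|y Yy _]; [exact: hsg|rewrite inv].
Qed.

End Graph.

(** * The curve is not a topological plane *)

Section DoubleCover.
Variable R : realType.
Local Notation C := R[i].
Local Notation U := (cspace R 1).
Local Notation X := (@curve R).
Local Notation i0 := (ord0 : 'I_2).
Local Notation i1 := (lift ord0 ord0 : 'I_2).

(** The point [v] = (t, s) of the curve s^2 = 1 - t^4 lies above [p] = (t^2, t s). *)
Let above (p v : cspace R 2) : Prop :=
  [/\ co v i0 ^+ 2 = co p i0, co v i0 * co v i1 = co p i1 &
      co v i1 ^+ 2 = 1 - co p i0 ^+ 2].

Let above_nonempty p : X p -> exists v, above p v.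
Proof.
move=> cp; have [x0|x0] := eqVneq (co p i0) 0.
  have y0 : co p i1 = 0.
    by apply/eqP; rewrite -sqrf_eq0 [_ ^+ 2]cp x0 expr0n subr0.
  by exists (mk 0 1); split; rewrite ?co_mk0 ?co_mk1 ?x0 ?y0 ?expr0n ?mul0r ?expr1n ?subr0.
pose t := sqrtc (co p i0); have t2 : t ^+ 2 = co p i0 by rewrite sqr_sqrtc.
have t0 : t != 0 by rewrite -sqrf_eq0 t2.
exists (mk t (co p i1 / t)); split; rewrite ?co_mk0 ?co_mk1 //.
  by rewrite mulrC divfK.
rewrite expr_div_n t2 [co p i1 ^+ 2]cp; field.
exact: x0.
Qed.

Let opp2 (v : cspace R 2) : cspace R 2 := mk (- co v i0) (- co v i1).

Let above_opp p v : above p v -> above p (opp2 v).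
Proof. by move=> [a b c]; split; rewrite /opp2 ?co_mk0 ?co_mk1 ?sqrrN ?mulrNN. Qed.

(** The monomials of degree 2 in (t, s) determine (t, s) up to sign, continuously:
    the products of a coordinate of [v - w] with one of [v + w] are differences of
    such monomials, up to the determinant of [v] and [w], the square of which is
    again a combination of such differences. *)
Let sign_close (v w : cspace R 2) (e : R) : 0 < e ->
  cm (co v i0 ^+ 2 - co w i0 ^+ 2) < e ^+ 2 / 64 ->
  cm (co v i0 * co v i1 - co w i0 * co w i1) < e ^+ 2 / 64 ->
  cm (co v i1 ^+ 2 - co w i1 ^+ 2) < e ^+ 2 / 64 ->
  mdist v w < e \/ mdist v (opp2 w) < e.
Proof.
move=> e0; set t := co v i0; set s := co v i1; set t' := co w i0; set s' := co w i1.
set eta := e ^+ 2 / 64 => h1 h2 h3.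
have eta0 : 0 < eta by rewrite divr_gt0// exprn_gt0.
have etaE : 64 * eta = e ^+ 2 by rewrite /eta; field.
clearbody eta.
pose c := t * s' - t' * s.
have cE : c ^+ 2 = (t * s - t' * s') ^+ 2 - (t ^+ 2 - t' ^+ 2) * (s ^+ 2 - s' ^+ 2).
  by rewrite /c; ring.
have e01 : (t - t') * (s + s') = (t * s - t' * s') + c by rewrite /c; ring.
have e10 : (s - s') * (t + t') = (t * s - t' * s') - c by rewrite /c; ring.
clearbody c.
have cc : cm c < 2 * eta.
  rewrite -(@ltr_pXn2r _ 2)// ?nnegrE ?cm_ge0 ?mulr_ge0 ?(ltW eta0)//.
  rewrite -cmX cE; apply: (le_lt_trans (cmB _ _)); rewrite cmX cmM.
  have := cm_ge0 (t * s - t' * s'); have := cm_ge0 (t ^+ 2 - t' ^+ 2); have := cm_ge0 (s ^+ 2 - s' ^+ 2).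
  clear etaE; move: h1 h2 h3 eta0; move: (cm (t * s - t' * s')) (cm (t ^+ 2 - t' ^+ 2)) (cm (s ^+ 2 - s' ^+ 2)) eta.
  by move=> x y z eta; nra.
have p00 : cm (t - t') * cm (t + t') <= 3 * eta by rewrite -cmM -subr_sqr; lra.
have p11 : cm (s - s') * cm (s + s') <= 3 * eta by rewrite -cmM -subr_sqr; lra.
have p01 : cm (t - t') * cm (s + s') <= 3 * eta.
  by rewrite -cmM e01; apply: (le_trans (cmD _ _)); lra.
have p10 : cm (s - s') * cm (t + t') <= 3 * eta.
  by rewrite -cmM e10; apply: (le_trans (cmB _ _)); lra.
have small (x y : R) : e / 4 <= x -> 0 <= y -> x * y <= 3 * eta -> y < e / 2.
  move=> xe y0 xy; rewrite ltNge; apply/negP => ye.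
  by nra.
have far (x y z : R) : e / 4 <= x -> 0 <= y -> 0 <= z -> x * y <= 3 * eta -> x * z <= 3 * eta ->
    y + z < e.
  by move=> xe y0 z0 /(small _ _ xe y0) ? /(small _ _ xe z0) ?; lra.
have oppE : mdist v (opp2 w) <= cm (t + t') + cm (s + s').
  by rewrite (le_trans (mdist2_le _ _))// /opp2 co_mk0 co_mk1 !opprK.
have [a1|a1] := leP (e / 4) (cm (t - t')).
  by right; apply: (le_lt_trans oppE); apply: (far _ _ _ a1); rewrite ?cm_ge0.
have [a2|a2] := leP (e / 4) (cm (s - s')).
  by right; apply: (le_lt_trans oppE); apply: (far _ _ _ a2); rewrite ?cm_ge0.
left; apply: (le_lt_trans (mdist2_le _ _)); rewrite -/t -/t' -/s -/s'; lra.
Qed.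

Let above_near p q v w e : 0 < e -> above p v -> above q w ->
  cm (co p i0 - co q i0) < e ^+ 2 / 64 -> cm (co p i1 - co q i1) < e ^+ 2 / 64 ->
  cm (co p i0 ^+ 2 - co q i0 ^+ 2) < e ^+ 2 / 64 ->
  mdist v w < e \/ mdist v (opp2 w) < e.
Proof.
move=> e0 [a b c] [a' b' c'] h1 h2 h3; apply: sign_close; rewrite ?a ?b ?c ?a' ?b' ?c'//.
by rewrite opprB addrC addrA subrK cm_distC.
Qed.

(* Opposite points above [p] are distant since t^4 + s^2 = 1. *)
Let above_separated p v w : above p v -> above p w -> mdist v w < 1 / 2 -> v = w.
Proof.
move=> av aw vw; apply/mdist_positivity/eqP.
apply/negPn/negP => d0; have {}d0 : 0 < mdist v w by rewrite lt_neqAle eq_sym d0 mdist_ge0.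
have e0 : 0 < Num.min (mdist v w) (1 / 4) by rewrite lt_min d0 divr_gt0.
have z0 (x : C) : cm (x - x) < Num.min (mdist v w) (1 / 4) ^+ 2 / 64.
  by rewrite subrr cm0 divr_gt0// exprn_gt0.
case: (above_near e0 av aw (z0 _) (z0 _) (z0 _)); rewrite lt_min ?ltxx// => /andP[_ vo].
have h0 := le_lt_trans (co_le_mdist _ _ i0) vw; have h1 := le_lt_trans (co_le_mdist _ _ i1) vw.
have k0 := le_lt_trans (co_le_mdist _ _ i0) vo; have k1 := le_lt_trans (co_le_mdist _ _ i1) vo.
rewrite /opp2 co_mk0 ?opprK in k0; rewrite /opp2 co_mk1 ?opprK in k1.
have half (x y : C) : cm (x - y) < 1 / 2 -> cm (x + y) < 1 / 4 -> cm x < 3 / 8.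
  move=> h k; have := cmD (x - y) (x + y).
  have -> : x - y + (x + y) = 2 * x by ring.
  rewrite cmM (_ : cm 2 = 2); first by lra.
  by rewrite -[2 : C](rmorph_nat (real_complex R)) cm_real ger0_norm.
have [a _ c] := av.
have v0 := half _ _ h0 k0; have v1 := half _ _ h1 k1.
have : cm 1 <= cm (co v i1 ^+ 2) + cm (co v i0 ^+ 2 ^+ 2).
  by rewrite c a -[X in cm X <= _](subrK (co p i0 ^+ 2)) cmD.
rewrite cm1 !cmX -exprM; move: (cm_ge0 (co v i0)) (cm_ge0 (co v i1)) v0 v1.
move: (cm (co v i0)) (cm (co v i1)) => x y x0 y0 x1 y1.
have x2 : x ^+ 2 <= 9 / 64 by nra.
have y2 : y ^+ 2 <= 9 / 64 by nra.
have x4 : x ^+ (2 * 2) <= 9 / 64 by rewrite exprM; nra.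
lra.
Qed.

(** A path in the covering between opposite points; it covers a loop of the curve. *)
Let path (t : R) : cspace R 2 :=
  mk ((2 * t - 1)%:C)%C ((Num.sqrt (1 - (2 * t - 1) ^+ 4))%:C)%C.

Let loop (t : R) : cspace R 2 := mk (co (path t) i0 ^+ 2) (co (path t) i0 * co (path t) i1).

Let radicand_ge0 (t : R) : 0 <= t <= 1 -> 0 <= 1 - (2 * t - 1) ^+ 4.
Proof.
move=> /andP[t0 t1]; rewrite subr_ge0 (_ : 4 = 2 * 2)%N// exprM.
have h1 : (2 * t - 1) ^+ 2 <= 1 by nra.
have h2 : 0 <= (2 * t - 1) ^+ 2 by rewrite sqr_ge0.
by move: h1 h2; move: ((2 * t - 1) ^+ 2) => x; nra.
Qed.

Let path_above t : t \in `[0, 1] -> above (loop t) (path t).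
Proof.
rewrite in_itv/= => t01; split; rewrite /loop ?co_mk0 ?co_mk1 //.
rewrite -rmorphXn/= sqr_sqrtr ?radicand_ge0// rmorphB rmorph1 rmorphXn/=.
by rewrite -exprM.
Qed.

Let loop_curve t : t \in `[0, 1] -> X (loop t).
Proof.
move=> /path_above[a b c]; rewrite /curve/= -a -b exprMn c -a; ring.
Qed.

Let ccont_real (f : R -> R) : @cont_on R R^o R^o `[0, 1] f ->
  @ccont R R^o `[0, 1] (fun t => ((f t)%:C)%C).
Proof.
move=> cf t t01 e e0; have [d d0 hd] := cf t t01 e e0; exists d => // s s01 ts.
by rewrite -rmorphB cm_real distrC; exact: hd.
Qed.

Let path_cont : @cont_on R R^o (cspace R 2) `[0, 1] path.
Proof.
have cl : continuous (fun t : R => 2 * t - 1).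
  by move=> t; apply: cvgB; [apply: cvgM; [exact: cvg_cst|exact: cvg_id]|exact: cvg_cst].
have c4 : continuous (fun t : R => (2 * t - 1) ^+ 4).
  rewrite (_ : (fun t : R => _) = fun t => (2 * t - 1) * ((2 * t - 1) * ((2 * t - 1) * (2 * t - 1)))).
    by move=> t; do 3 (apply: cvgM; first exact: cl); exact: cl.
  by apply/funext => t; ring.
apply: cont_on_ccont; apply: ord2P.
  apply: (@ccont_ext R R^o _ (fun t : R => ((2 * t - 1)%:C)%C)); first by move=> t; rewrite co_mk0.
  by apply: ccont_real; apply/cont_on_curve/continuous_subspaceT.
apply: (@ccont_ext R R^o _ (fun t : R => ((Num.sqrt (1 - (2 * t - 1) ^+ 4))%:C)%C)).
  by move=> t; rewrite co_mk1.
apply: ccont_real; apply/cont_on_curve/continuous_subspaceT => t.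
apply: continuous_cvg; first exact: sqrt_continuous.
apply: cvgB; first exact: cvg_cst.
exact: c4.
Qed.

Let loop_cont : @cont_on R R^o (cspace R 2) `[0, 1] loop.
Proof.
have c0 := ccont_cont_on i0 path_cont; have c1 := ccont_cont_on i1 path_cont.
apply: cont_on_ccont; apply: ord2P.
  apply: (@ccont_ext R R^o _ (fun t : R => co (path t) i0 ^+ 2)); first by move=> t; rewrite /loop [RHS]co_mk0.
  exact: ccontX.
apply: (@ccont_ext R R^o _ (fun t : R => co (path t) i0 * co (path t) i1)); first by move=> t; rewrite /loop [RHS]co_mk1.
exact: ccontM.
Qed.

(** The pullback of the double covering by [H] is trivial over rectangles, so the
    loop would lift to a closed path. *)
Lemma curve_not_plane (G : cspace R 2 -> U) (H : U -> cspace R 2) :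
  cont_on X G -> cont_on setT H -> (forall u, X (H u)) -> (forall p, X p -> H (G p) = p) ->
  False.
Proof.
move=> cG cH XH HG.
have cz : @cont_on R R^o U `[0, 1] (G \o loop).
  exact: (@cont_on_comp R R^o (cspace R 2) U `[0, 1]%classic X loop G loop_curve loop_cont cG).
have cseg : compact (`[0, 1]%classic : set R^o) by exact: segment_compact.
have [M hM] := compact_bounded_from (pt 0) (compact_image cseg cz).
have close u0 e : 0 < e -> exists2 d, 0 < d & forall u, mdist u0 u < d ->
   [/\ cm (co (H u) i0 - co (H u0) i0) < e, cm (co (H u) i1 - co (H u0) i1) < e &
       cm (co (H u) i0 ^+ 2 - co (H u0) i0 ^+ 2) < e].
  move=> e0; have [d0 d00 h0] := ccont_cont_on i0 cH I e0 (x := u0).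
  have [d1 d10 h1] := ccont_cont_on i1 cH I e0 (x := u0).
  have [d2 d20 h2] := ccontX 2 (ccont_cont_on i0 cH) I e0 (x := u0).
  exists (Num.min d0 (Num.min d1 d2)); first by rewrite !lt_min d00 d10.
  by move=> u; rewrite !lt_min => /and3P[? ? ?]; split; rewrite cm_distC; [exact: h0|exact: h1|exact: h2].
have near u0 e : 0 < e -> exists2 d, 0 < d & forall u, mdist u0 u < d -> forall v v0,
    above (H u) v -> above (H u0) v0 -> mdist v v0 < e \/ mdist v (opp2 v0) < e.
  move=> e0; have e10 : 0 < e ^+ 2 / 64 by rewrite divr_gt0// exprn_gt0.
  have [d d0 hd] := close u0 _ e10; exists d => // u /hd[? ? ?] v v0 av av0.
  exact: above_near av av0 _ _ _.
have opp_dist v v0 : mdist (opp2 v) v0 = mdist v (opp2 v0).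
  rewrite !mdist_sqrt; congr Num.sqrt; apply: eq_bigr; apply: ord2P => _;
    by rewrite /opp2 ?co_mk0 ?co_mk1 -cmN opprB opprK addrC opprK.
have t0 : (0 : R) \in `[0, 1] by rewrite in_itv/= lexx ler01.
have loop01 : loop 0 = loop 1.
  rewrite /loop /path !co_mk0 !co_mk1; congr mk.
    by rewrite mulr0 sub0r mulr1 rmorphN/= sqrrN (_ : 2 - 1 = 1 :> R); [|ring].
  rewrite mulr0 sub0r mulr1 (_ : 2 - 1 = 1 :> R); last by ring.
  by rewrite -signr_odd/= expr0 expr1n subrr sqrtr0 !mulr0.
suff : path 0 = path 1.
  move=> /(congr1 (fun v => co v i0)); rewrite /path !co_mk0 mulr0 sub0r mulr1.
  move=> /complexI /eqP; rewrite (_ : 2 - 1 = 1 :> R); last by ring.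
  by rewrite eq_sym -subr_eq0 opprK -[1 + 1]/(2%:R) pnatr_eq0.
apply: (@rect_lift_closes R (cspace R 2) (fun u v => above (H u) v) (- M) M (- M) M
  _ _ (G \o loop) path cz path_cont).
- move=> u0 _ e e0; have [d d0 hd] := near u0 e e0; exists d => // u _ uu; split.
    move=> v av; have [v0 av0] := above_nonempty (XH u0).
    by case: (hd u uu v v0 av av0) => ?; [exists v0|exists (opp2 v0) => //; exact: above_opp].
  move=> v0 av0; have [v av] := above_nonempty (XH u).
  case: (hd u uu v v0 av av0) => ?; first by exists v.
  by exists (opp2 v); [exact: above_opp|rewrite opp_dist].
- move=> u0 _; exists (1 / 2); first by rewrite divr_gt0.
  by exists 1 => // u _ _ v v'; exact: above_separated.
- move=> t t01; split; last by rewrite /= HG; [exact: path_above|exact: loop_curve].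
  have : mdist (pt 0) (G (loop t)) <= M by apply: hM; exists t.
  rewrite mdist_cx ptK sub0r cmN => h.
  have := le_trans (Re_le_cm _) h; have := le_trans (Im_le_cm _) h.
  by rewrite !ler_norml => /andP[? ?] /andP[? ?]; split.
- by rewrite /= loop01.
Qed.

End DoubleCover.

Theorem theorem4p1 (R : realType) :
  exists (n : nat) (X : set (cspace R n)),
    smooth_affine_curve X /\ connected X /\
    forall m : nat,
      ~ exists Y : set (cspace R m), algebraic_set Y /\ LNE_model X Y.
Proof.
exists 2%N, (@curve R); split; last split.
- by split; [exact: algebraic_curve|exact: curve_dim|exact: curve_smooth].
- exact: curve_connected_set.
move=> m [Y [algY [F [YE lneY bilF]]]].
have [i [a [_ dir_a]]] := single_direction algY YE lneY bilF.
have [sg [Ysg sgK csg]] := model_is_graph algY YE lneY bilF dir_a.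
have [K K0 invF] := model_inverse_lipschitz YE lneY bilF.
have /choice[F' hF'] : forall y, exists p, Y y -> curve p /\ F p = y.
  move=> y; have [Yy|nY] := pselect (Y y); last by exists (mk 0 0).
  by move: Yy; rewrite YE => -[p cp py]; exists p.
have FY p : curve p -> Y (F p) by move=> cp; rewrite YE; exists p.
apply: (@curve_not_plane R (fun p => pt (co (F p) i)) (F' \o sg)).
- apply: (@cont_on_comp _ _ _ _ _ setT F (fun y => pt (co y i))) => //.
    exact: model_cont bilF.
  by apply: (@cont_on_lip _ _ _ _ _ 1) => x y _ _; rewrite mul1r mdist_cx !ptK co_le_mdist.
- apply: (@cont_on_comp _ _ _ _ setT Y sg F') => //.
  apply: (@cont_on_lip _ _ _ _ _ K) => x y Yx Yy.
  have [cx' xE] := hF' x Yx; have [cy' yE] := hF' y Yy.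
  by rewrite -{2}xE -{2}yE; exact: invF.
- by move=> u; have [] := hF' _ (Ysg u).
move=> p cp; rewrite /= sgK; last exact: FY.
have [cq qE] := hF' _ (FY _ cp).
apply: mdist_positivity; apply/eqP; rewrite eq_le mdist_ge0 andbT.
by have := invF _ _ cq cp; rewrite qE mdistxx mulr0.
Qed.
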